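(* Let $\alpha\ge1$ and $\beta>1$. Then there is a constant $c$, depending only on $\alpha$ and $\beta$, such that the following holds for every positive integer $N$ and every real-valued trigonometric polynomial $f$ on $\mathbb{T}^N$ with $\int_{\mathbb{T}^N}f\,dP=0$, with the Brownian maximal functions $F^*$ and $G^*$ (associated with $f$ and with $g=f+iH(f)$ respectively) defined in the context: whenever $\lambda>0$ satisfies $$P(G^*>\lambda)\le\alpha\,P(G^*>\beta\lambda),$$ then $$P(G^*>\lambda)\le c\,P(c\,F^*>\lambda).$$
   Context: $\mathbb{T}=\{z\in\mathbb{C}:|z|=1\}$ and $P$ is normalized Lebesgue measure on $\mathbb{T}^N$; $P$ also denotes the probability on the space carrying the Brownian motions below (this is its meaning in the two inequalities of the claim). For a function $f$ on $\mathbb{T}^N$, let $\mathcal{F}_n$ be the $\sigma$-algebra generated by the first $n$ coordinate functions ($\mathcal{F}_0$ trivial), $d_0(f)=\int f\,dP$, and $d_j(f)=\mathbb{E}(f|\mathcal{F}_j)-\mathbb{E}(f|\mathcal{F}_{j-1})$ for $1\le j\le N$. For $1\le j\le N$, $H_j$ is the conjugate function operator in the $j$-th variable, $\widehat{H_j(f)}(z_1,\dots,z_N)=-i\,\mathrm{sgn}(z_j)\widehat f(z_1,\dots,z_N)$ for $(z_1,\dots,z_N)\in\mathbb{Z}^N$ (with $\mathrm{sgn}(0)=0$), and $H(f)=\sum_{j=1}^N H_j(d_j(f))$, which is again a trigonometric polynomial when $f$ is. Extension: a trigonometric polynomial $u(\theta_1,\dots,\theta_N)=\sum a_{j_1,\dots,j_N}\theta_1^{j_1}\cdots\theta_N^{j_N}$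 ($\theta_n\in\mathbb{T}$) is extended to a function on $\mathbb{C}^N$, harmonic in each variable, by $u(r_1\theta_1,\dots,r_N\theta_N)=\sum a_{j_1,\dots,j_N} r_1^{|j_1|}\theta_1^{j_1}\cdots r_N^{|j_N|}\theta_N^{j_N}$ for $r_n\ge0$, $\theta_n\in\mathbb{T}$. Time set: $\mathcal{T}=\{1,2,\dots,N\}\times[0,\infty)$ with the lexicographic order: $(m,s)<(n,t)$ iff $m<n$, or $m=n$ and $s<t$; $\infty$ is an additional largest element. Let $c_{n,t}$ ($1\le n\le N$, $t\ge0$) be $N$ independent complex Brownian motions, each starting at $0$, and let $\tau_n=\inf\{t:|c_{n,t}|\ge1\}$. Define $$F_{n,t}=f(c_{1,\tau_1},\dots,c_{n-1,\tau_{n-1}},c_{n,\tau_n\wedge t},0,\dots,0),\qquad F_\infty=f(c_{1,\tau_1},\dots,c_{N,\tau_N}),$$ and let $G_{n,t}$, $G_\infty$ be defined by the same formulas with $g=f+iH(f)$ in place of $f$. The Brownian maximal functions are $F^*=\sup_{\kappa\in\mathcal{T}\cup\{\infty\}}|F_\kappa|$ and $G^*=\sup_{\kappa\in\mathcal{T}\cup\{\infty\}}|G_\kappa|$. *)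

(* Defs.v *)
From HB Require Import structures.
From mathcomp Require Import all_boot all_order all_algebra.
From mathcomp Require Import all_classical all_reals all_analysis.
From mathcomp Require Import measurable_realfun lebesgue_integral_fubini.
From mathcomp.real_closed Require Export complex.

Set Implicit Arguments.
Unset Strict Implicit.
Unset Printing Implicit Defensive.

Import Order.TTheory GRing.Theory Num.Theory.
Import numFieldNormedType.Exports.
Import ComplexField.Normc.

Local Open Scope classical_set_scope.
Local Open Scope ring_scope.
Local Open Scope complex_scope.

(* Throughout, R[i] is the field of complex numbers and [normc z : R] is the
   modulus of z; the norm `|z| is the same number seen in R[i]. *)

(** * Complex-valued measurable functions and integrals *)

(* The Borel sets of R[i], by identification with R * R. *)
Section complex_measurable.
Context (R : realType).

Definition complex_pair (z : R[i]) : R * R := (complex.Re z, complex.Im z).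

HB.instance Definition _ := isPointed.Build R[i] 0.

HB.instance Definition _ := Measurable.copy R[i]
  (g_sigma_algebra_preimageType complex_pair).

Lemma measurable_complex_pair : measurable_fun [set: R[i]] complex_pair.
Proof. by move=> _ A mA; rewrite setTI; exists A => //; rewrite setTI. Qed.

Lemma measurable_Complex d (T : measurableType d) (x y : T -> R) :
  measurable_fun setT x -> measurable_fun setT y ->
  measurable_fun setT (fun t => x t +i* y t).
Proof.
move=> mx my _ _ [A mA <-]; rewrite !setTI.
rewrite (_ : _ @^-1` _ = setT `&` (fun t => (x t, y t)) @^-1` A).
  exact: (measurable_fun_pair mx my).
by rewrite setTI.
Qed.

End complex_measurable.

Definition complex_integrable d (T : measurableType d) (R : realType)
    (mu : {measure set T -> \bar R}) (f : T -> R[i]) : Prop :=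
  mu.-integrable setT (fun x => (complex.Re (f x))%:E) /\
  mu.-integrable setT (fun x => (complex.Im (f x))%:E).

Definition complex_integral d (T : measurableType d) (R : realType)
    (mu : {measure set T -> \bar R}) (A : set T) (f : T -> R[i]) : R[i] :=
  (\int[mu]_(x in A) complex.Re (f x)) +i*
  (\int[mu]_(x in A) complex.Im (f x)).

(* h is a version of the conditional expectation E(f | G). *)
Definition is_cond_exp d (T : measurableType d) (R : realType)
    (P : probability T R) (G : set (set T)) (f h : T -> R[i]) : Prop :=
  [/\ complex_integrable P h,
      forall B : set R[i], measurable B -> G (h @^-1` B) &
      forall A : set T, G A ->
        complex_integral P A h = complex_integral P A f].

(** * Normalized Lebesgue measure on the torus *)

(* T^N is regarded as the subset {|z_1| = ... = |z_N| = 1} of C^N, and its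
   normalized Lebesgue measure as a probability on C^N carried by T^N. *)
Section torus.
Context (R : realType).

Lemma two_pi_gt0 : (0 : R) < pi *+ 2.
Proof. by rewrite pmulrn_lgt0// pi_gt0. Qed.

Definition cis (t : measurableTypeR R) : R[i] := cos t +i* sin t.

Lemma measurable_cis : measurable_fun setT cis.
Proof.
apply: measurable_Complex; apply: continuous_measurable_fun.
- exact: continuous_cos.
- exact: continuous_sin.
Qed.

HB.instance Definition _ :=
  @isMeasurableFun.Build _ _ (measurableTypeR R) R[i] cis measurable_cis.

Definition circle_prob : probability R[i] R :=
  distribution (uniform_prob two_pi_gt0) cis.

Definition tuple_cons n (x : R[i] * n.-tuple R[i]) : n.+1.-tuple R[i] :=
  [the n.+1.-tuple R[i] of x.1 :: x.2].

Lemma measurable_tuple_cons n : measurable_fun setT (@tuple_cons n).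
Proof. exact: measurable_cons. Qed.

HB.instance Definition _ n :=
  @isMeasurableFun.Build _ _ _ _ (@tuple_cons n) (@measurable_tuple_cons n).

Fixpoint torus_prob N : probability (N.-tuple R[i]) R :=
  match N with
  | 0 => \d_[tuple]
  | n.+1 => distribution (circle_prob \x torus_prob n)%E (@tuple_cons n)
  end.

(* The sigma-algebra generated by the first n coordinate functions. *)
Definition coord_sigma N (n : nat) : set (set (N.-tuple R[i])) :=
  <<s [set A | exists i : 'I_N, (i < n)%N /\
        exists2 B : set R[i], measurable B &
          A = [set z : N.-tuple R[i] | B (tnth z i)]] >>.

End torus.

(** * Trigonometric polynomials *)

Section trig_poly.
Context (R : realType) (N : nat).

(* A trigonometric polynomial is given by its (finitely supported) family of
   Fourier coefficients, indexed by Z^N. *)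
Definition coefs := {ffun 'I_N -> int} -> R[i].

Definition is_trig_poly (a : coefs) : Prop := finite_set [set k | a k != 0].

(* The extension to C^N, harmonic in each variable: with z_n = r_n theta_n the
   n-th factor is r_n^|k_n| theta_n^(k_n).  At z_n = 0 (where z_n / |z_n| = 0)
   this is 0 if k_n <> 0 and 1 if k_n = 0, as it should. *)
Definition trig_eval (a : coefs) (z : N.-tuple R[i]) : R[i] :=
  \sum_(k \in [set k | a k != 0]) a k *
    \prod_(n < N) (`|tnth z n| ^+ `|k n|%N *
                   (tnth z n / `|tnth z n|) ^ (k n)).

Definition on_torus (z : N.-tuple R[i]) : Prop :=
  forall n, normc (tnth z n) = 1.

Definition real_on_torus (a : coefs) : Prop :=
  forall z, on_torus z -> complex.Im (trig_eval a z) = 0.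

Definition torus_mean (a : coefs) : R[i] :=
  complex_integral (torus_prob R N) setT (trig_eval a).

(* E(a | F_n): the trigonometric polynomial which is a version of the
   conditional expectation (it exists, and it is unique since trigonometric
   polynomials agreeing almost everywhere on T^N have the same coefficients). *)
Definition trig_cond_exp (n : nat) (a : coefs) : coefs :=
  xget 0 [set e : coefs | is_trig_poly e /\
    is_cond_exp (torus_prob R N) (@coord_sigma R N n)
      (trig_eval a) (trig_eval e)].

(* Variables are numbered from 0: for j : 'I_N, [trig_diff j] is d_{j+1} and
   [conj_fun j] is H_{j+1}. *)
Definition trig_diff (j : 'I_N) (a : coefs) : coefs :=
  trig_cond_exp j.+1 a - trig_cond_exp j a.

Definition conj_fun (j : 'I_N) (a : coefs) : coefs :=
  fun k => - 'i%C * (sgz (k j))%:~R * a k.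

Definition conj_op (a : coefs) : coefs :=
  \sum_(j < N) conj_fun j (trig_diff j a).

Definition analytic_completion (a : coefs) : coefs :=
  fun k => a k + 'i%C * conj_op a k.

End trig_poly.

(** * Brownian motion *)

Section brownian.
Context d (Omega : measurableType d) (R : realType) (P : probability Omega R).

(* Mutual independence of a finite family of classes of events. *)
Definition mutually_independent (I : finType) (S : I -> set (set Omega)) : Prop :=
  forall (J : {set I}) (A : I -> set Omega),
    (forall i, i \in J -> S i (A i)) ->
    P (\bigcap_(i in [set i | i \in J]) A i) = (\prod_(i in J) P (A i))%E.

Definition rv_sigma d' (T' : measurableType d') (X : Omega -> T') :
    set (set Omega) :=
  [set A | exists2 B : set T', measurable B & A = X @^-1` B].

(* The sigma-algebra generated by a process indexed by [0, +oo[; values at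
   negative times are irrelevant throughout. *)
Definition process_sigma d' (T' : measurableType d') (X : R -> Omega -> T') :
    set (set Omega) :=
  <<s [set A | exists2 t : R, 0 <= t & rv_sigma (X t) A] >>.

(* Standard real Brownian motion started at 0, with continuous paths. *)
Definition brownian_motion (X : R -> Omega -> R) : Prop :=
  [/\ forall t, 0 <= t -> measurable_fun setT (X t),
      forall w, X 0 w = 0,
      forall w, {within `[0, +oo[, continuous (X ^~ w)},
      forall s t, 0 <= s -> s < t -> forall A : set R, measurable A ->
        P [set w | A (X t w - X s w)] = normal_prob 0 (Num.sqrt (t - s)) A &
      forall (n : nat) (t : nat -> R), 0 <= t 0%N ->
        (forall i, t i <= t i.+1) ->
        mutually_independent
          (fun i : 'I_n => rv_sigma (fun w => X (t i.+1) w - X (t i) w))].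

(* The real and imaginary parts are independent standard Brownian motions. *)
Definition complex_brownian_motion (c : R -> Omega -> R[i]) : Prop :=
  let re t w := complex.Re (c t w) in
  let im t w := complex.Im (c t w) in
  [/\ brownian_motion re, brownian_motion im &
      mutually_independent
        (fun b : bool => process_sigma (if b then re else im))].

Definition independent_complex_bm (N : nat) (c : 'I_N -> R -> Omega -> R[i]) :
    Prop :=
  (forall n, complex_brownian_motion (c n)) /\
  mutually_independent (fun n => process_sigma (c n)).

(* inf {t : |c_t| >= 1}, which is +oo when the path stays in the unit disc. *)
Definition exit_time (c : R -> Omega -> R[i]) (w : Omega) : \bar R :=
  ereal_inf [set t%:E | t in [set t : R | 0 <= t /\ 1 <= normc (c t w)]].

(* c_tau; on the null event {tau = +oo} the value is c_0. *)
Definition exit_point (c : R -> Omega -> R[i]) (w : Omega) : R[i] :=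
  c (fine (exit_time c w)) w.

(* c_{tau /\ t} *)
Definition stopped (c : R -> Omega -> R[i]) (t : R) (w : Omega) : R[i] :=
  c (fine (Order.min (exit_time c w) t%:E)) w.

Section maximal_function.
Context (N : nat) (c : 'I_N -> R -> Omega -> R[i]).

(* (c_{1,tau_1}, ..., c_{n-1,tau_{n-1}}, c_{n,tau_n /\ t}, 0, ..., 0) *)
Definition walk (n : 'I_N) (t : R) (w : Omega) : N.-tuple R[i] :=
  [tuple if (k < n)%N then exit_point (c k) w
         else if k == n then stopped (c n) t w
         else 0 | k < N].

Definition walk_end (w : Omega) : N.-tuple R[i] :=
  [tuple exit_point (c k) w | k < N].

(* The Brownian maximal function associated with the polynomial a. *)
Definition brownian_max (a : coefs R N) (w : Omega) : \bar R :=
  ereal_sup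
    ([set y | exists n : 'I_N, exists2 t : R, 0 <= t &
        y = (normc (trig_eval a (walk n t w)))%:E] `|`
     [set (normc (trig_eval a (walk_end w)))%:E]).

End maximal_function.

End brownian.

(* Main.v *)
(* The polynomial g = f + iH(f) has real part f, and g(z_1, ..., z_n, 0, ..., 0) is
   holomorphic in z_n: at a frequency whose last nonzero entry is k_n, the
   coefficient of g is 1 + sgn(k_n) times that of f.  So G is a conformal
   martingale with real part F.  Fix lambda < l < L = beta lambda, and let S be
   the increment of G between the first time that |G| > l and the first time
   that |G| > L.  Then E(S^2) = 0, that is, E|S|^2 = 2 E(Re S)^2; moreover
   |S| >= L - l on {G^* > L}, S = 0 off {G^* > l}, |Re S| <= 2 F^* and
   |S| <= 2 L.  Hence, for every x > 0, up to constants,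
     (L - l)^2 P(G^* > L) <= x^2 P(G^* > l) + L^2 P(2 F^* > x),
   and the hypothesis on lambda lets the first term on the right be absorbed
   when x is a small multiple of lambda.

   Stochastic integrals are avoided by observing the paths at multiples of a
   mesh h.  A step of the walk is polynomial without constant term in a complex
   Gaussian increment, which is independent of the past, and all positive powers
   of which have mean 0, so the discretized G is still a martingale whose stopped
   increments S satisfy E(S^2) = 0.  The overshoot of the stopping levels is at
   most the largest step, which tends to 0 in L^2 with h, and almost surely the
   discrete maxima converge to the Brownian ones. *)
From HB Require Import structures.
From mathcomp Require Import all_boot all_order all_algebra.
From mathcomp Require Import all_classical all_reals all_analysis.
From mathcomp Require Import measurable_realfun lebesgue_integral_fubini.
From mathcomp Require Import ring lra zify.
Require Import Defs.

Set Implicit Arguments.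
Unset Strict Implicit.
Unset Printing Implicit Defensive.

Import Order.TTheory GRing.Theory Num.Theory.
Import numFieldNormedType.Exports.
Import ComplexField.Normc.

Local Open Scope classical_set_scope.
Local Open Scope ring_scope.
Local Open Scope complex_scope.

(** * Complex-valued random variables *)

(** Three obstacles shape the details. [trig_cond_exp] picks its value by [xget], so the
    coefficients of g are known only once conditional expectations of trigonometric polynomials are
    shown to exist, and to be unique at the level of coefficients. This, with the reality and the
    mean of f, is what the measure on the torus is used for.

    Convergence of the maxima is one-sided at each level. A Brownian maximum above L forces the
    discrete ones above L from some mesh on, but a Brownian maximum at most L only keeps the
    discrete ones below every L' > L. The two sides of the estimate use opposite directions; hence
    the level l strictly between lambda and L, and the passage from x/2 to x/4 for F.

    The discrete walk overshoots the unit disc, where a polynomial is no longer bounded, so the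
    largest step is controlled by high powers of the Gaussian increments. With about m^2 steps of
    length 1/m in each coordinate, the sum of the moments of order 2p is of size m^(2-p), which
    tends to 0 from the sixth moment on. *)

Section complex_arith.
Context (R : realType).
Implicit Types z w : R[i].

Lemma ReD z w : complex.Re (z + w) = complex.Re z + complex.Re w.
Proof. by case: z w => ? ? []. Qed.

Lemma ImD z w : complex.Im (z + w) = complex.Im z + complex.Im w.
Proof. by case: z w => ? ? []. Qed.

Lemma ReN z : complex.Re (- z) = - complex.Re z. Proof. by case: z. Qed.

Lemma ImN z : complex.Im (- z) = - complex.Im z. Proof. by case: z. Qed.

Lemma ReM z w : complex.Re (z * w) =
  complex.Re z * complex.Re w - complex.Im z * complex.Im w.
Proof. by case: z w => ? ? []. Qed.

Lemma ImM z w : complex.Im (z * w) =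
  complex.Re z * complex.Im w + complex.Im z * complex.Re w.
Proof. by case: z w => ? ? []. Qed.

Lemma ReJ z : complex.Re z^* = complex.Re z. Proof. by case: z. Qed.

Lemma ImJ z : complex.Im z^* = - complex.Im z. Proof. by case: z. Qed.

Lemma complexP z w :
  complex.Re z = complex.Re w -> complex.Im z = complex.Im w -> z = w.
Proof. by case: z w => ? ? [? ?] /= -> ->. Qed.

Lemma normc_ge0 z : 0 <= normc z. Proof. by case: z => x y; exact: sqrtr_ge0. Qed.

Lemma normc_sq z : normc z ^+ 2 = complex.Re z ^+ 2 + complex.Im z ^+ 2.
Proof. by case: z => x y; rewrite /= sqr_sqrtr// addr_ge0// sqr_ge0. Qed.

Lemma normc_Re z : `|complex.Re z| <= normc z.
Proof. by case: z => x y; rewrite /= -sqrtr_sqr ler_wsqrtr// lerDl sqr_ge0. Qed.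

Lemma normc_Im z : `|complex.Im z| <= normc z.
Proof. by case: z => x y; rewrite /= -sqrtr_sqr ler_wsqrtr// lerDr sqr_ge0. Qed.

Lemma normc_le z : normc z <= `|complex.Re z| + `|complex.Im z|.
Proof.
rewrite -(ler_pXn2r (n := 2%N)) ?nnegrE ?addr_ge0 ?normc_ge0//.
rewrite normc_sq sqrrD !real_normK ?num_real// addrAC lerDl.
by rewrite mulrn_wge0// mulr_ge0.
Qed.

Lemma ler_normcD z w : normc (z + w) <= normc z + normc w.
Proof. exact: le_normcD. Qed.

Lemma ncM z w : normc (z * w) = normc z * normc w.
Proof. exact: normcM. Qed.

Lemma ncN z : normc (- z) = normc z.
Proof. by case: z => x y /=; rewrite !sqrrN. Qed.

Lemma ncB z w : normc (z - w) = normc (w - z).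
Proof. by rewrite -ncN opprB. Qed.

Lemma ncJ z : normc z^* = normc z.
Proof. by case: z => x y /=; rewrite !sqrrN. Qed.

Lemma ncX z n : normc (z ^+ n) = normc z ^+ n.
Proof.
by elim: n => [|n ih]; rewrite ?expr0 ?normc1// !exprS ncM ih.
Qed.

Lemma normc_real (x : R) : normc x%:C = `|x|.
Proof. by rewrite /= expr0n addr0 sqrtr_sqr. Qed.

Lemma lerB_normc z w : normc z - normc w <= normc (z - w).
Proof. by rewrite lerBlDr (le_trans _ (ler_normcD _ _))// subrK. Qed.

End complex_arith.

Section cmeasurable.
Context d (T : measurableType d) (R : realType).
Implicit Types X Y : T -> R[i].

Definition cmeasurable X :=
  measurable_fun setT (fun t => complex.Re (X t)) /\
  measurable_fun setT (fun t => complex.Im (X t)).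

Lemma cmeasurableP X : cmeasurable X <-> measurable_fun setT X.
Proof.
split=> [[mRe mIm]|mX].
  rewrite (_ : X = fun t => complex.Re (X t) +i* complex.Im (X t)).
    exact: measurable_Complex.
  by apply/funext => t; case: (X t).
have mp : measurable_fun setT (@complex_pair R \o X).
  exact: measurableT_comp (@measurable_complex_pair R) mX.
by split; [exact: measurableT_comp measurable_fst mp
          |exact: measurableT_comp measurable_snd mp].
Qed.

Lemma cmeasurable_cst z : cmeasurable (fun=> z).
Proof. by split; exact: measurable_cst. Qed.

Lemma cmeasurableD X Y :
  cmeasurable X -> cmeasurable Y -> cmeasurable (fun t => X t + Y t).
Proof.
move=> [a b] [a' b']; split.
- by under eq_fun do rewrite ReD; exact: measurable_funD.
- by under eq_fun do rewrite ImD; exact: measurable_funD.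
Qed.

Lemma cmeasurableM X Y :
  cmeasurable X -> cmeasurable Y -> cmeasurable (fun t => X t * Y t).
Proof.
move=> [a b] [a' b']; split.
- under eq_fun do rewrite ReM.
  by apply: measurable_funB; exact: measurable_funM.
- under eq_fun do rewrite ImM.
  by apply: measurable_funD; exact: measurable_funM.
Qed.

Lemma cmeasurableN X : cmeasurable X -> cmeasurable (fun t => - X t).
Proof.
move=> mX; under eq_fun do rewrite -mulN1r.
by apply: cmeasurableM => //; exact: cmeasurable_cst.
Qed.

Lemma cmeasurableJ X : cmeasurable X -> cmeasurable (fun t => (X t)^*).
Proof.
move=> [a b]; split; first by under eq_fun do rewrite ReJ.
by under eq_fun do rewrite ImJ; exact: measurable_funN.
Qed.

Lemma cmeasurableX X n : cmeasurable X -> cmeasurable (fun t => X t ^+ n).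
Proof.
move=> mX; elim: n => [|n ih].
  by under eq_fun do rewrite expr0; exact: cmeasurable_cst.
by under eq_fun do rewrite exprS; exact: cmeasurableM.
Qed.

Lemma cmeasurable_sum I (r : seq I) (F : I -> T -> R[i]) :
  (forall i, cmeasurable (F i)) -> cmeasurable (fun t => \sum_(i <- r) F i t).
Proof.
move=> mF; elim: r => [|i r ih].
  by under eq_fun do rewrite big_nil; exact: cmeasurable_cst.
by under eq_fun do rewrite big_cons; exact: cmeasurableD.
Qed.

Lemma cmeasurable_prod I (r : seq I) (F : I -> T -> R[i]) :
  (forall i, cmeasurable (F i)) -> cmeasurable (fun t => \prod_(i <- r) F i t).
Proof.
move=> mF; elim: r => [|i r ih].
  by under eq_fun do rewrite big_nil; exact: cmeasurable_cst.
by under eq_fun do rewrite big_cons; exact: cmeasurableM.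
Qed.

Lemma cmeasurable_if (b : T -> bool) X Y : measurable_fun setT b ->
  cmeasurable X -> cmeasurable Y ->
  cmeasurable (fun t => if b t then X t else Y t).
Proof.
move=> mb /cmeasurableP mX /cmeasurableP mY; apply/cmeasurableP.
by apply: measurable_fun_if => //; exact: measurable_funTS.
Qed.

Lemma measurable_normc X :
  cmeasurable X -> measurable_fun setT (fun t => normc (X t)).
Proof.
move=> [a b].
rewrite (_ : (fun _ => _) =
  (fun t => Num.sqrt (complex.Re (X t) ^+ 2 + complex.Im (X t) ^+ 2))).
  have ms : measurable_fun setT (Num.sqrt : R -> R).
    by apply: continuous_measurable_fun; exact: sqrt_continuous.
  apply: (measurableT_comp ms).
  by apply: measurable_funD; exact: measurable_funX.
by apply/funext => t; case: (X t).
Qed.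

End cmeasurable.

Section complex_integral_theory.
Context d (T : measurableType d) (R : realType) (mu : probability T R).
Implicit Types X Y : T -> R[i].

Definition cexp X : R[i] := complex_integral mu setT X.

Lemma complex_integrableP X : cmeasurable X ->
  complex_integrable mu X <-> mu.-integrable setT (fun t => (normc (X t))%:E).
Proof.
move=> mX; have [a b] := mX; split=> [[iR iI]|iX].
  apply: (@le_integrable _ _ _ _ _ measurableT _
    (fun t => (`|complex.Re (X t)| + `|complex.Im (X t)|)%:E)).
  - by apply/measurable_EFinP; exact: measurable_normc.
  - move=> t _; rewrite lee_fin ger0_norm ?normc_ge0//.
    by rewrite ger0_norm ?normc_le// addr_ge0.
  - under eq_fun do rewrite EFinD.
    by apply: integrableD => //; [have := integrable_abse iR
                                 |have := integrable_abse iI].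
split; apply: (@le_integrable _ _ _ _ _ measurableT _
    (fun t => (normc (X t))%:E)) => //; try exact/measurable_EFinP.
- by move=> t _; rewrite lee_fin (ger0_norm (normc_ge0 _)) normc_Re.
- by move=> t _; rewrite lee_fin (ger0_norm (normc_ge0 _)) normc_Im.
Qed.

Lemma complex_integrable_cst z : complex_integrable mu (fun=> z).
Proof.
by split; apply: finite_measure_integrable_cst.
Qed.

Lemma complex_integrableD X Y : complex_integrable mu X ->
  complex_integrable mu Y -> complex_integrable mu (fun t => X t + Y t).
Proof.
move=> [a b] [a' b']; split.
- by under eq_fun do rewrite ReD EFinD; exact: integrableD.
- by under eq_fun do rewrite ImD EFinD; exact: integrableD.
Qed.

Let integrable_rscale (k : R) (x : T -> R) :
  mu.-integrable setT (EFin \o x) -> mu.-integrable setT (EFin \o (fun t => k * x t)).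
Proof.
move=> ix; rewrite (_ : _ \o _ = fun t => k%:E * (x t)%:E)%E.
  exact: integrableZl.
by apply/funext => t /=; rewrite EFinM.
Qed.

Lemma complex_integrableZ z X : complex_integrable mu X ->
  complex_integrable mu (fun t => z * X t).
Proof.
move=> [a b]; split.
- under eq_fun do rewrite ReM EFinB !EFinM.
  by apply: integrableB => //; exact: integrableZl.
- under eq_fun do rewrite ImM EFinD !EFinM.
  by apply: integrableD => //; exact: integrableZl.
Qed.

Lemma cexpD X Y : complex_integrable mu X -> complex_integrable mu Y ->
  cexp (fun t => X t + Y t) = cexp X + cexp Y.
Proof.
move=> [a b] [a' b']; rewrite /cexp /complex_integral; apply: complexP => /=.
- by under eq_Rintegral do rewrite ReD; rewrite RintegralD.
- by under eq_Rintegral do rewrite ImD; rewrite RintegralD.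
Qed.

Lemma cexpZ z X : complex_integrable mu X ->
  cexp (fun t => z * X t) = z * cexp X.
Proof.
move=> [a b]; rewrite /cexp /complex_integral; apply: complexP; rewrite /= ?ReM ?ImM/=.
- under eq_Rintegral do rewrite ReM.
  by rewrite RintegralB ?RintegralZl//; exact: integrable_rscale.
- under eq_Rintegral do rewrite ImM.
  by rewrite RintegralD ?RintegralZl//; exact: integrable_rscale.
Qed.

Lemma cexp_cst z : cexp (fun=> z) = z.
Proof.
rewrite /cexp /complex_integral; apply: complexP => /=;
  by rewrite Rintegral_cst//= probability_setT/= mulr1.
Qed.

Lemma complex_integrable_sum I (r : seq I) (F : I -> T -> R[i]) :
  (forall i, complex_integrable mu (F i)) ->
  complex_integrable mu (fun t => \sum_(i <- r) F i t).
Proof.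
move=> mF; elim: r => [|i r ih].
  by under eq_fun do rewrite big_nil; exact: complex_integrable_cst.
by under eq_fun do rewrite big_cons; exact: complex_integrableD.
Qed.

Lemma cexp_sum I (r : seq I) (F : I -> T -> R[i]) :
  (forall i, complex_integrable mu (F i)) ->
  cexp (fun t => \sum_(i <- r) F i t) = \sum_(i <- r) cexp (F i).
Proof.
move=> mF; elim: r => [|i r ih].
  by under eq_fun do rewrite big_nil; rewrite big_nil cexp_cst.
under eq_fun do rewrite big_cons; rewrite cexpD ?big_cons ?ih//.
exact: complex_integrable_sum.
Qed.

End complex_integral_theory.

Section moments.
Context d (T : measurableType d) (R : realType) (mu : probability T R).
Implicit Types X Y : T -> R[i].

(* Every quantity of the discretized problem has moments of all orders, and
   such functions form an algebra: this disposes of all integrability issues. *)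
Definition moments X := cmeasurable X /\
  forall p, mu.-integrable setT (fun t => (normc (X t) ^+ p)%:E).

Lemma moments_dom X (y : T -> R) : cmeasurable X ->
  mu.-integrable setT (EFin \o y) -> forall p,
  (forall t, normc (X t) ^+ p <= y t) ->
  mu.-integrable setT (fun t => (normc (X t) ^+ p)%:E).
Proof.
move=> mX iy p Xy; apply: (@le_integrable _ _ _ _ _ measurableT _ _ _ _ iy).
  by apply/measurable_EFinP; apply: measurable_funX; exact: measurable_normc.
move=> t _; rewrite lee_fin ger0_norm ?exprn_ge0 ?normc_ge0//.
exact: le_trans (ler_norm _).
Qed.

Lemma moments_le X Y : cmeasurable X -> moments Y ->
  (forall t, normc (X t) <= normc (Y t)) -> moments X.
Proof.
move=> mX [mY iY] XY; split=> // p; apply: (moments_dom mX (iY p)) => t.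
by rewrite lerXn2r// nnegrE normc_ge0.
Qed.

Lemma moments_cst z : moments (fun=> z).
Proof.
split=> [|p]; first exact: cmeasurable_cst.
exact: (finite_measure_integrable_cst mu).
Qed.

Lemma momentsM X Y : moments X -> moments Y -> moments (fun t => X t * Y t).
Proof.
move=> [mX iX] [mY iY]; have mXY := cmeasurableM mX mY; split=> // p.
apply: (@moments_dom _ (fun t => normc (X t) ^+ (2 * p) + normc (Y t) ^+ (2 * p))) => //.
  exact: (integrableD measurableT (iX (2 * p)%N) (iY (2 * p)%N)).
move=> t; rewrite ncM exprMn !(mulnC 2) !exprM.
set a := _ ^+ p; set b := _ ^+ p.
have := sqr_ge0 (a - b); have := sqr_ge0 (a + b); nra.
Qed.

Lemma momentsD X Y : moments X -> moments Y -> moments (fun t => X t + Y t).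
Proof.
move=> [mX iX] [mY iY]; have mXY := cmeasurableD mX mY; split=> // p.
apply: (@moments_dom _ (fun t => 2 ^+ p * (normc (X t) ^+ p + normc (Y t) ^+ p))) => //.
  rewrite (_ : _ \o _ = fun t => (2 ^+ p)%:E *
      ((normc (X t) ^+ p)%:E + (normc (Y t) ^+ p)%:E))%E.
    by apply: integrableZl => //; exact: (integrableD measurableT (iX p) (iY p)).
  by apply/funext => t /=; rewrite EFinM EFinD.
move=> t; have [ab|/ltW ab] := leP (normc (X t)) (normc (Y t)).
- apply: (@le_trans _ _ ((2 * normc (Y t)) ^+ p)).
    rewrite lerXn2r// ?nnegrE ?normc_ge0// ?mulr_ge0 ?normc_ge0//.
    by rewrite (le_trans (ler_normcD _ _))// mulr_natl mulr2n lerD2r.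
  by rewrite exprMn ler_pM2l ?exprn_gt0// lerDr exprn_ge0// normc_ge0.
- apply: (@le_trans _ _ ((2 * normc (X t)) ^+ p)).
    rewrite lerXn2r// ?nnegrE ?normc_ge0// ?mulr_ge0 ?normc_ge0//.
    by rewrite (le_trans (ler_normcD _ _))// mulr_natl mulr2n lerD2l.
  by rewrite exprMn ler_pM2l ?exprn_gt0// lerDl exprn_ge0// normc_ge0.
Qed.

Lemma momentsN X : moments X -> moments (fun t => - X t).
Proof.
move=> mX; apply: (moments_le _ mX) => [|t]; last by rewrite ncN.
by case: mX => mX _; exact: cmeasurableN.
Qed.

Lemma momentsJ X : moments X -> moments (fun t => (X t)^*).
Proof.
move=> mX; apply: (moments_le _ mX) => [|t]; last by rewrite ncJ.
by case: mX => mX _; exact: cmeasurableJ.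
Qed.

Lemma momentsX X n : moments X -> moments (fun t => X t ^+ n).
Proof.
move=> mX; elim: n => [|n ih].
  by under eq_fun do rewrite expr0; exact: moments_cst.
by under eq_fun do rewrite exprS; exact: momentsM.
Qed.

Lemma moments_if (b : T -> bool) X : measurable_fun setT b ->
  moments X -> moments (fun t => if b t then X t else 0).
Proof.
move=> mb mX; apply: (moments_le _ mX) => [|t].
  by case: mX => mX _; apply: cmeasurable_if => //; exact: cmeasurable_cst.
by case: ifP => // _; rewrite normc0 normc_ge0.
Qed.

Lemma moments_sum I (r : seq I) (F : I -> T -> R[i]) :
  (forall i, moments (F i)) -> moments (fun t => \sum_(i <- r) F i t).
Proof.
move=> mF; elim: r => [|i r ih].
  by under eq_fun do rewrite big_nil; exact: moments_cst.
by under eq_fun do rewrite big_cons; exact: momentsD.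
Qed.

Lemma moments_prod I (r : seq I) (F : I -> T -> R[i]) :
  (forall i, moments (F i)) -> moments (fun t => \prod_(i <- r) F i t).
Proof.
move=> mF; elim: r => [|i r ih].
  by under eq_fun do rewrite big_nil; exact: moments_cst.
by under eq_fun do rewrite big_cons; exact: momentsM.
Qed.

Lemma moments_complex_integrable X : moments X -> complex_integrable mu X.
Proof. by move=> [mX iX]; apply/complex_integrableP => //; exact: (iX 1%N). Qed.

End moments.

(** * Product measures and independence *)

Lemma Rintegral_prodM d1 d2 (T1 : measurableType d1) (T2 : measurableType d2)
    (R : realType) (m1 : probability T1 R) (m2 : probability T2 R)
    (f : T1 -> R) (g : T2 -> R) :
  m1.-integrable setT (EFin \o f) -> m2.-integrable setT (EFin \o g) ->
  (m1 \x m2)%E.-integrable setT (fun z => (f z.1 * g z.2)%:E) /\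
  (\int[(m1 \x m2)%E]_z (f z.1 * g z.2) = \int[m1]_x f x * \int[m2]_y g y).
Proof.
move=> f1 g1; have mf := measurable_int _ f1; have mg := measurable_int _ g1.
have mfg : measurable_fun setT (fun z : T1 * T2 => (f z.1 * g z.2)%:E).
  have /measurable_EFinP mf' := mf; have /measurable_EFinP mg' := mg.
  apply/measurable_EFinP; apply: measurable_funM.
    exact: (measurableT_comp mf' measurable_fst).
  exact: (measurableT_comp mg' measurable_snd).
have ifg : (m1 \x m2)%E.-integrable setT (fun z => (f z.1 * g z.2)%:E).
  apply/integrable12ltyP => //.
  have mag : measurable_fun setT (fun y => `|(g y)%:E|%E) := measurable_int _ (integrable_abse g1).
  have maf : measurable_fun setT (fun y => `|(f y)%:E|%E) := measurable_int _ (integrable_abse f1).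
  have /integrableP[_ fy] := f1; have /integrableP[_ gy] := g1.
  have E x : (\int[m2]_y `|(f x * g y)%:E| = `|(f x)%:E| * \int[m2]_y `|(g y)%:E|)%E.
    rewrite -ge0_integralZl//; by apply: eq_integral => y _; rewrite EFinM abseM.
  rewrite (eq_integral (fun x => `|(f x)%:E| * \int[m2]_y `|(g y)%:E|)%E); last by move=> x _; exact: E.
  rewrite ge0_integralZr//; last exact: integral_ge0.
  rewrite lte_mul_pinfty//; first exact: integral_ge0.
  by rewrite ge0_fin_numE//; exact: integral_ge0.
split=> //; rewrite /Rintegral -integral12_prod_meas1//= /fubini_F/=.
have ef := integrable_fin_num measurableT f1.
have eg := integrable_fin_num measurableT g1.
have E x : (\int[m2]_y (f x * g y)%:E = (f x)%:E * \int[m2]_y (g y)%:E)%E.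
  by rewrite -integralZl//; apply: eq_integral => y _; rewrite EFinM.
under eq_integral do rewrite E.
have eg' : (\int[m2]_y (g y)%:E)%E \is a fin_num := eg.
by rewrite -(fineK eg') integralZr// fineM.
Qed.

Lemma cexp_prodM d1 d2 (T1 : measurableType d1) (T2 : measurableType d2)
    (R : realType) (m1 : probability T1 R) (m2 : probability T2 R)
    (X : T1 -> R[i]) (Y : T2 -> R[i]) :
  complex_integrable m1 X -> complex_integrable m2 Y ->
  complex_integrable (m1 \x m2)%E (fun z => X z.1 * Y z.2) /\
  complex_integral (m1 \x m2)%E setT (fun z => X z.1 * Y z.2) =
    cexp m1 X * cexp m2 Y.
Proof.
move=> [a b] [a' b'].
have [i1 e1] := Rintegral_prodM a a'; have [i2 e2] := Rintegral_prodM b b'.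
have [i3 e3] := Rintegral_prodM a b'; have [i4 e4] := Rintegral_prodM b a'.
split; first split.
- by under eq_fun do rewrite ReM EFinB; exact: integrableB.
- by under eq_fun do rewrite ImM EFinD; exact: integrableD.
rewrite /cexp /complex_integral; apply: complexP; rewrite ?ReM ?ImM /=.
- by rewrite -e1 -e2 -RintegralB//; apply: eq_Rintegral => z _; rewrite ReM.
- by rewrite -e3 -e4 -RintegralD//; apply: eq_Rintegral => z _; rewrite ImM.
Qed.

Section independence.
Context d (Omega : measurableType d) (R : realType) (P : probability Omega R).
Context d' (T' : measurableType d').

Definition indep_sigma (G : set (set Omega)) (X : Omega -> T') :=
  forall A B, <<s G >> A -> measurable B ->
    P (A `&` X @^-1` B) = (P A * P (X @^-1` B))%E.

Variables (G : set (set Omega)) (X : Omega -> T').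
Hypotheses (mG : <<s G >> `<=` measurable) (mX : measurable_fun setT X).
Hypothesis GX : indep_sigma G X.

Let GO := g_sigma_algebraType G.
(** The identity into Omega with the smaller sigma-algebra. Its law is the restriction of P to
    [<<s G>>], so that variables of the past live on a probability space of their own. *)
Let toG : Omega -> GO := id.

Let measurable_toG : measurable_fun setT toG.
Proof. by move=> _ A /mG mA; rewrite setTI. Qed.

HB.instance Definition _ := @isMeasurableFun.Build _ _ _ _ toG measurable_toG.
HB.instance Definition _ := @isMeasurableFun.Build _ _ _ _ X mX.

Let PG : probability GO R := distribution P toG.
Let PX : probability T' R := distribution P X.

Let pair (w : Omega) : GO * T' := (toG w, X w).

Let measurable_pair : measurable_fun setT pair.
Proof. exact: measurable_fun_pair. Qed.

(** Independence says that the law of the pair ([toG], X) is the product of the two laws, since they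
    agree on rectangles; the claim is Fubini transported along this pair. *)
Lemma indep_Rintegral (Y : GO -> R) (phi : T' -> R) :
  measurable_fun setT Y -> measurable_fun setT phi ->
  P.-integrable setT (EFin \o Y) -> P.-integrable setT (EFin \o (phi \o X)) ->
  P.-integrable setT (fun w : Omega => (Y w * phi (X w))%:E) /\
  \int[P]_w (Y w * phi (X w)) = \int[P]_w Y w * \int[P]_w phi (X w).
Proof.
move=> mY mphi iY iphi.
have iY' : PG.-integrable setT (EFin \o Y).
  by apply: integrable_pushforward => //; exact/measurable_EFinP.
have iphi' : PX.-integrable setT (EFin \o phi).
  by apply: integrable_pushforward => //; exact/measurable_EFinP.
have [i e] := Rintegral_prodM iY' iphi'.
have mf := measurable_int _ i.
have joint A : measurable A -> (PG \x PX)%E A = pushforward P pair A.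
  apply: product_measure_unique => A1 A2 mA1 mA2.
  exact: (GX mA1 mA2).
have i'' : P.-integrable setT (fun w : Omega => (Y w * phi (X w))%:E).
  have mg : measurable_fun setT (fun w : Omega => (Y w * phi (X w))%:E) :=
    measurableT_comp mf measurable_pair.
  apply/integrableP; split=> //; have /integrableP[_] := i.
  rewrite (@eq_measure_integral _ _ _ _ (pushforward P pair)).
    by rewrite ge0_integral_pushforward//; exact: measurableT_comp mf.
  by move=> A mA _; exact: joint.
split=> //.
transitivity (\int[(PG \x PX)%E]_z (Y z.1 * phi z.2)).
  congr fine; rewrite (@eq_measure_integral _ _ _ _ (pushforward P pair)).
    by rewrite integral_pushforward.
  by move=> A mA _; exact: joint.
rewrite e; congr (fine _ * fine _).
- by rewrite integral_pushforward//; exact/measurable_EFinP.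
- by rewrite integral_pushforward//; exact/measurable_EFinP.
Qed.

End independence.

Lemma indep_cexp d (Omega : measurableType d) (R : realType)
    (P : probability Omega R) d' (T' : measurableType d')
    (G : set (set Omega)) (X : Omega -> T')
    (Y : g_sigma_algebraType G -> R[i]) (phi : T' -> R[i]) :
  <<s G >> `<=` measurable -> measurable_fun setT X -> indep_sigma P G X ->
  cmeasurable Y -> cmeasurable phi ->
  complex_integrable P Y -> complex_integrable P (phi \o X) ->
  cexp P (fun w => Y w * phi (X w)) = cexp P Y * cexp P (phi \o X).
Proof.
move=> mG mX GX [mYr mYi] [mpr mpi] [iYr iYi] [ipr ipi].
have [i1 e1] := indep_Rintegral mG mX GX mYr mpr iYr ipr.
have [i2 e2] := indep_Rintegral mG mX GX mYi mpi iYi ipi.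
have [i3 e3] := indep_Rintegral mG mX GX mYr mpi iYr ipi.
have [i4 e4] := indep_Rintegral mG mX GX mYi mpr iYi ipr.
rewrite /cexp /complex_integral; apply: complexP; rewrite ?ReM ?ImM /=.
- by rewrite -e1 -e2 -RintegralB//; apply: eq_Rintegral => z _; rewrite ReM.
- by rewrite -e3 -e4 -RintegralD//; apply: eq_Rintegral => z _; rewrite ImM.
Qed.

(** * Gaussian moments *)

Section gaussian_moments.
Context (R : realType) (s : R).
Hypothesis s0 : 0 < s.
Local Notation mu := (@lebesgue_measure R).
Local Notation pdf := (normal_pdf 0 s).
Local Notation nu := (normal_prob 0 s).

Let sn0 : s != 0. Proof. by rewrite gt_eqF. Qed.

(** The Radon-Nikodym derivative of [normal_prob] agrees almost everywhere with [normal_pdf], both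
    having the same integral over every measurable set. *)
Lemma ge0_integral_normal_prob (f : R -> R) :
  measurable_fun setT f -> (forall x, 0 <= f x) ->
  (\int[nu]_x (f x)%:E = \int[mu]_x (f x * pdf x)%:E)%E.
Proof.
move=> mf f0.
have dom : nu `<< mu := normal_prob_dominates 0 s.
have mf' : measurable_fun setT (EFin \o f) by exact/measurable_EFinP.
have ipdf := integrable_normal_pdf 0 s.
rewrite -(Radon_Nikodym_SigmaFinite.change_of_variables dom)//.
apply: ae_eq_integral => //.
- apply: emeasurable_funM => //.
  exact: measurable_int (Radon_Nikodym_SigmaFinite.f_integrable dom).
- apply/measurable_EFinP; apply: measurable_funM => //.
  exact: measurable_normal_pdf.
have : ae_eq mu setT (Radon_Nikodym_SigmaFinite.f nu mu) (EFin \o pdf).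
  apply: integral_ae_eq => //.
  - exact: Radon_Nikodym_SigmaFinite.f_integrable.
  - exact: measurable_int ipdf.
  - by move=> E _ mE; rewrite -Radon_Nikodym_SigmaFinite.f_integral.
by apply: filterS => x /= + xT => /(_ xT) ->; rewrite EFinM.
Qed.

Lemma integrable_normal_prob (f : R -> R) : measurable_fun setT f ->
  nu.-integrable setT (EFin \o f) <->
  mu.-integrable setT (fun x => (f x * pdf x)%:E).
Proof.
move=> mf; have mfp : measurable_fun setT (fun x => (f x * pdf x)%:E).
  by apply/measurable_EFinP; apply: measurable_funM => //; exact: measurable_normal_pdf.
have E : (\int[nu]_x `|(f x)%:E| = \int[mu]_x `|(f x * pdf x)%:E|)%E.
  rewrite (@ge0_integral_normal_prob (fun x => `|f x|))//; last first.
    exact: measurableT_comp.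
  by apply: eq_integral => x _ /=; rewrite normrM (ger0_norm (normal_pdf_ge0 _ _ _)).
split=> /integrableP[_ iy]; apply/integrableP; split=> //.
- by rewrite -E.
- exact/measurable_EFinP.
- by rewrite E.
Qed.

Lemma Rintegral_normal_prob (f : R -> R) : measurable_fun setT f ->
  nu.-integrable setT (EFin \o f) ->
  \int[nu]_x f x = \int[mu]_x (f x * pdf x).
Proof.
move=> mf inf; have imf := (integrable_normal_prob mf).1 inf.
congr fine; rewrite integralE [RHS]integralE.
have mfp : measurable_fun setT (f^\+)%R by exact: measurable_funrpos.
have mfn : measurable_fun setT (f^\-)%R by exact: measurable_funrneg.
congr (_ - _)%E.
- transitivity (\int[nu]_x ((f^\+)%R x)%:E)%E.
    by apply: eq_integral => x _; rewrite funeposE /funrpos EFin_max.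
  rewrite ge0_integral_normal_prob//; apply: eq_integral => x _.
  by rewrite funeposE /funrpos maxr_pMl ?normal_pdf_ge0// mul0r EFin_max.
- transitivity (\int[nu]_x ((f^\-)%R x)%:E)%E.
    by apply: eq_integral => x _; rewrite funenegE /funrneg EFin_max.
  rewrite ge0_integral_normal_prob//; apply: eq_integral => x _.
  by rewrite funenegE /funrneg maxr_pMl ?normal_pdf_ge0// mul0r mulNr EFin_max.
Qed.

Lemma exprn_le_expR p (x : R) : 0 <= x -> x ^+ p <= p`!%:R * expR x.
Proof.
move=> x0; case: p => [|p]; first by rewrite expr0 fact0 mul1r -expR0 ler_expR.
rewrite mulrC -ler_pdivrMr ?ltr0n ?fact_gt0//.
by apply: le_trans (expR_ge1Dxn p x0); rewrite lerDr.
Qed.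

(* Completing the square. *)
Lemma expR_normal_pdf (t x : R) :
  expR (t * x) * pdf x = expR (t ^+ 2 * s ^+ 2 / 2) * normal_pdf (t * s ^+ 2) s x.
Proof.
rewrite !normal_pdfE// /normal_fun !(mulrCA _ (normal_peak s)) -!expRD.
congr (_ * expR _); field.
exact: sn0.
Qed.

(** From |x|^p <= p! e^|x| <= p! (e^x + e^(-x)): by completing the square, each exponential times
    the density is e^(s^2/2) times a density centred at s^2 or -s^2. This gives integrability of all
    moments at once. *)
Lemma normal_moment_bound p (x : R) : `|x| ^+ p * pdf x <=
  p`!%:R * expR (s ^+ 2 / 2) *
    (normal_pdf (s ^+ 2) s x + normal_pdf (- s ^+ 2) s x).
Proof.
apply: (@le_trans _ _ (p`!%:R * expR `|x| * pdf x)).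
  by rewrite ler_wpM2r ?normal_pdf_ge0// exprn_le_expR.
rewrite -(mulrA p`!%:R) -(mulrA p`!%:R) ler_wpM2l//.
have e1 := expR_normal_pdf 1 x; have e2 := expR_normal_pdf (-1) x.
rewrite expr1n !mul1r in e1; rewrite sqrrN expr1n mul1r !mulN1r in e2.
rewrite mulrDr -e1 -e2; have [x0|x0] := leP 0 x.
  by rewrite ger0_norm// lerDl mulr_ge0 ?expR_ge0 ?normal_pdf_ge0.
by rewrite ltr0_norm// lerDr mulr_ge0 ?expR_ge0 ?normal_pdf_ge0.
Qed.

Lemma integrable_normal_moment p :
  mu.-integrable setT (fun x => (x ^+ p * pdf x)%:E).
Proof.
have m1 : measurable_fun setT (fun x : R => x ^+ p * pdf x).
  by apply: measurable_funM; [exact: measurable_funX|exact: measurable_normal_pdf].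
have i := integrableZl measurableT (p`!%:R * expR (s ^+ 2 / 2))
  (integrableD measurableT (integrable_normal_pdf (s ^+ 2) s)
                           (integrable_normal_pdf (- s ^+ 2) s)).
apply: le_integrable i => //; first exact/measurable_EFinP.
move=> x _; rewrite -EFinD -EFinM lee_fin.
have -> : `|x ^+ p * pdf x| = `|x| ^+ p * pdf x.
  by rewrite normrM normrX [X in _ * X]ger0_norm// normal_pdf_ge0.
exact: le_trans (normal_moment_bound _ _) (ler_norm _).
Qed.

Let u p (x : R) : R := - s ^+ 2 * (x ^+ p * pdf x).
Let du p (x : R) : R := x ^+ p.+1 * pdf x - s ^+ 2 * p%:R * (x ^+ p.-1 * pdf x).

Let is_derive_pdf (x : R) : is_derive x (1 : R) pdf (- (x / s ^+ 2) * pdf x).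
Proof.
have -> : pdf = fun x => normal_peak s * expR (- x ^+ 2 / (s ^+ 2 *+ 2)).
  by rewrite normal_pdfE//; apply/funext => y; rewrite /normal_fun subr0.
apply: is_derive_eq.
by rewrite /GRing.scale/= mulr0 add0r; field.
Qed.

Let is_derive_u p (x : R) : is_derive x (1 : R) (u p) (du p x).
Proof.
have dX := @is_deriveX R R id p x 1 1 (is_derive_id x 1).
have h := is_deriveZ (- s ^+ 2) (is_deriveM dX (is_derive_pdf x)).
rewrite (_ : u p = - s ^+ 2 \*: (id ^+ p * pdf)); last first.
  by apply/funext => y; rewrite /u !fctE.
apply: is_derive_eq h _; rewrite /du /GRing.scale/= !fctE mulr1.
by rewrite [x ^+ p.+1]exprS; field.
Qed.

Let continuous_du p : continuous (du p).
Proof.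
have cm q : continuous (fun x : R => x ^+ q * pdf x).
  move=> x; apply: cvgM; first exact: exprn_continuous.
  exact: continuous_normal_pdf.
move=> x; apply: cvgB; first exact: cm.
by apply: cvgM; [exact: cvg_cst|exact: cm].
Qed.

(** The bound for the moment of order p + 1, divided by |x|: decay of order 1/|x| is enough to kill
    the boundary terms of the integration by parts. *)
Let u_bound p (x : R) : x != 0 ->
  `|u p x| <= s ^+ 2 * (p.+1`!%:R * expR (s ^+ 2 / 2) * (normal_peak s *+ 2)) / `|x|.
Proof.
move=> x0; rewrite ler_pdivlMr ?normr_gt0//.
have -> : `|u p x| * `|x| = s ^+ 2 * (`|x| ^+ p.+1 * pdf x).
  rewrite /u !normrM normrN normrX normrX (ger0_norm (normal_pdf_ge0 _ _ _)).
  by rewrite (ger0_norm (ltW s0)) [`|x| ^+ p.+1]exprS; ring.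
rewrite ler_wpM2l ?sqr_ge0// (le_trans (normal_moment_bound _ _))//.
by rewrite ler_wpM2l ?mulr_ge0 ?expR_ge0// mulr2n lerD// normal_pdf_ub.
Qed.

Let integrable_du p : mu.-integrable setT (fun x => (du p x)%:E).
Proof.
have i1 := integrable_normal_moment p.+1.
have i2 := integrableZl measurableT (s ^+ 2 * p%:R) (integrable_normal_moment p.-1).
have := integrableB measurableT i1 i2.
by under eq_fun do rewrite -EFinM -EFinB.
Qed.

(** Integration by parts: [du p] is the derivative of [u p], which vanishes at infinity. Its
    integral over [-(n+1), n+1] tends to 0 by the fundamental theorem of calculus and to the full
    integral by dominated convergence. For p = 0 the factor p%:R makes the right side 0, so the
    first moment is covered. *)
Lemma normal_moment_rec p :
  \int[mu]_x (x ^+ p.+1 * pdf x) = s ^+ 2 * p%:R * \int[mu]_x (x ^+ p.-1 * pdf x).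
Proof.
have iu := integrable_du p.
suff iu0 : (\int[mu]_x (du p x)%:E = 0)%E.
  have : \int[mu]_x (du p x) = 0 by rewrite /Rintegral iu0.
  rewrite RintegralB//; last 2 first.
  - exact: integrable_normal_moment.
  - have := integrableZl measurableT (s ^+ 2 * p%:R) (integrable_normal_moment p.-1).
    by under eq_fun do rewrite -EFinM.
  rewrite RintegralZl//; last exact: integrable_normal_moment.
  by move/eqP; rewrite subr_eq0 => /eqP.
pose A n : set R := `[- n.+1%:R, n.+1%:R]%classic.
have c1 : (\int[mu]_(x in A n) (du p x)%:E @[n --> \oo] --> \int[mu]_x (du p x)%:E)%E.
  have -> : (fun n => \int[mu]_(x in A n) (du p x)%:E)%E =
            (fun n => \int[mu]_x ((EFin \o du p) \_ (A n)) x)%E.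
    by apply/funext => n; rewrite integral_mkcond.
  have mdu := measurable_int _ iu.
  apply: (@dominated_cvg _ _ _ mu setT measurableT _ _ (fun x => `|(du p x)%:E|%E)) => //.
  - move=> n; apply/(measurable_restrictT _ _).1 => //; first exact: measurable_itv.
    exact: measurable_funTS.
  - move=> x _; apply: cvg_near_cst.
    near=> n; rewrite patchE ifT// inE /A/= in_itv/=.
    rewrite -ler_norml.
    rewrite (@le_trans _ _ n%:R)//; last by rewrite ler_nat.
    by near: n; exact: nbhs_infty_ger.
  - exact: integrable_abse iu.
  - by move=> n x _; rewrite patchE; case: ifPn => // _; rewrite abse0.
have c2 : ((\int[mu]_(x in A n) (du p x)%:E)%E @[n --> \oo] --> 0%E).
  have -> : (fun n => \int[mu]_(x in A n) (du p x)%:E)%E =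
      (fun n => (u p n.+1%:R - u p (- n.+1%:R))%:E).
    apply/funext => n; rewrite EFinB; apply: continuous_FTC2.
    - by rewrite (@lt_trans _ _ 0)// ?oppr_lt0 ltr0n.
    - by apply: continuous_subspaceT; exact: continuous_du.
    - split=> [x _||]; first by have [] := is_derive_u p x.
      + apply: cvg_at_right_filter; apply: differentiable_continuous.
        by apply/derivable1_diffP; have [] := is_derive_u p (- n.+1%:R).
      + apply: cvg_at_left_filter; apply: differentiable_continuous.
        by apply/derivable1_diffP; have [] := is_derive_u p (n.+1%:R).
    - by move=> x _; rewrite derive1E; have := is_derive_u p x => -[_ ->].
  apply/cvg_EFin; first by near=> n.
  rewrite /comp/=.
  pose C := s ^+ 2 * (p.+1`!%:R * expR (s ^+ 2 / 2) * (normal_peak s *+ 2)).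
  apply: norm_cvg0; apply: (@squeeze_cvgr _ _ _ _ (fun=> 0) (fun n => 2 * C * n.+1%:R^-1)).
  - near=> n; rewrite normr_ge0/= (le_trans (ler_normB _ _))//.
    have n0 : n.+1%:R != 0 :> R by rewrite pnatr_eq0.
    have := u_bound p n0; have := @u_bound p (- n.+1%:R).
    rewrite oppr_eq0 normrN normr_nat => /(_ n0); rewrite -/C -mulrA.
    set a := `|_|; set b := `|_|; set c := C / _ => h1 h2.
    by rewrite mulr_natl mulr2n lerD.
  - exact: cvg_cst.
  - rewrite -[X in _ --> X](mulr0 (2 * C)); apply: cvgMr.
    exact: cvg_harmonic.
exact: (cvg_unique _ c1 c2).
Unshelve. all: by end_near.
Qed.

End gaussian_moments.

Section normal_law.
Context (R : realType) (s : R).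
Hypothesis s0 : 0 < s.
Local Notation mu := (@lebesgue_measure R).

Definition normal_moment p : R := \int[mu]_x (x ^+ p * normal_pdf 0 s x).
Local Notation m := normal_moment.

(** The double factorial (2q - 1)!!. *)
Fixpoint odd_fact q := if q is q'.+1 then ((2 * q').+1 * odd_fact q')%N else 1%N.

Lemma normal_moment0 : m 0 = 1.
Proof.
rewrite /m; under eq_Rintegral do rewrite expr0 mul1r.
by rewrite /Rintegral integral_normal_pdf.
Qed.

Lemma normal_moment1 : m 1 = 0.
Proof. by rewrite /m normal_moment_rec// mulr0 mul0r. Qed.

Lemma normal_momentS p : m p.+1 = s ^+ 2 * p%:R * m p.-1.
Proof. exact: normal_moment_rec. Qed.

Lemma normal_moment_even q : m (2 * q) = (odd_fact q)%:R * (s ^+ 2) ^+ q.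
Proof.
elim: q => [|q ih]; first by rewrite muln0 normal_moment0 expr0 mulr1.
by rewrite mulnS !addSn add0n normal_momentS/= ih natrM [(s ^+ 2) ^+ q.+1]exprS; ring.
Qed.


Context d (Omega : measurableType d) (P : probability Omega R).
Variable Z : Omega -> measurableTypeR R.
Hypothesis mZ : measurable_fun setT Z.
Hypothesis lawZ : forall A, measurable A -> P (Z @^-1` A) = normal_prob 0 s A.

HB.instance Definition _ := @isMeasurableFun.Build _ _ _ _ Z mZ.

Lemma normal_law_moment p :
  P.-integrable setT (fun w => (Z w ^+ p)%:E) /\ \int[P]_w Z w ^+ p = m p.
Proof.
have mp : measurable_fun setT (fun x : R => x ^+ p) by exact: measurable_funX.
have ip : (normal_prob 0 s).-integrable setT (fun x : R => (x ^+ p)%:E).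
  exact: (integrable_normal_prob s mp).2 (integrable_normal_moment s0 p).
have e (f : R -> \bar R) :
    (\int[distribution P Z]_x f x = \int[normal_prob 0 s]_x f x)%E.
  by apply: eq_measure_integral => A mA _; exact: lawZ.
have iZ : P.-integrable setT (fun w => (Z w ^+ p)%:E).
  have mZp : measurable_fun setT (fun w => Z w ^+ p) by exact: measurable_funX.
  apply/integrableP; split; first exact/measurable_EFinP.
  have /integrableP[_] := ip; rewrite -e ge0_integral_pushforward//.
  by apply: measurableT_comp => //; exact/measurable_EFinP.
split=> //; rewrite /m -Rintegral_normal_prob// /Rintegral -e.
by rewrite integral_pushforward//; exact/measurable_EFinP.
Qed.

End normal_law.

Section complex_gaussian.
Context d (Omega : measurableType d) (R : realType) (P : probability Omega R).
Variables (s : R) (X Y : Omega -> R).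
Hypothesis s0 : 0 < s.
Hypotheses (mX : measurable_fun setT X) (mY : measurable_fun setT Y).
Hypothesis lawX : forall A, measurable A -> P (X @^-1` A) = normal_prob 0 s A.
Hypothesis lawY : forall A, measurable A -> P (Y @^-1` A) = normal_prob 0 s A.
Hypothesis indXY : forall A B, measurable A -> measurable B ->
  P (X @^-1` A `&` Y @^-1` B) = (P (X @^-1` A) * P (Y @^-1` B))%E.

Local Notation m := (normal_moment s).

Let law_momentX p := normal_law_moment s0 mX lawX p.
Let law_momentY p := normal_law_moment s0 mY lawY p.

Let xi w : R[i] := X w +i* Y w.

Let G : set (set Omega) := [set X @^-1` B | B in measurable].

Let sG : <<s G >> = G.
Proof.
rewrite (_ : G = preimage_set_system setT X measurable).
  apply: sigma_algebra_id.
  exact/sigma_algebra_preimage/sigma_algebra_measurable.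
by apply/seteqP; split=> _ [B mB <-]; exists B => //; rewrite setTI.
Qed.

Lemma moments_complex_gaussian : moments P xi.
Proof.
have iX p := integrable_norm (law_momentX p).1.
have iY p := integrable_norm (law_momentY p).1.
have mo (Z : Omega -> R) : measurable_fun setT Z ->
    (forall p, P.-integrable setT (fun w => `|Z w ^+ p|%:E)) ->
    moments P (fun w => (Z w)%:C).
  move=> mZ iZ; split=> [|p]; first by split=> //=; exact: measurable_cst.
  by under eq_fun do rewrite normc_real -normrX.
have -> : xi = fun w => (X w)%:C + 'i * (Y w)%:C.
  by apply/funext => w; apply: complexP; rewrite ?ReD ?ImD ?ReM ?ImM /=; ring.
apply: momentsD; first exact: mo.
by apply: momentsM; [exact: moments_cst|exact: mo].
Qed.

Let joint_moment a b :
  P.-integrable setT (fun w => (X w ^+ a * Y w ^+ b)%:E) /\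
  \int[P]_w (X w ^+ a * Y w ^+ b) = m a * m b.
Proof.
have [iX <-] := law_momentX a; have [iY <-] := law_momentY b.
have mG : <<s G >> `<=` measurable.
  by rewrite sG => _ [B mB <-]; rewrite -[_ @^-1` _]setTI; exact: mX.
have iG : indep_sigma P G Y.
  by move=> A B; rewrite sG => -[C mC <-] mB; exact: indXY.
have mXG : @measurable_fun _ _ (g_sigma_algebraType G) R setT (fun w => X w ^+ a).
  apply: measurable_funX => _ B mB; rewrite setTI.
  by apply: sub_gen_smallest; exists B.
have mp : measurable_fun setT (fun x : R => x ^+ b) by exact: measurable_funX.
exact: (indep_Rintegral mG mY iG mXG mp iX iY).
Qed.

Let cexp_joint a b (z : R[i]) :
  complex_integrable P (fun w => z * ((X w)%:C ^+ a * (Y w)%:C ^+ b)) /\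
  cexp P (fun w => z * ((X w)%:C ^+ a * (Y w)%:C ^+ b)) = z * (m a * m b)%:C.
Proof.
have [i e] := joint_moment a b.
have E : (fun w => (X w)%:C ^+ a * (Y w)%:C ^+ b) = fun w => (X w ^+ a * Y w ^+ b)%:C.
  by apply/funext => w; rewrite rmorphM !rmorphXn.
have ci : complex_integrable P (fun w => (X w ^+ a * Y w ^+ b)%:C).
  by split=> //=; exact: (finite_measure_integrable_cst P 0).
have -> : (fun w => z * ((X w)%:C ^+ a * (Y w)%:C ^+ b)) = (fun w => z * (X w ^+ a * Y w ^+ b)%:C).
  by apply/funext => w; rewrite rmorphM !rmorphXn.
split; first exact: complex_integrableZ.
rewrite cexpZ//; congr (_ * _); rewrite /cexp /complex_integral/= e.
by rewrite Rintegral_cst//= mul0r.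
Qed.

(** Gaussian integration by parts: E(xi xi^l) is s^2 times the mean of (d/dx + i d/dy) xi^l, which
    is 0 by the Cauchy-Riemann equation. In coordinates, one factor X + iY is split off, the rest is
    expanded, and the moment recursion is applied to the variable that received the extra factor. *)
Lemma cexp_complex_gaussian l : cexp P (fun w => xi w ^+ l.+1) = 0.
Proof.
have xiE w : xi w = (X w)%:C + 'i * (Y w)%:C.
  by apply: complexP; rewrite ?ReD ?ImD ?ReM ?ImM /=; ring.
pose c (a : 'I_l.+1) : R[i] := 'C(l, a)%:R * 'i ^+ a.
have -> : (fun w => xi w ^+ l.+1) = fun w => \sum_(a < l.+1)
    (c a * ((X w)%:C ^+ (l - a).+1 * (Y w)%:C ^+ a) +
     c a * 'i * ((X w)%:C ^+ (l - a) * (Y w)%:C ^+ a.+1)).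
  apply/funext => w; rewrite exprS xiE exprDn mulr_sumr; apply: eq_bigr => a _.
  rewrite /c exprMn -mulr_natl [_ ^+ (l - a).+1]exprS [_ ^+ a.+1]exprS; ring.
rewrite cexp_sum; last first.
  move=> a; apply: complex_integrableD; first exact: (cexp_joint _ _ _).1.
  exact: (cexp_joint _ _ _).1.
rewrite (eq_bigr (fun a => c a * (m (l - a).+1 * m a)%:C + c a * 'i * (m (l - a) * m a.+1)%:C)); last first.
  move=> a _; rewrite cexpD; last 2 first.
  - exact: (cexp_joint _ _ _).1.
  - exact: (cexp_joint _ _ _).1.
  by rewrite (cexp_joint _ _ _).2 (cexp_joint _ _ _).2.
rewrite big_split/= {}/c; case: l => [|l].
  by rewrite !big_ord1 subnn/= normal_moment1// mul0r mulr0 !mulr0 addr0.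
(* The last term of the first sum and the first term of the second contain the first moment, which
   is 0. The remaining terms are paired with a shift of the index by one. *)
rewrite big_ord_recr [X in _ + X]big_ord_recl/= subnn normal_moment1// mul0r mulr0 !mulr0 addr0 add0r.
rewrite -big_split big1//= => a _; rewrite /bump/= add1n subSS.
rewrite subSn ?(ltnW (ltn_ord a))//; last by rewrite -ltnS.
rewrite !normal_momentS//= !rmorphM/= !rmorph_nat.
(* Both binomial products equal (l + 1) C(l, a), so each pair is a multiple of 1 + i^2. *)
have e1 : 'C(l.+1, a)%:R * (l - a).+1%:R = l.+1%:R * 'C(l, a)%:R :> R[i].
  by rewrite -!natrM; congr _%:R; rewrite mul_bin_down mulnC subSn// -ltnS.
have e2 : 'C(l.+1, a.+1)%:R * a.+1%:R = l.+1%:R * 'C(l, a)%:R :> R[i].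
  by rewrite -!natrM; congr _%:R; rewrite mul_bin_diag mulnC.
have i2 : 'i * 'i = -1 :> R[i].
  by apply: complexP; rewrite ?ReM ?ImM ?ReN ?ImN /=; ring.
rewrite exprS.
transitivity ('i ^+ a * s%:C ^+ 2 * (m (l - a))%:C * (m a)%:C *
    ('C(l.+1, a)%:R * (l - a).+1%:R + 'i * 'i * ('C(l.+1, a.+1)%:R * a.+1%:R))); first by ring.
by rewrite e1 e2 i2; ring.
Qed.

(** From (x + y)^q <= 2^q (x^q + y^q) with x, y the squares of the real and imaginary parts; only
    the order of magnitude s^(2q) matters later. *)
Lemma normc_complex_gaussian q :
  (\int[P]_w (normc (X w +i* Y w) ^+ (2 * q))%:E <=
     (2 ^+ q.+1 * (odd_fact q)%:R * (s ^+ 2) ^+ q)%:E)%E.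
Proof.
have [iX eX] := law_momentX (2 * q); have [iY eY] := law_momentY (2 * q).
have fX : (\int[P]_w (X w ^+ (2 * q))%:E = (m (2 * q))%:E)%E.
  by rewrite -eX fineK//; exact: integrable_fin_num iX.
have fY : (\int[P]_w (Y w ^+ (2 * q))%:E = (m (2 * q))%:E)%E.
  by rewrite -eY fineK//; exact: integrable_fin_num iY.
have [mxi ixi] := moments_complex_gaussian.
apply: (@le_trans _ _ (\int[P]_w ((2 ^+ q)%:E *
    ((X w ^+ (2 * q))%:E + (Y w ^+ (2 * q))%:E)))%E).
  apply: le_integral => //.
  - by apply: integrableZl => //; exact: integrableD.
  move=> w _; rewrite -EFinD -EFinM lee_fin !exprM normc_sq/=.
  set x := X w ^+ 2; set y := Y w ^+ 2.
  have x0 : 0 <= x := sqr_ge0 _; have y0 : 0 <= y := sqr_ge0 _.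
  have [xy|/ltW xy] := leP x y.
  - apply: (@le_trans _ _ ((2 * y) ^+ q)).
      by apply: lerXn2r; rewrite ?nnegrE; lra.
    by rewrite exprMn ler_pM2l ?exprn_gt0// lerDr exprn_ge0.
  - apply: (@le_trans _ _ ((2 * x) ^+ q)).
      by apply: lerXn2r; rewrite ?nnegrE; lra.
    by rewrite exprMn ler_pM2l ?exprn_gt0// lerDl exprn_ge0.
rewrite integralZl//; last exact: integrableD.
rewrite integralD// fX fY -EFinD -EFinM lee_fin normal_moment_even//.
by rewrite [2 ^+ q.+1]exprS le_eqVlt; apply/orP; left; apply/eqP; ring.
Qed.

End complex_gaussian.

(** * Independence from the past *)

Section pi_lambda.
Context d (Omega : measurableType d) (R : realType) (P : probability Omega R).

(** For fixed E the events A that factor form a Dynkin system, and G is a pi-system contained in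
    it. *)
Lemma indep_generated (G : set (set Omega)) (E : set Omega) :
  setI_closed G -> G `<=` measurable -> measurable E ->
  (forall A, G A -> P (A `&` E) = (P A * P E)%E) ->
  forall A, <<s G >> A -> P (A `&` E) = (P A * P E)%E.
Proof.
move=> GI mG mE GE.
have mS : <<s G >> `<=` measurable.
  by apply: smallest_sub => //; exact: sigma_algebra_measurable.
apply: (@dynkin_induction _ (g_sigma_algebraType G) G
    (fun A => P (A `&` E) = (P A * P E)%E)) => //.
- by rewrite setTI probability_setT mul1e.
- move=> A /mS mA AE.
  rewrite probability_setC// muleBl ?fin_num_adde_defr ?fin_num_measure// mul1e.
  rewrite -AE setIC -setDE measureD//; last by rewrite ltey_eq fin_num_measure.
  by rewrite setIC.
- move=> F /(_ _)/mS mF tF FE; rewrite setI_bigcupl measure_bigcup//; last 2 first.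
  - by move=> k _; exact: measurableI.
  - exact: trivIset_setIr.
  rewrite measure_bigcup//.
  rewrite muleC -(@fineK _ (P E)) ?fin_num_measure// -nneseriesZl//.
  by apply: eq_eseriesr => k _; rewrite fineK ?fin_num_measure// muleC; exact: FE.
Qed.

End pi_lambda.

Definition process_past d (Omega : measurableType d) (R : realType) d'
    (T' : measurableType d') (Z : R -> Omega -> T') (t : R) : set (set Omega) :=
  [set A | exists2 s : R, 0 <= s <= t & rv_sigma (Z s) A].

Section brownian_past.
Context d (Omega : measurableType d) (R : realType) (P : probability Omega R).
Variable X : R -> Omega -> R.
Hypothesis bmX : brownian_motion P X.
Variables t t' : R.
Hypotheses (t0 : 0 <= t) (tt' : t < t').

(** The times form an arbitrary list, so that an intersection of cylinders is a concatenation of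
    lists; the order of the times is dealt with once, in [cylinder_indep]. *)
Inductive cylinder : seq R -> set Omega -> Prop :=
| cylinder_nil : cylinder [::] setT
| cylinder_cons s C ts A : measurable C -> cylinder ts A ->
    cylinder (s :: ts) (X s @^-1` C `&` A).

Let cylinder_cat ts A ts' A' :
  cylinder ts A -> cylinder ts' A' -> cylinder (ts ++ ts') (A `&` A').
Proof.
move=> cA cA'; elim: cA => [|s C {}ts {}A mC _ ih] /=; first by rewrite setTI.
by rewrite -setIA; exact: cylinder_cons.
Qed.

Let in_past (ts : seq R) := all (fun s => 0 <= s <= t) ts.

Let mX s : 0 <= s -> measurable_fun setT (X s).
Proof. by case: bmX => mX _ _ _ _; exact: mX. Qed.

Let measurable_cylinder ts A : in_past ts -> cylinder ts A -> measurable A.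
Proof.
move=> + cA; elim: cA => [|s C {}ts {}A mC _ ih] //= /andP[/andP[s0 _] pts].
by apply: measurableI; [rewrite -[_ @^-1` _]setTI; exact: mX|exact: ih].
Qed.

Let E (D : set R) := [set w | D (X t' w - X t w)].

Let measurable_E D : measurable D -> measurable (E D).
Proof.
move=> mD; have mt : measurable_fun setT (fun w => X t' w - X t w).
  by apply: measurable_funB; apply: mX => //; exact: le_trans (ltW tt').
by have := mt measurableT D mD; rewrite setTI.
Qed.

(** Independence is given for successive increments, not for values. The times are sorted and
    completed by 0, t and t'. The values at past times are sums of the increments before t, so the
    cylinder lies in the sigma-algebra these generate, and the increment from t to t' is independent
    of it. *)
Let cylinder_indep ts A D : in_past ts -> cylinder ts A -> measurable D ->
  P (A `&` E D) = (P A * P (E D))%E.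
Proof.
move=> pts cA mD.
pose st := sort <=%R ts.
(* [tau] runs through 0, the sorted times and t, and then stays at t'. Increment number q is
   therefore the one from t to t'. *)
pose tau i := nth t' (0 :: rcons st t) i.
pose q := (size st).+1.
have tauq : tau q = t by rewrite /tau /q /= nth_rcons ltnn eqxx.
have tauS : tau q.+1 = t' by rewrite /tau nth_default//= size_rcons.
have sst : path <=%R 0 (rcons st t).
  rewrite rcons_path; apply/andP; split.
    rewrite path_min_sorted; first exact/sort_sorted/le_total.
    by apply/allP => s; rewrite mem_sort => /(allP pts)/andP[].
  have : last 0 st \in 0 :: st by exact: mem_last.
  by rewrite inE => /orP[/eqP->//|]; rewrite mem_sort => /(allP pts)/andP[].
have tau_ndecr i : tau i <= tau i.+1.
  have [iq|qi] := ltnP i q.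
    by have /pathP := sst; apply; rewrite size_rcons.
  rewrite [leRHS]/tau nth_default; last by rewrite /= size_rcons.
  move: qi; rewrite leq_eqVlt => /orP[/eqP <-|qi]; first by rewrite tauq ltW.
  by rewrite /tau nth_default//= size_rcons.
have tau_ge0 i : 0 <= tau i.
  by elim: i => [|i ih]; [rewrite /tau|exact: le_trans (tau_ndecr i)].
pose I i w := X (tau i.+1) w - X (tau i) w.
have mI i : measurable_fun setT (I i) by apply: measurable_funB; exact: mX.
have indI (C : nat -> set R) : (forall i, measurable (C i)) ->
    P (\bigcap_(i < q.+1) I i @^-1` C i) = (\prod_(i < q.+1) P (I i @^-1` C i))%E.
  move=> mC; case: bmX => _ _ _ _ /(_ q.+1 tau (tau_ge0 0%N) tau_ndecr).
  move=> /(_ finset.setT (fun i => I i @^-1` C i)) => h.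
  rewrite (_ : \bigcap_(i < q.+1) _ =
    \bigcap_(i in [set i | i \in [set: 'I_q.+1]%SET]) (I i @^-1` C i)).
    rewrite h; first by apply: eq_bigl => i; rewrite inE.
    by move=> i _; exists (C i).
  apply/seteqP; split=> [w h' i _|w h' i /= iq]; first exact: h' (ltn_ord i).
  by have := h' (Ordinal iq); rewrite /= inE; exact.
pose G : set (set Omega) := [set A | exists2 C : nat -> set R,
  (forall i, measurable (C i)) & A = \bigcap_(i < q) I i @^-1` C i].
have GI : setI_closed G.
  move=> _ _ [C mC ->] [C' mC' ->]; exists (fun i => C i `&` C' i).
    by move=> i; exact: measurableI.
  by rewrite -bigcapI.
have mG : G `<=` measurable.
  move=> _ [C mC ->]; apply: fin_bigcap_measurable; first exact: finite_II.
  by move=> i _; rewrite -[_ @^-1` _]setTI; exact: mI.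
have bigcapS (C : nat -> set R) D' : \bigcap_(i < q) I i @^-1` C i `&` E D' =
    \bigcap_(i < q.+1) I i @^-1` (if i == q then D' else C i).
  apply/seteqP; split=> [w [h1 h2] i /= |w h].
    rewrite ltnS leq_eqVlt => /orP[/eqP ->|iq]; last by rewrite ltn_eqF//; exact: h1.
    by rewrite eqxx /I tauS tauq.
  split=> [i /= iq|].
    by have := h i (ltnW iq); rewrite /= ltn_eqF.
  by have := h q (ltnSn q); rewrite /= eqxx /I tauS tauq.
have GE A' : G A' -> P (A' `&` E D) = (P A' * P (E D))%E.
  move=> [C mC ->].
  have mif D' : measurable D' -> forall i, measurable (if i == q then D' else C i).
    by move=> mD' i; case: ifP.
  have PE D' : measurable D' -> P (\bigcap_(i < q) I i @^-1` C i `&` E D') =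
      (\prod_(i < q) P (I i @^-1` C i) * P (E D'))%E.
    move=> mD'; rewrite bigcapS indI; last exact: mif.
    rewrite big_ord_recr/= eqxx; congr (_ * _)%E.
      by apply: eq_bigr => i _; rewrite ltn_eqF.
    by congr (P _); apply/seteqP; split=> w; rewrite /I /E/= tauS tauq.
  rewrite PE//; congr (_ * _)%E.
  (* Leaving the last increment unconstrained evaluates the product over the earlier ones. *)
  have := PE setT measurableT; rewrite (_ : E setT = setT); last exact/seteqP.
  by rewrite setIT probability_setT mule1.
(* The process starts at 0, so its value at [tau i] is the sum of the first i increments. *)
have XG i : (i <= q)%N -> @measurable_fun _ _ (g_sigma_algebraType G) R setT (X (tau i)).
  elim: i => [_|i ih iq].
    by rewrite (_ : X _ = cst 0) //; apply/funext => w; case: bmX => _ X0 _ _ _; exact: X0.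
  rewrite (_ : X (tau i.+1) = fun w => I i w + X (tau i) w); last first.
    by apply/funext => w; rewrite /I subrK.
  apply: measurable_funD; last exact: ih (ltnW iq).
  move=> _ C mC; rewrite setTI; apply: sub_gen_smallest.
  exists (fun j => if j == i then C else setT); first by move=> j; case: ifP.
  apply/seteqP; split=> [w Cw j _ /=|w /(_ i iq)/=]; last by rewrite eqxx.
  by case: eqP => [->|].
apply: (indep_generated GI mG (measurable_E mD) GE).
have : {subset ts <= st} by move=> s; rewrite mem_sort.
elim: cA => [_|s C us A' mC _ ih sub]; first exact: (@measurableT _ (g_sigma_algebraType G)).
apply: (@measurableI _ (g_sigma_algebraType G)); last first.
  by apply: ih => u uts; apply: sub; rewrite inE uts orbT.
have sst' : s \in st by apply: sub; rewrite inE eqxx.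
have -> : s = tau (index s st).+1.
  by rewrite /tau/= nth_rcons index_mem sst' nth_index.
have iq : ((index s st).+1 <= q)%N by rewrite ltnS index_size.
by have := XG _ iq measurableT C mC; rewrite setTI.
Qed.

Lemma brownian_past_indep (A : set Omega) (D : set R) : <<s process_past X t >> A -> measurable D ->
  P (A `&` [set w | D (X t' w - X t w)]) =
  (P A * P [set w | D (X t' w - X t w)%R])%E.
Proof.
move=> pA mD.
pose G := [set A | exists2 ts, in_past ts & cylinder ts A].
apply: (@indep_generated _ _ _ P G).
- move=> A1 A2 [ts1 p1 c1] [ts2 p2 c2]; exists (ts1 ++ ts2).
    by rewrite /in_past all_cat; apply/andP.
  exact: cylinder_cat.
- by move=> A' [ts pts cts]; exact: measurable_cylinder cts.
- exact: measurable_E.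
- by move=> A' [ts pts cts]; exact: cylinder_indep cts mD.
move: A pA; apply: smallest_sub; first exact: smallest_sigma_algebra.
move=> A' [s s0t [C mC ->]].
apply: sub_gen_smallest; exists [:: s]; first by rewrite /in_past/= s0t.
by rewrite -[_ @^-1` _]setIT; apply: cylinder_cons => //; exact: cylinder_nil.
Qed.

End brownian_past.

Section complex_brownian_past.
Context d (Omega : measurableType d) (R : realType) (P : probability Omega R).
Variables (N : nat) (B : 'I_N -> R -> Omega -> R[i]).
Hypothesis bmB : independent_complex_bm P B.

Let re n t w := complex.Re (B n t w).
Let im n t w := complex.Im (B n t w).

(** What is known when coordinate n of the walk is about to move at time t: the whole paths of the
    earlier motions, and the path of motion n up to t. Real and imaginary parts enter separately
    because [brownian_past_indep] concerns real motions. *)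
Definition bm_past (n : 'I_N) (t : R) : set (set Omega) :=
  [set A | (exists2 i : 'I_N, (i < n)%N & process_sigma (B i) A) \/
           (process_past (re n) t A \/ process_past (im n) t A)].

Let bm_re n : brownian_motion P (re n). Proof. by case: bmB => /(_ n)[]. Qed.
Let bm_im n : brownian_motion P (im n). Proof. by case: bmB => /(_ n)[]. Qed.

Lemma cmeasurable_bm n t : 0 <= t -> cmeasurable (B n t).
Proof.
by move=> t0; split; [have [h] := bm_re n|have [h] := bm_im n]; move=> *; exact: h.
Qed.

Lemma process_sigma_measurable d' (T' : measurableType d') (Z : R -> Omega -> T') :
  (forall t, 0 <= t -> measurable_fun setT (Z t)) ->
  process_sigma Z `<=` measurable.
Proof.
move=> mZ; apply: smallest_sub; first exact: sigma_algebra_measurable.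
by move=> A [t t0 [C mC ->]]; rewrite -[_ @^-1` _]setTI; exact: mZ.
Qed.

Lemma process_past_sub d' (T' : measurableType d') (Z : R -> Omega -> T') t :
  <<s process_past Z t >> `<=` process_sigma Z.
Proof.
apply: smallest_sub; first exact: smallest_sigma_algebra.
move=> A [s /andP[s0 _] sA]; apply: sub_gen_smallest; by exists s.
Qed.

Let measurable_Re : measurable_fun setT (@complex.Re R : R[i] -> R).
Proof. by have [] := (cmeasurableP (@idfun R[i])).2 (@measurable_id _ _ _). Qed.

Let measurable_Im : measurable_fun setT (@complex.Im R : R[i] -> R).
Proof. by have [] := (cmeasurableP (@idfun R[i])).2 (@measurable_id _ _ _). Qed.

Let re_sub n : process_sigma (re n) `<=` process_sigma (B n).
Proof.
apply: smallest_sub; first exact: smallest_sigma_algebra.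
move=> A [s s0 [C mC ->]]; apply: sub_gen_smallest; exists s => //.
exists (@complex.Re R @^-1` C) => //.
by have := measurable_Re measurableT mC; rewrite setTI.
Qed.

Let im_sub n : process_sigma (im n) `<=` process_sigma (B n).
Proof.
apply: smallest_sub; first exact: smallest_sigma_algebra.
move=> A [s s0 [C mC ->]]; apply: sub_gen_smallest; exists s => //.
exists (@complex.Im R @^-1` C) => //.
by have := measurable_Im measurableT mC; rewrite setTI.
Qed.

Variables (n : 'I_N) (t t' : R).
Hypotheses (t0 : 0 <= t) (tt' : t < t').

Let E (Z : R -> Omega -> R) (D : set R) : set Omega := [set w | D (Z t' w - Z t w)].

Let E_process Z D : measurable D -> process_sigma Z (E Z D).
Proof.
move=> mD.
have mZ s : 0 <= s -> @measurable_fun _ _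
    (g_sigma_algebraType [set A | exists2 t : R, 0 <= t & rv_sigma (Z t) A]) R setT (Z s).
  move=> s0 _ C mC; rewrite setTI; apply: sub_gen_smallest; exists s => //.
  by exists C.
have := measurable_funB (mZ _ (le_trans t0 (ltW tt'))) (mZ _ t0).
by move=> /(_ measurableT D mD); rewrite setTI.
Qed.

Let lower (F : 'I_N -> set Omega) : set Omega := \bigcap_(i in [set i : 'I_N | (i < n)%N]) F i.

Let split_lower F A : (forall i, process_sigma (B i) (F i)) -> process_sigma (B n) A ->
  P (lower F `&` A) = (\prod_(i < N | (i < n)%N) P (F i) * P A)%E.
Proof.
move=> sF sA; have [_ /(_ [set i : 'I_N | (i <= n)%N]%SET)] := bmB.
move=> /(_ (fun i => if i == n then A else F i)) h.
rewrite (_ : _ `&` _ = \bigcap_(i in [set i | i \in [set i : 'I_N | (i <= n)%N]%SET])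
    (if i == n then A else F i)).
  rewrite h; last by move=> i _; case: eqP => [->|].
  rewrite (bigD1 n) ?inE//= eqxx muleC; congr (_ * _)%E.
  apply: eq_big => [i|i /andP[_ /negbTE ->]//].
  by rewrite inE ltn_neqAle andbC.
apply/seteqP; split=> [w [h1 h2] i|w h'].
  rewrite /= inE leq_eqVlt => /orP[/eqP/val_inj ->|iq]; first by rewrite eqxx.
  by case: eqP => // _; exact: h1.
split=> [i /= iq|].
  have := h' i; rewrite /= inE (ltnW iq) => /(_ isT).
  by case: eqP => // e; rewrite e ltnn in iq.
by have := h' n; rewrite /= inE leqnn eqxx => /(_ isT).
Qed.

Let split_re_im A1 A2 : process_sigma (re n) A1 -> process_sigma (im n) A2 ->
  P (A1 `&` A2) = (P A1 * P A2)%E.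
Proof.
move=> s1 s2; have [/(_ n)[_ _ /(_ [set: bool]%SET (fun b => if b then A1 else A2))] h _] := bmB.
rewrite (_ : _ `&` _ = \bigcap_(b in [set b | b \in [set: bool]%SET]) (if b then A1 else A2)).
  rewrite h; last by case.
  by rewrite (eq_bigl xpredT) ?big_bool// => b; rewrite inE.
apply/seteqP; split=> [w [h1 h2] [] _//|w h'].
by split; [have := h' true|have := h' false]; rewrite /= inE; exact.
Qed.

(** A pi-system generating at least [bm_past n t]: one event for each motion, of which only those
    before n count, and one event in the past of each part of motion n. On it every independence
    assumption can be used as a product formula. *)
Let G : set (set Omega) := [set A | exists F R1 R2,
  [/\ forall i, process_sigma (B i) (F i),
     <<s process_past (re n) t >> R1, <<s process_past (im n) t >> R2 &
     A = lower F `&` (R1 `&` R2)]].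

Let sub_process (X : set (set Omega)) A A' : <<s X >> A -> <<s X >> A' -> <<s X >> (A `&` A').
Proof. exact: (@measurableI _ (g_sigma_algebraType X)). Qed.

Let sub_processT (X : set (set Omega)) : <<s X >> setT.
Proof. exact: (@measurableT _ (g_sigma_algebraType X)). Qed.

(** The probability is factored over the motions, then over the real and imaginary parts of motion
    n, then over past and increment of each part; the factors are regrouped in the end. *)
Let G_indep A D1 D2 : G A -> measurable D1 -> measurable D2 ->
  P (A `&` (E (re n) D1 `&` E (im n) D2)) =
  (P A * P (E (re n) D1 `&` E (im n) D2))%E.
Proof.
move=> [F [R1 [R2 [sF s1 s2 ->]]]] mD1 mD2.
have p1 := process_past_sub s1; have p2 := process_past_sub s2.
have e1 := @E_process (re n) _ mD1; have e2 := @E_process (im n) _ mD2.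
rewrite -setIA (_ : R1 `&` R2 `&` (E (re n) D1 `&` E (im n) D2) =
    (R1 `&` E (re n) D1) `&` (R2 `&` E (im n) D2)); last by rewrite setIACA.
rewrite !split_lower//; last 2 first.
- exact: sub_process (re_sub p1) (im_sub p2).
- exact: sub_process (re_sub (sub_process p1 e1)) (im_sub (sub_process p2 e2)).
rewrite (split_re_im p1 p2) (split_re_im e1 e2).
rewrite (split_re_im (sub_process p1 e1) (sub_process p2 e2)).
have -> : P (R1 `&` E (re n) D1) = (P R1 * P (E (re n) D1))%E.
  exact: (brownian_past_indep (bm_re n) t0 tt' s1 mD1).
have -> : P (R2 `&` E (im n) D2) = (P R2 * P (E (im n) D2))%E.
  exact: (brownian_past_indep (bm_im n) t0 tt' s2 mD2).
by rewrite -!muleA; congr (_ * (_ * _))%E; rewrite muleCA.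
Qed.

Let GI : setI_closed G.
Proof.
move=> _ _ [F [R1 [R2 [sF s1 s2 ->]]]] [F' [R1' [R2' [sF' s1' s2' ->]]]].
exists (fun i => F i `&` F' i), (R1 `&` R1'), (R2 `&` R2'); split.
- by move=> i; exact: (sub_process (sF i) (sF' i)).
- exact: (sub_process s1 s1').
- exact: (sub_process s2 s2').
- by rewrite /lower bigcapI setIACA (setIACA R1).
Qed.

Let G_measurable : G `<=` measurable.
Proof.
move=> _ [F [R1 [R2 [sF s1 s2 ->]]]].
have mB i A : process_sigma (B i) A -> measurable A.
  move=> sA; apply: (process_sigma_measurable _ sA) => s s0.
  by apply/cmeasurableP; exact: cmeasurable_bm.
apply: measurableI.
  by apply: fin_bigcap_measurable => // i _; exact: (mB i).
apply: measurableI; apply: (mB n).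
  exact: re_sub (process_past_sub s1).
exact: im_sub (process_past_sub s2).
Qed.

Lemma bm_past_subG : <<s bm_past n t >> `<=` <<s G >>.
Proof.
apply: smallest_sub; first exact: smallest_sigma_algebra.
have lowerT : lower (fun=> setT) = setT by apply/seteqP; split.
move=> A [[i iq sA]|[pA|pA]]; apply: sub_gen_smallest.
- exists (fun j => if j == i then A else setT), setT, setT; split=> //.
    by move=> j; case: eqP => [->//|_]; exact: sub_processT.
  rewrite !setIT; apply/seteqP; split=> [w Aw j _ /=|w /(_ i iq)]; last by rewrite eqxx.
  by case: eqP.
- exists (fun=> setT), A, setT; split=> //; last by rewrite lowerT setTI setIT.
    by move=> j; exact: sub_processT.
  exact: sub_gen_smallest.
- exists (fun=> setT), setT, A; split=> //; last by rewrite lowerT !setTI.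
    by move=> j; exact: sub_processT.
  exact: sub_gen_smallest.
Qed.

Lemma bm_past_measurable : <<s bm_past n t >> `<=` measurable.
Proof.
apply: (subset_trans bm_past_subG).
by apply: smallest_sub => //; exact: sigma_algebra_measurable.
Qed.

(** Two pi-lambda arguments: one in the Borel set, generated by rectangles in real and imaginary
    part, and for a fixed rectangle one in the past event, generated by [G]. *)
Lemma bm_past_indep :
  indep_sigma P (bm_past n t) (fun w => B n t' w - B n t w).
Proof.
move=> A D /bm_past_subG GA [D' mD' <-]; rewrite setTI.
pose xi w := (re n t' w - re n t w, im n t' w - im n t w).
have -> : (fun w => B n t' w - B n t w) @^-1` (@complex_pair R @^-1` D') = xi @^-1` D'.
  by apply/funext => w; rewrite /preimage /complex_pair /= ReD ImD ReN ImN.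
pose H : set (set Omega) := [set xi @^-1` C | C in
  [set A1 `*` A2 | A1 in (measurable : set (set R)) & A2 in (measurable : set (set R))]].
have HE D1 D2 : xi @^-1` (D1 `*` D2) = E (re n) D1 `&` E (im n) D2.
  by apply/seteqP; split.
have mE D1 D2 : measurable D1 -> measurable D2 ->
    measurable (E (re n) D1 `&` E (im n) D2).
  move=> m1 m2; apply: measurableI.
    apply: (process_sigma_measurable _ (@E_process (re n) _ m1)) => s s0.
    by case: (bm_re n) => h *; exact: h.
  apply: (process_sigma_measurable _ (@E_process (im n) _ m2)) => s s0.
  by case: (bm_im n) => h *; exact: h.
rewrite setIC muleC; apply: (@indep_generated _ _ _ P H).
- move=> _ _ [_ [A1 m1 [A2 m2 <-]] <-] [_ [A1' m1' [A2' m2' <-]] <-].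
  rewrite -preimage_setI -setXI; exists ((A1 `&` A1') `*` (A2 `&` A2')) => //.
  exists (A1 `&` A1'); first exact: measurableI.
  by exists (A2 `&` A2') => //; exact: measurableI.
- by move=> _ [_ [A1 m1 [A2 m2 <-]] <-]; rewrite HE; exact: mE.
- by apply: (smallest_sub _ G_measurable) GA; exact: sigma_algebra_measurable.
- move=> _ [_ [A1 m1 [A2 m2 <-]] <-]; rewrite HE setIC muleC.
  apply: (indep_generated GI G_measurable) GA; first exact: mE.
  by move=> A' GA'; exact: G_indep.
- have : preimage_set_system setT xi measurable (xi @^-1` D') by exists D' => //; rewrite setTI.
  rewrite measurable_prod_measurableType -g_sigma_preimageE.
  move: (xi @^-1` D'); apply: smallest_sub; first exact: smallest_sigma_algebra.
  move=> _ [C pC <-]; rewrite setTI; apply: sub_gen_smallest; by exists C.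
Qed.

Lemma bm_increment_law D : measurable D ->
  (P (E (re n) D) = normal_prob 0 (Num.sqrt (t' - t)) D /\
   P (E (im n) D) = normal_prob 0 (Num.sqrt (t' - t)) D).
Proof.
by move=> mD; split; [have [_ _ _ h _] := bm_re n|have [_ _ _ h _] := bm_im n]; exact: h.
Qed.

Lemma bm_increment_indep D1 D2 : measurable D1 -> measurable D2 ->
  P (E (re n) D1 `&` E (im n) D2) = (P (E (re n) D1) * P (E (im n) D2))%E.
Proof. by move=> m1 m2; apply: split_re_im; exact: E_process. Qed.

End complex_brownian_past.

(** * Fourier coefficients on the torus *)

Section circle_fourier.
Context (R : realType).
Implicit Types z w : R[i].

(** The factor r^|k| theta^k of [trig_eval], written as a power of z or of its conjugate. This form
    is a polynomial also at z = 0, and shows that nonnegative frequencies are holomorphic. *)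
Definition zpow (k : int) z : R[i] :=
  match k with Posz p => z ^+ p | Negz p => conjc z ^+ p.+1 end.

Lemma zpowE k z : `|z| ^+ `|k|%N * (z / `|z|) ^ k = zpow k z.
Proof.
have [->|z0] := eqVneq z 0.
  rewrite normr0 invr0 mulr0; case: k => [[|p]|p]; rewrite /zpow ?absz_nat.
  - by rewrite expr0 expr0z mulr1.
  - by rewrite !expr0n mul0r.
  - by rewrite conjc0 !expr0n mul0r.
have n0 : `|z| != 0 by rewrite normr_eq0.
case: k => p; rewrite /zpow; first by rewrite -exprnP -exprMn mulrCA divff// mulr1.
rewrite NegzE -exprnN -exprVn -exprMn; congr (_ ^+ _).
rewrite invf_div mulrA -expr2 complex.sqr_normc.
by rewrite mulrAC divff// mul1r.
Qed.

Lemma zpow0 z : zpow 0 z = 1. Proof. exact: expr0. Qed.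

Lemma zpow_at0 k : zpow k 0 = (k == 0)%:R.
Proof. by case: k => [[|p]|p]; rewrite /zpow ?conjc0 ?expr0n. Qed.

Lemma conjcD z w : conjc (z + w) = conjc z + conjc w.
Proof. by apply: complexP; rewrite ?(ReD, ImD, ReJ, ImJ) ?opprD. Qed.

Lemma conjcM z w : conjc (z * w) = conjc z * conjc w.
Proof. by apply: complexP; rewrite ?(ReM, ImM, ReJ, ImJ); ring. Qed.

Lemma conjcX z p : conjc (z ^+ p) = conjc z ^+ p.
Proof.
elim: p => [|p ih]; last by rewrite !exprS conjcM ih.
by rewrite !expr0 conjc1.
Qed.

Lemma zpowN k z : zpow (- k) z = conjc (zpow k z).
Proof.
case: k => [[|p]|p].
- by rewrite oppr0 /zpow !expr0 conjc1.
- by rewrite /zpow conjcX.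
- by rewrite /zpow conjcX conjcK.
Qed.

Lemma normc_zpow k z : normc (zpow k z) = normc z ^+ `|k|%N.
Proof. by case: k => p; rewrite /zpow ncX ?ncJ. Qed.

Lemma cmeasurable_zpow k d (T : measurableType d) (X : T -> R[i]) :
  cmeasurable X -> cmeasurable (fun t => zpow k (X t)).
Proof.
by move=> mX; case: k => p /=; apply: cmeasurableX => //; exact: cmeasurableJ.
Qed.

Lemma cisX p (t : R) : cis t ^+ p = cis (p%:R * t).
Proof.
elim: p => [|p ih]; first by rewrite expr0 mul0r /cis cos0 sin0.
rewrite exprS ih -natr1 mulrDl mul1r [_ + t]addrC.
by apply: complexP; rewrite ?ReM ?ImM /= ?cosD ?sinD//= [in RHS]addrC.
Qed.

Lemma normc_cis (t : R) : normc (cis t) = 1.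
Proof. by rewrite /= cos2Dsin2 sqrtr1. Qed.

Local Notation mu := (@lebesgue_measure R).
Local Notation U := (uniform_prob (@two_pi_gt0 R)).

(** The function 1 + f is nonnegative with primitive x + F(x), so it is integrable with mean 1
    because F takes the same value at 0 and 2 pi; subtracting 1 gives the claim for f. *)
Let integral_trig (f F : R -> R) : (forall x, -1 <= f x) ->
  (forall x : R, is_derive x (1 : R) F (f x)) -> continuous f ->
  F 0 = F (pi *+ 2) -> \int[U]_x f x = 0 /\ U.-integrable setT (EFin \o f).
Proof.
move=> f1 dF cf F02.
have mf : measurable_fun setT f by exact: continuous_measurable_fun.
have p0 := two_pi_gt0 R.
have E : (\int[U]_x (1 + f x)%:E = 1)%E.
  rewrite integral_uniform//; last 2 first.
  - by apply/measurable_EFinP; exact: measurable_funD.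
  - by move=> x; rewrite lee_fin -lerBlDl sub0r.
  have dG (x : R) : is_derive x (1 : R) (fun y => y + F y) (1 + f x).
    by apply: is_derive_eq.
  rewrite (@continuous_FTC2 _ _ (fun y => y + F y))//.
  - by rewrite -EFinB -EFinM add0r subr0 F02 addrK mulVf// gt_eqF.
  - apply: continuous_subspaceT => x; apply: cvgD; [exact: cvg_cst|exact: cf].
  - have cG x : {for x, continuous (fun y => y + F y)}.
      apply: differentiable_continuous; apply/derivable1_diffP.
      by have [] := dG x.
    split=> [x _||]; first by have [] := dG x.
    + exact/cvg_at_right_filter/cG.
    + exact/cvg_at_left_filter/cG.
  - by move=> x _; rewrite derive1E; have [_ ->] := dG x.
have i1 : U.-integrable setT (fun x => (1 + f x)%:E).
  apply/integrableP; split; first by apply/measurable_EFinP; exact: measurable_funD.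
  under eq_integral do rewrite gee0_abs ?lee_fin -?lerBlDl ?sub0r//.
  by rewrite E ltry.
have ic : U.-integrable setT (fun=> 1%:E) by exact: finite_measure_integrable_cst.
have i2 : U.-integrable setT (EFin \o f).
  have := integrableB measurableT i1 ic; congr (U.-integrable _ _).
  by apply/funext => x /=; rewrite -EFinB addrAC subrr add0r.
split=> //; have : \int[U]_x (1 + f x) = 1 by rewrite /Rintegral E.
have e1 : \int[U]_x 1 = 1 :> R.
  rewrite /Rintegral integral_cst//.
  transitivity (fine (1%:E * 1%:E) : R); last by rewrite mule1.
  congr (fine (_ * _)%E); exact: (@probability_setT _ _ _ U).
rewrite RintegralD// e1 => /eqP.
by rewrite -subr_eq0 addrAC subrr add0r => /eqP.
Qed.

Lemma zpow_cis k (t : R) : zpow k (cis t) = cis (k%:~R * t).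
Proof.
case: k => p; rewrite /zpow; first by rewrite cisX.
rewrite -conjcX cisX NegzE mulrNz mulNr.
by apply: complexP; rewrite ?ReJ ?ImJ /= ?cosN ?sinN.
Qed.

Let cis_trig (r : R) : r != 0 -> cis (r * (pi *+ 2)) = 1 ->
  [/\ \int[U]_x cos (r * x) = 0, U.-integrable setT (fun x => (cos (r * x))%:E),
      \int[U]_x sin (r * x) = 0 & U.-integrable setT (fun x => (sin (r * x))%:E)].
Proof.
move=> r0 [cos1 sin0'].
have cM : continuous (fun x : R => r * x) by move=> x; apply: cvgMr; exact: cvg_id.
have cc : continuous (fun x : R => cos (r * x)).
  by move=> x; apply: continuous_comp; [exact: cM|exact: continuous_cos].
have cs : continuous (fun x : R => sin (r * x)).
  by move=> x; apply: continuous_comp; [exact: cM|exact: continuous_sin].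
have [|||i1 i2] := @integral_trig (fun x => cos (r * x)) (fun x => sin (r * x) / r) _ _ cc.
- by move=> x; exact: cos_geN1.
- move=> x; apply: is_derive_eq.
  by rewrite /GRing.scale/=; field.
- by rewrite mulr0 sin0 sin0'.
have [|||i3 i4] := @integral_trig (fun x => sin (r * x)) (fun x => - cos (r * x) / r) _ _ cs.
- by move=> x; exact: sin_geN1.
- move=> x; apply: is_derive_eq.
  by rewrite /GRing.scale/=; field.
- by rewrite mulr0 cos0 cos1.
by split.
Qed.

Lemma circle_zpow k : complex_integrable (circle_prob R) (zpow k) /\
  cexp (circle_prob R) (zpow k) = (k == 0)%:R.
Proof.
have [->|k0] := eqVneq k 0.
  have -> : zpow 0 = (fun=> 1) by apply/funext => z; exact: zpow0.
  split; first exact: complex_integrable_cst.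
  exact: cexp_cst.
have r0 : k%:~R != 0 :> R by rewrite intr_eq0.
have p1 : cis (k%:~R * (pi *+ 2)) = 1 :> R[i].
  have c1 : cis (pi *+ 2 : R) = 1 by rewrite /cis cos2pi -(add0r (pi *+ 2)) sinD2pi sin0.
  rewrite -zpow_cis c1; case: k {k0 r0} => p; rewrite /zpow ?conjc1 expr1n//.
have [i1 i2 i3 i4] := cis_trig r0 p1.
have [mr mi] := cmeasurable_zpow k ((cmeasurableP (@idfun R[i])).2 (@measurable_id _ _ _)).
have mr' : measurable_fun setT (fun z : R[i] => (complex.Re (zpow k z))%:E) by exact/measurable_EFinP.
have mi' : measurable_fun setT (fun z : R[i] => (complex.Im (zpow k z))%:E) by exact/measurable_EFinP.
have er : (fun z : R[i] => (complex.Re (zpow k z))%:E) \o @cis R = fun t => (cos (k%:~R * t))%:E.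
  by apply/funext => t /=; rewrite zpow_cis.
have ei : (fun z : R[i] => (complex.Im (zpow k z))%:E) \o @cis R = fun t => (sin (k%:~R * t))%:E.
  by apply/funext => t /=; rewrite zpow_cis.
split.
  by split; apply: integrable_pushforward => //; rewrite preimage_setT ?er ?ei.
rewrite /cexp /complex_integral; apply: complexP.
- rewrite /= /Rintegral integral_pushforward//; last by rewrite preimage_setT er.
  by rewrite preimage_setT er; move: i1; rewrite /Rintegral.
- rewrite /= /Rintegral integral_pushforward//; last by rewrite preimage_setT ei.
  by rewrite preimage_setT ei; move: i3; rewrite /Rintegral.
Qed.

End circle_fourier.

Lemma cexp_distribution d d' (T : measurableType d) (T' : measurableType d')
    (R : realType) (mu : probability T R) (h : {RV mu >-> T'}) (f : T' -> R[i]) :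
  cmeasurable f -> complex_integrable mu (f \o h) ->
  complex_integrable (distribution mu h) f /\
  cexp (distribution mu h) f = cexp mu (f \o h).
Proof.
move=> [mr mi] [ir ii].
have mr' : measurable_fun setT (fun z => (complex.Re (f z))%:E) by exact/measurable_EFinP.
have mi' : measurable_fun setT (fun z => (complex.Im (f z))%:E) by exact/measurable_EFinP.
split; first by split; exact: integrable_pushforward.
rewrite /cexp /complex_integral; apply: complexP.
- by rewrite /= /Rintegral integral_pushforward.
- by rewrite /= /Rintegral integral_pushforward.
Qed.

(** The product is [zpow (k + l)] on the unit circle only, not on the plane, so the identity is used
    after composition with [cis]. *)
Lemma circle_zpowM (R : realType) (k l : int) :
  [/\ cmeasurable (fun z : R[i] => zpow k z * zpow l z),
    complex_integrable (circle_prob R) (fun z => zpow k z * zpow l z) &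
    cexp (circle_prob R) (fun z => zpow k z * zpow l z) = (k + l == 0)%:R].
Proof.
have mz j : cmeasurable (zpow (R := R) j).
  exact: cmeasurable_zpow ((cmeasurableP (@idfun R[i])).2 (@measurable_id _ _ _)).
have mkl : cmeasurable (fun z : R[i] => zpow k z * zpow l z) by exact: cmeasurableM.
have E : (fun z => zpow k z * zpow l z) \o @cis R = zpow (k + l) \o @cis R.
  apply/funext => t /=; rewrite !zpow_cis intrD mulrDl.
  by apply: complexP; rewrite ?ReM ?ImM /= ?cosD ?sinD// addrC.
have ik : complex_integrable (uniform_prob (two_pi_gt0 R)) (zpow (k + l) \o @cis R).
  have mc : cmeasurable (zpow (R := R) (k + l) \o @cis R).
    by apply: cmeasurable_zpow; apply/cmeasurableP; exact: measurable_cis.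
  apply/complex_integrableP => //.
  rewrite (_ : (fun _ => _) = EFin \o cst 1); first exact: finite_measure_integrable_cst.
  by apply/funext => t /=; rewrite normc_zpow normc_cis expr1n.
have [|i e] := cexp_distribution (mu := uniform_prob (two_pi_gt0 R)) (h := @cis R) mkl; first by rewrite E.
have [i' e'] := cexp_distribution (mu := uniform_prob (two_pi_gt0 R)) (h := @cis R) (mz (k + l)) ik.
split=> //; rewrite [LHS]e E -e'; exact: (circle_zpow _ _).2.
Qed.

Section torus_fourier.
Context (R : realType).

Lemma cmeasurable_tnth N (i : 'I_N) d (T : measurableType d) (X : T -> N.-tuple R[i]) :
  measurable_fun setT X -> cmeasurable (fun t => tnth (X t) i).
Proof.
move=> mX; apply/cmeasurableP.
exact: (measurableT_comp (@measurable_tnth _ R[i] N i) mX).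
Qed.

Lemma torus_prod N (phi : 'I_N -> R[i] -> R[i]) :
  (forall i, cmeasurable (phi i)) ->
  (forall i, complex_integrable (circle_prob R) (phi i)) ->
  complex_integrable (torus_prob R N) (fun z => \prod_i phi i (tnth z i)) /\
  cexp (torus_prob R N) (fun z => \prod_i phi i (tnth z i)) =
    \prod_i cexp (circle_prob R) (phi i).
Proof.
elim: N phi => [|N ih] phi mphi iphi.
  rewrite (_ : (fun _ => _) = fun=> 1); last by apply/funext => z; rewrite big_ord0.
  split; first exact: complex_integrable_cst.
  by rewrite big_ord0 cexp_cst.
have [i e] := ih _ (fun i => mphi (lift ord0 i)) (fun i => iphi (lift ord0 i)).
have [i' e'] := cexp_prodM (iphi ord0) i.
have mF : cmeasurable (fun z : N.+1.-tuple R[i] => \prod_i phi i (tnth z i)).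
  apply: cmeasurable_prod => j; apply/cmeasurableP.
  have /cmeasurableP h := mphi j; apply: (measurableT_comp h).
  exact: measurable_tnth.
have E : (fun z : N.+1.-tuple R[i] => \prod_i phi i (tnth z i)) \o @tuple_cons R N =
    fun z => phi ord0 z.1 * \prod_i phi (lift ord0 i) (tnth z.2 i).
  apply/funext => -[x y] /=; rewrite big_ord_recl; congr (phi _ _ * _).
  by apply: eq_bigr => j _; rewrite tnthS.
have [|i2 e2] := @cexp_distribution _ _ _ _ _ (circle_prob R \x torus_prob R N)%E (@tuple_cons R N) _ mF.
  by rewrite E.
split; first exact: i2.
by rewrite [LHS]e2 E [LHS]e' e big_ord_recl.
Qed.

End torus_fourier.

Section trig_poly_theory.
Context (R : realType) (N : nat).
Local Notation index := {ffun 'I_N -> int}.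
Implicit Types (k : index) (a : coefs R N) (z : N.-tuple R[i]) (s : seq index).

Definition mono k z : R[i] := \prod_(n < N) zpow (k n) (tnth z n).

Lemma trig_evalE a s z : uniq s -> (forall k, a k != 0 -> k \in s) ->
  trig_eval a z = \sum_(k <- s) a k * mono k z.
Proof.
move=> us sup; rewrite [RHS]fsbig_seq//.
transitivity (\sum_(k \in [set k | a k != 0]) a k * mono k z).
  apply: eq_fsbigr => k _; congr (_ * _).
  by apply: eq_bigr => n _; exact: zpowE.
apply: fsbig_widen; first by move=> k; exact: sup.
by move=> k [_ /= /negP/negPn/eqP ->]; rewrite mul0r.
Qed.

Definition support_seq a : seq index :=
  finmap.enum_fset (fset_set [set k | a k != 0]).

Lemma support_seqP a : is_trig_poly a ->
  uniq (support_seq a) /\ forall k, (k \in support_seq a) = (a k != 0).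
Proof.
move=> fa; split; first exact: finmap.fset_uniq.
move=> k; transitivity (k \in [set k | a k != 0]); first exact: (in_fset_set fa k).
by apply/idP/idP; rewrite inE.
Qed.

Lemma trig_eval_support a z : is_trig_poly a ->
  trig_eval a z = \sum_(k <- support_seq a) a k * mono k z.
Proof.
by move=> /support_seqP[us sup]; apply: trig_evalE => // k; rewrite sup.
Qed.

Lemma monoN k z : mono (- k) z = conjc (mono k z).
Proof.
rewrite /mono (big_morph _ (@conjcM R) (conjc1 R)).
by apply: eq_bigr => n _; rewrite ffunE zpowN.
Qed.

Lemma torus_monoM k l :
  complex_integrable (torus_prob R N) (fun z => mono k z * mono l z) /\
  cexp (torus_prob R N) (fun z => mono k z * mono l z) = (k + l == 0)%:R.
Proof.
have -> : (fun z => mono k z * mono l z) =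
    fun z => \prod_(n < N) (zpow (k n) (tnth z n) * zpow (l n) (tnth z n)).
  by apply/funext => z; rewrite -big_split.
have [||i e] := @torus_prod R N (fun n (x : R[i]) => zpow (k n) x * zpow (l n) x).
- by move=> n; exact: (let: And3 h _ _ := circle_zpowM R (k n) (l n) in h).
- by move=> n; exact: (let: And3 _ h _ := circle_zpowM R (k n) (l n) in h).
split; [exact: i|rewrite [LHS]e].
rewrite (eq_bigr (fun i => (k i + l i == 0)%:R)); last first.
  by move=> j _; exact: (let: And3 _ _ h := circle_zpowM R (k j) (l j) in h).
have [kl0|kl0] := eqVneq (k + l) 0.
  by rewrite big1// => j _; move/ffunP: kl0 => /(_ j); rewrite !ffunE => ->.
have [j kj] : exists j, k j + l j != 0.
  apply/existsP; apply: contra_neqT kl0; rewrite negb_exists => /forallP h.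
  by apply/ffunP => j; rewrite !ffunE; have := h j; rewrite negbK => /eqP.
by rewrite (bigD1 j)//= (negbTE kj) mul0r.
Qed.

Lemma cmeasurable_mono k d (T : measurableType d) (X : T -> N.-tuple R[i]) :
  measurable_fun setT X -> cmeasurable (fun t => mono k (X t)).
Proof.
move=> mX; apply: cmeasurable_prod => n; apply: cmeasurable_zpow.
exact: cmeasurable_tnth.
Qed.

Lemma mono0 z : mono 0 z = 1.
Proof. by rewrite /mono big1// => n _; rewrite ffunE zpow0. Qed.

Lemma torus_mono k : complex_integrable (torus_prob R N) (mono k) /\
  cexp (torus_prob R N) (mono k) = (k == 0)%:R.
Proof.
have := torus_monoM k 0; rewrite addr0.
by under eq_fun do rewrite mono0 mulr1.
Qed.

(** Orthogonality of the characters. Coefficients are thus determined by the values almost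
    everywhere on the torus, which turns almost everywhere identities into identities of
    coefficients. *)
Lemma trig_coef a k : is_trig_poly a ->
  complex_integrable (torus_prob R N) (fun z => trig_eval a z * mono (- k) z) /\
  cexp (torus_prob R N) (fun z => trig_eval a z * mono (- k) z) = a k.
Proof.
move=> ta; have [us sup] := support_seqP ta.
have -> : (fun z => trig_eval a z * mono (- k) z) =
    fun z => \sum_(l <- support_seq a) a l * (mono l z * mono (- k) z).
  apply/funext => z; rewrite trig_eval_support// mulr_suml.
  by apply: eq_bigr => l _; rewrite mulrA.
have il l : complex_integrable (torus_prob R N) (fun z => a l * (mono l z * mono (- k) z)).
  by apply: complex_integrableZ; exact: (torus_monoM _ _).1.
split; first exact: complex_integrable_sum.
rewrite cexp_sum//.
rewrite (eq_bigr (fun l => a l * (l == k)%:R)); last first.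
  move=> l _; rewrite cexpZ; last exact: (torus_monoM _ _).1.
  by rewrite (torus_monoM _ _).2 subr_eq0.
have [ks|ks] := boolP (k \in support_seq a).
  rewrite (bigD1_seq k)//= eqxx mulr1 big1 ?addr0// => l /negbTE ->.
  by rewrite mulr0.
rewrite big_seq big1 => [|l ls].
  by apply/eqP; rewrite eq_sym; apply: contraNT ks; rewrite sup.
by case: eqP => [lk|_]; [rewrite -lk ls in ks|rewrite mulr0].
Qed.

Lemma integrable_trig_eval a : is_trig_poly a ->
  complex_integrable (torus_prob R N) (trig_eval a).
Proof.
move=> ta; have := (trig_coef 0 ta).1; rewrite oppr0.
by under eq_fun do rewrite mono0 mulr1.
Qed.

Lemma trig_coef0 a : is_trig_poly a -> torus_mean a = a 0.
Proof.
move=> ta; have := (trig_coef 0 ta).2; rewrite oppr0.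
by under eq_fun do rewrite mono0 mulr1.
Qed.

End trig_poly_theory.

(** * Conditional expectations of trigonometric polynomials *)

Section zero_integrals.
Context d (T : measurableType d) (R : realType) (mu : probability T R).

Lemma integral_generated_eq0 (G : set (set T)) (f : T -> \bar R) :
  setI_closed G -> G `<=` measurable -> mu.-integrable setT f ->
  (\int[mu]_x f x = 0)%E -> (forall A, G A -> \int[mu]_(x in A) f x = 0)%E ->
  forall A, <<s G >> A -> (\int[mu]_(x in A) f x = 0)%E.
Proof.
move=> GI mG fi f0 G0.
have mS : <<s G >> `<=` measurable.
  by apply: smallest_sub => //; exact: sigma_algebra_measurable.
apply: (@dynkin_induction _ (g_sigma_algebraType G) G
    (fun A => \int[mu]_(x in A) f x = 0)%E) => //.
- move=> A /mS mA A0; have := f0.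
  rewrite -(setvU A) integral_setU//=; last 3 first.
  - exact: measurableC.
  - by rewrite setvU; exact: measurable_int fi.
  - by rewrite disj_set2E setICl.
  by rewrite A0 adde0.
- move=> F /(_ _)/mS mF tF F0.
  rewrite integral_bigcup//; last first.
    by apply: (integrableS measurableT) => //; exact: bigcup_measurable.
  by rewrite eseries0// => k _ _; exact: F0.
Qed.

(** The function |f| is f on the set where f > 0 and -f on the complement, so its integral
    vanishes. *)
Lemma Rintegral_pos_neg_eq0 (f : T -> R) :
  mu.-integrable setT (EFin \o f) ->
  \int[mu]_(x in [set x | 0 < f x]) f x = 0 ->
  \int[mu]_(x in ~` [set x | 0 < f x]) f x = 0 ->
  ae_eq mu setT (EFin \o f) (cst 0%E).
Proof.
move=> fi f1 f2; have mf := measurable_int _ fi.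
have mf' : measurable_fun setT f by exact/measurable_EFinP.
have mA : measurable [set x | 0 < f x].
  rewrite (_ : [set x | _] = setT `&` f @^-1` `]0, +oo[%classic).
    exact: mf'.
  by rewrite setTI; apply/seteqP; split=> x /=; rewrite in_itv/= andbT.
apply/(ae_eq_integral_abs mu measurableT mf).
rewrite -(setUv [set x | 0 < f x]) ge0_integral_setU//; last 3 first.
- exact: measurableC.
- by apply: measurableT_comp => //; rewrite setUv.
- by rewrite disj_set2E setICr.
have i1 := integrableS measurableT mA (@subsetT _ _) fi.
have i2 := integrableS measurableT (measurableC mA) (@subsetT _ _) fi.
have -> : (\int[mu]_(x in [set x | (0 < f x)%R]) `|(EFin \o f) x| = 0)%E.
  rewrite (eq_integral (EFin \o f)) => [|x]; last first.
    by rewrite inE /= => x0; rewrite gtr0_norm.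
  by rewrite -[LHS]fineK ?(integrable_fin_num mA)//; congr EFin.
rewrite add0e.
rewrite (eq_integral (fun x => (-1)%:E * (f x)%:E)%E) => [|x]; last first.
  by rewrite inE /= => /negP; rewrite -leNgt => x0; rewrite ler0_norm// -EFinM mulN1r.
rewrite integralZl//; last exact: measurableC.
by rewrite -[X in (_ * X)%E]fineK ?(integrable_fin_num (measurableC mA))// [fine _]f2 mule0.
Qed.

Lemma cexp_ae_eq0 (X Y : T -> R[i]) :
  ae_eq mu setT (fun x => (complex.Re (X x))%:E) (cst 0%E) ->
  ae_eq mu setT (fun x => (complex.Im (X x))%:E) (cst 0%E) ->
  cmeasurable X -> cmeasurable Y -> cexp mu (fun x => X x * Y x) = 0.
Proof.
move=> r0 i0 mX mY; have [mr mi] := cmeasurableM mX mY.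
rewrite /cexp /complex_integral; apply: complexP.
- rewrite /= /Rintegral (ae_eq_integral (cst 0%E))//; last 2 first.
  + exact/measurable_EFinP.
  + apply: (filterS2 _ _ r0 i0) => x /= + + xT => /(_ xT) [re0] /(_ xT) [im0].
    by rewrite ReM re0 im0 !mul0r subr0.
  by rewrite integral0.
- rewrite /= /Rintegral (ae_eq_integral (cst 0%E))//; last 2 first.
  + exact/measurable_EFinP.
  + apply: (filterS2 _ _ r0 i0) => x /= + + xT => /(_ xT) [re0] /(_ xT) [im0].
    by rewrite ImM re0 im0 !mul0r addr0.
  by rewrite integral0.
Qed.

End zero_integrals.

Section conditional_expectation.
Context (R : realType) (N : nat).
Local Notation index := {ffun 'I_N -> int}.
Implicit Types (k : index) (a b : coefs R N) (z : N.-tuple R[i]).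
Local Notation T := (torus_prob R N).

Let measurable_id_tuple : measurable_fun setT (@idfun (N.-tuple R[i])).
Proof. exact: measurable_id. Qed.

Lemma cmeasurable_trig_eval a : is_trig_poly a ->
  forall d (S : measurableType d) (X : S -> N.-tuple R[i]),
  measurable_fun setT X -> cmeasurable (fun t => trig_eval a (X t)).
Proof.
move=> ta d S X mX; under eq_fun do rewrite trig_eval_support//.
apply: cmeasurable_sum => k; apply: cmeasurableM; first exact: cmeasurable_cst.
exact: cmeasurable_mono.
Qed.

Lemma trig_poly_sub a b : (forall k, b k != 0 -> a k != 0) ->
  is_trig_poly a -> is_trig_poly b.
Proof. by move=> ab; apply: sub_finite_set => k; exact: ab. Qed.

(** The frequencies whose character depends on the first n variables only; [trunc n] keeps exactly
    these and will turn out to be the conditional expectation. *)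
Definition supported n k := [forall i : 'I_N, (n <= i)%N ==> (k i == 0)].

Definition trunc n a : coefs R N := fun k => if supported n k then a k else 0.

Lemma is_trig_poly_trunc n a : is_trig_poly a -> is_trig_poly (trunc n a).
Proof.
by apply: trig_poly_sub => k; rewrite /trunc; case: ifP => //; rewrite eqxx.
Qed.

Definition cylinder_gen n : set (set (N.-tuple R[i])) :=
  [set A | exists i : 'I_N, (i < n)%N /\
        exists2 B : set R[i], measurable B &
          A = [set z : N.-tuple R[i] | B (tnth z i)]].

Lemma cmeasurable_trunc n a : is_trig_poly a ->
  @cmeasurable _ (g_sigma_algebraType (cylinder_gen n)) R (trig_eval (trunc n a)).
Proof.
move=> ta; have [us sup] := support_seqP ta.
rewrite (_ : trig_eval (trunc n a) = fun z => \sum_(k <- support_seq a)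
    (if supported n k then a k * mono k z else 0)); last first.
  apply/funext => z; rewrite (@trig_evalE _ _ _ (support_seq a))//.
    by apply: eq_bigr => k _; rewrite /trunc; case: ifP; rewrite ?mul0r.
  by move=> k; rewrite /trunc sup; case: ifP => //; rewrite eqxx.
apply: cmeasurable_sum => k; case: (boolP (supported n k)) => [/forallP sk|_]; last exact: cmeasurable_cst.
apply: cmeasurableM; first exact: cmeasurable_cst.
apply: cmeasurable_prod => i.
have [ni|ni] := leqP n i.
  have /eqP -> := implyP (sk i) ni.
  by under eq_fun do rewrite zpow0; exact: cmeasurable_cst.
apply: cmeasurable_zpow; apply/cmeasurableP => _ B mB; rewrite setTI.
apply: sub_gen_smallest; exists i; split=> //; by exists B.
Qed.

Let cmeasurable_indicC d (S : measurableType d) (A : set S) :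
  measurable A -> cmeasurable (fun x => (\1_A x)%:C : R[i]).
Proof.
move=> mA; split=> /=; last exact: measurable_cst.
exact: measurable_indic.
Qed.

Lemma complex_integral_indic d (S : measurableType d) (mu : probability S R)
    (A : set S) (X : S -> R[i]) : measurable A ->
  complex_integral mu A X = cexp mu (fun x => (\1_A x)%:C * X x).
Proof.
move=> mA; rewrite /cexp /complex_integral; apply: complexP => /=.
- rewrite Rintegral_mkcond; apply: eq_Rintegral => x _.
  by rewrite ReM/= mul0r subr0 patchE indicE; case: ifP; rewrite ?mul1r ?mul0r.
- rewrite Rintegral_mkcond; apply: eq_Rintegral => x _.
  by rewrite ImM/= mul0r addr0 patchE indicE; case: ifP; rewrite ?mul1r ?mul0r.
Qed.

Lemma complex_integrable_indic d (S : measurableType d) (mu : probability S R)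
    (A : set S) (X : S -> R[i]) : measurable A -> cmeasurable X ->
  complex_integrable mu X -> complex_integrable mu (fun x => (\1_A x)%:C * X x).
Proof.
move=> mA mX iX; have mAX := cmeasurableM (cmeasurable_indicC mA) mX.
apply/complex_integrableP => //.
apply: le_integrable ((complex_integrableP mu mX).1 iX) => //.
  by apply/measurable_EFinP; exact: measurable_normc.
move=> x _; rewrite lee_fin !(ger0_norm (normc_ge0 _)) ncM normc_real.
by rewrite indicE; case: (_ \in _); rewrite ?normr1 ?normr0 ?mul1r// mul0r normc_ge0.
Qed.

Let rectangle n (C : 'I_N -> set R[i]) : set (N.-tuple R[i]) :=
  [set z | forall i : 'I_N, (i < n)%N -> C i (tnth z i)].

Let measurable_rectangle n C : (forall i, measurable (C i)) -> measurable (rectangle n C).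
Proof.
move=> mC; rewrite (_ : rectangle n C =
    \bigcap_(i in [set i : 'I_N | (i < n)%N]) (fun z => tnth z i) @^-1` C i).
  apply: fin_bigcap_measurable => // i _; rewrite -[_ @^-1` _]setTI.
  exact: (measurable_tnth i).
by apply/seteqP; split.
Qed.

(** On a rectangle that constrains only the first n coordinates the integral is a product over
    coordinates, and a coordinate j >= n with k_j <> 0 contributes the factor 0. The general case
    follows by the pi-lambda argument. *)
Lemma torus_mono_eq0 n k A : ~~ supported n k -> coord_sigma n A ->
  complex_integral T A (mono k) = 0.
Proof.
move=> /forallPn[j]; rewrite negb_imply => /andP[nj kj] sA.
pose G := [set A | exists2 C : 'I_N -> set R[i],
  (forall i, measurable (C i)) & A = rectangle n C].
have GI : setI_closed G.
  move=> _ _ [C mC ->] [C' mC' ->]; exists (fun i => C i `&` C' i).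
    by move=> i; exact: measurableI.
  apply/seteqP; split=> [z [h h'] i iq|z h]; first by split; [exact: h|exact: h'].
  by split=> i iq; have [] := h i iq.
have mG : G `<=` measurable by move=> _ [C mC ->]; exact: measurable_rectangle.
have mz i : cmeasurable (zpow (R := R) (k i)).
  exact: cmeasurable_zpow ((cmeasurableP (@idfun R[i])).2 (@measurable_id _ _ _)).
have mm : cmeasurable (mono k) := cmeasurable_mono k measurable_id_tuple.
have G0 A' : G A' -> complex_integral T A' (mono k) = 0.
  move=> [C mC ->]; rewrite complex_integral_indic; last exact: measurable_rectangle.
  pose C' (i : 'I_N) := if (i < n)%N then C i else setT.
  have mC' i : measurable (C' i) by rewrite /C'; case: ifP.
  have -> : (fun z => (\1_(rectangle n C) z)%:C * mono k z) =
      fun z => \prod_i ((\1_(C' i) (tnth z i))%:C * zpow (k i) (tnth z i)).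
    apply/funext => z; rewrite big_split; congr (_ * _).
    rewrite indicE; have [h|h] := boolP (z \in rectangle n C).
      rewrite big1// => i _; rewrite indicE mem_set// /C'.
      by case: ifP => // iq; have := set_mem h; exact.
    suff [i hi] : exists i, tnth z i \notin C' i.
      by rewrite (bigD1 i)//= indicE (negbTE hi) mul0r.
    apply: contrapT => /forallNP h'; move/negP: h; apply; apply/mem_set => i iq.
    have /negP := h' i; rewrite negbK => /set_mem; by rewrite /C' iq.
  have iC i := complex_integrable_indic (mC' i) (mz i) (circle_zpow R (k i)).1.
  have [|_ e] := @torus_prod R N (fun i x => (\1_(C' i) x)%:C * zpow (k i) x) _ iC.
    by move=> i; exact: cmeasurableM (cmeasurable_indicC (mC' i)) (mz i).
  rewrite [LHS]e (bigD1 j)//= (_ : (fun _ => _) = zpow (k j)); last first.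
    apply/funext => x; rewrite /C' ltnNge nj/= indicE mem_set// mul1r//.
  by rewrite (circle_zpow _ _).2 (negbTE kj) mul0r.
have k0 : k == 0 = false.
  by apply/eqP => k0; rewrite k0 ffunE eqxx in kj.
have [[ir ii] e0] := torus_mono R k; rewrite k0 in e0.
have fin0 (x : \bar R) : x \is a fin_num -> fine x = 0 -> x = 0%E.
  by move=> xf x0; rewrite -(fineK xf) x0.
have GsA : <<s G >> A.
  move: A sA; apply: smallest_sub; first exact: smallest_sigma_algebra.
  move=> _ [i [iq [B mB ->]]]; apply: sub_gen_smallest.
  exists (fun j => if j == i then B else setT); first by move=> ?; case: ifP.
  apply/seteqP; split=> [z Bz l ln|z /(_ i iq)]; last by rewrite eqxx.
  by case: eqP => [->|].
have mA : measurable A.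
  by apply: (smallest_sub _ mG) GsA; exact: sigma_algebra_measurable.
apply: complexP; rewrite /complex_integral/= /Rintegral.
- rewrite (integral_generated_eq0 GI mG ir)//.
    by apply: fin0; [exact: integrable_fin_num|have [] := e0].
  move=> A' GA'; apply: fin0; last by have [] := G0 _ GA'.
  apply: integrable_fin_num; first exact: mG.
  by apply: integrableS ir => //; exact: mG.
- rewrite (integral_generated_eq0 GI mG ii)//.
    by apply: fin0; [exact: integrable_fin_num|have [] := e0].
  move=> A' GA'; apply: fin0; last by have [] := G0 _ GA'.
  apply: integrable_fin_num; first exact: mG.
  by apply: integrableS ii => //; exact: mG.
Qed.

Lemma coord_sigma_measurable n : @coord_sigma R N n `<=` measurable.
Proof.
apply: smallest_sub; first exact: sigma_algebra_measurable.
move=> _ [i [_ [B mB ->]]].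
by have := measurable_tnth (T := R[i]) i measurableT mB; rewrite setTI.
Qed.

Lemma complex_integral_trig_eval a (s : seq index) A : measurable A -> uniq s ->
  (forall k, a k != 0 -> k \in s) ->
  complex_integral T A (trig_eval a) = \sum_(k <- s) a k * complex_integral T A (mono k).
Proof.
move=> mA us sup; rewrite complex_integral_indic//.
have iA k := complex_integrable_indic mA (cmeasurable_mono k measurable_id_tuple) (torus_mono R k).1.
rewrite (_ : (fun _ => _) = fun z => \sum_(k <- s) a k * ((\1_A z)%:C * mono k z)); last first.
  apply/funext => z; rewrite (trig_evalE _ us sup) mulr_sumr.
  by apply: eq_bigr => k _; rewrite mulrCA.
rewrite cexp_sum => [|k]; last exact: complex_integrableZ.
by apply: eq_bigr => k _; rewrite cexpZ// complex_integral_indic.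
Qed.

Lemma trunc_cond_exp n a : is_trig_poly a ->
  is_cond_exp T (@coord_sigma R N n) (trig_eval a) (trig_eval (trunc n a)).
Proof.
move=> ta; have [us sup] := support_seqP ta; split.
- exact/integrable_trig_eval/is_trig_poly_trunc.
- move=> B mB; have /cmeasurableP h := cmeasurable_trunc n ta.
  by have := h measurableT B mB; rewrite setTI.
move=> A sA; have mA := coord_sigma_measurable sA.
rewrite (@complex_integral_trig_eval _ (support_seq a))//; last first.
  by move=> k; rewrite /trunc sup; case: ifP => //; rewrite eqxx.
rewrite (@complex_integral_trig_eval _ (support_seq a))//; last by move=> k; rewrite sup.
apply: eq_bigr => k _; rewrite /trunc; case: ifPn => // nk.
by rewrite (torus_mono_eq0 nk sA) !mulr0.
Qed.

(** The difference of two versions is measurable for the sigma-algebra of the first n coordinates,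
    so the set where its real or imaginary part is positive is a legitimate test set. The difference
    vanishes almost everywhere, hence so do its Fourier coefficients. *)
Let cond_exp_ae n a b : is_trig_poly a -> is_trig_poly b ->
  is_cond_exp T (@coord_sigma R N n) (trig_eval a) (trig_eval b) -> b = trunc n a.
Proof.
move=> ta tb [ib mb eb]; have [it mt et] := trunc_cond_exp n ta.
have tt := is_trig_poly_trunc n ta.
have mX : cmeasurable (fun z => trig_eval b z - trig_eval (trunc n a) z).
  by apply: cmeasurableD; [|apply: cmeasurableN]; exact: cmeasurable_trig_eval measurable_id_tuple.
have iX : complex_integrable T (fun z => trig_eval b z - trig_eval (trunc n a) z).
  under eq_fun do rewrite -mulN1r.
  by apply: complex_integrableD => //; exact: complex_integrableZ.
have mcX : @cmeasurable _ (g_sigma_algebraType (cylinder_gen n)) R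
    (fun z => trig_eval b z - trig_eval (trunc n a) z).
  apply: cmeasurableD; last by apply: cmeasurableN; exact: cmeasurable_trunc.
  by apply/cmeasurableP => _ B mB; rewrite setTI; exact: mb.
have zero A : coord_sigma n A -> complex_integral T A
    (fun z => trig_eval b z - trig_eval (trunc n a) z) = 0.
  move=> sA; have mA := coord_sigma_measurable sA.
  have mb' := cmeasurable_trig_eval tb measurable_id_tuple.
  have mt' := cmeasurable_trig_eval tt measurable_id_tuple.
  have i1 := complex_integrable_indic mA mb' ib.
  have i2 := complex_integrable_indic mA mt' it.
  rewrite complex_integral_indic//.
  rewrite (_ : (fun _ => _) = fun z => (\1_A z)%:C * trig_eval b z +
      (-1) * ((\1_A z)%:C * trig_eval (trunc n a) z)); last first.
    by apply/funext => z; ring.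
  rewrite cexpD//; last exact: complex_integrableZ.
  rewrite cexpZ// -(complex_integral_indic _ _ mA) -(complex_integral_indic _ _ mA).
  by rewrite eb// et// mulN1r subrr.
have ae (x : N.-tuple R[i] -> R) :
    @measurable_fun _ _ (g_sigma_algebraType (cylinder_gen n)) R setT x ->
    T.-integrable setT (EFin \o x) ->
    (forall A, coord_sigma n A -> \int[T]_(z in A) x z = 0) ->
    ae_eq T setT (EFin \o x) (cst 0%E).
  move=> mx ix x0.
  have sA : @coord_sigma R N n [set z | 0 < x z].
    rewrite (_ : [set z | _] = setT `&` x @^-1` `]0, +oo[%classic); first exact: mx.
    by rewrite setTI; apply/seteqP; split=> z /=; rewrite in_itv/= andbT.
  apply: Rintegral_pos_neg_eq0 => //; apply: x0 => //.
  exact: (@measurableC _ (g_sigma_algebraType (cylinder_gen n)) _ sA).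
have aeR := ae _ mcX.1 iX.1 (fun A sA => congr1 (@complex.Re R) (zero A sA)).
have aeI := ae _ mcX.2 iX.2 (fun A sA => congr1 (@complex.Im R) (zero A sA)).
apply/funext => k; apply/eqP; rewrite -subr_eq0; apply/eqP.
have mk := cmeasurable_mono (- k) measurable_id_tuple.
rewrite -(cexp_ae_eq0 aeR aeI mX mk).
have [i1 e1] := trig_coef k tb; have [i2 e2] := trig_coef k tt.
rewrite (_ : (fun _ => _) = fun z => trig_eval b z * mono (- k) z +
    (-1) * (trig_eval (trunc n a) z * mono (- k) z)); last first.
  by apply/funext => z; ring.
rewrite cexpD//; last exact: complex_integrableZ.
by rewrite cexpZ// e1 e2 mulN1r.
Qed.

(** The set from which [xget] chooses consists of [trunc n a] alone: uniqueness handles the chosen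
    element, existence rules out the default value. *)
Lemma trig_cond_expE n a : is_trig_poly a -> trig_cond_exp n a = trunc n a.
Proof.
move=> ta; rewrite /trig_cond_exp; case: xgetP => [b _ [tb cb]|].
  exact: cond_exp_ae.
move=> /(_ (trunc n a)) h; exfalso; apply: h; split; first exact: is_trig_poly_trunc.
exact: trunc_cond_exp.
Qed.

End conditional_expectation.

(** * The coefficients of f + iH(f) *)

Section analytic_completion.
Context (R : realType) (N : nat).
Local Notation index := {ffun 'I_N -> int}.
Implicit Types (k : index) (a b : coefs R N) (z : N.-tuple R[i]).
Local Notation T := (torus_prob R N).

Lemma measurable_on_torus M : measurable (@on_torus R M).
Proof.
rewrite (_ : @on_torus R M = \bigcap_(i in setT)
    ((fun z : M.-tuple R[i] => normc (tnth z i)) @^-1` [set 1])).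
  apply: fin_bigcap_measurable => // i _; rewrite -[_ @^-1` _]setTI.
  have mt := cmeasurable_tnth i (@measurable_id _ (M.-tuple R[i]) setT).
  by apply: (measurable_normc mt).
by apply/seteqP; split=> [z h i _|z h i]; exact: h.
Qed.

Lemma torus_prob_on_torus M : torus_prob R M (@on_torus R M) = 1%E.
Proof.
elim: M => [|M ih] /=.
  by rewrite diracE mem_set// => -[].
have mc : measurable [set x : R[i] | normc x = 1].
  rewrite -[X in measurable X]setTI.
  have mt := (cmeasurableP (@idfun R[i])).2 (@measurable_id _ _ setT).
  have h := measurable_normc mt; exact: (h measurableT [set 1] (measurable_set1 1)).
transitivity ((circle_prob R \x torus_prob R M)%E
    ([set x : R[i] | normc x = 1] `*` @on_torus R M)); last first.
  rewrite product_measure1E//; last exact: measurable_on_torus.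
  transitivity (circle_prob R [set x : R[i] | normc x = 1%R] * 1)%E.
    by congr (_ * _)%E; exact: ih.
  rewrite mule1; transitivity (uniform_prob (two_pi_gt0 R) setT); last exact: probability_setT.
  by congr (uniform_prob _ _); apply/seteqP; split=> // t _; exact: normc_cis.
congr (product_measure1 _ _ _).
apply/seteqP; split=> [[x y] /= h|[x y] /= [nx h]].
  split; first by have := h ord0.
  by move=> i; have := h (lift ord0 i); rewrite tnthS.
move=> i; case: (unliftP ord0 i) => [j|] ->; last by rewrite (tnth_nth 0).
by rewrite tnthS; exact: h.
Qed.

(** [torus_prob] is a measure on the whole of C^N, whereas [real_on_torus] speaks of points of the
    torus only. *)
Lemma ae_on_torus : {ae T, forall z, on_torus z}.
Proof.
exists (~` @on_torus R N); split; last by [].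
- exact: measurableC (@measurable_on_torus N).
- rewrite probability_setC; last exact: measurable_on_torus.
  have -> : T (@on_torus R N) = 1%E := @torus_prob_on_torus N.
  by rewrite subee.
Qed.

Definition coef_conj a : coefs R N := fun k => conjc (a (- k)).

Lemma conjc_eq0b (x : R[i]) : (conjc x == 0) = (x == 0).
Proof.
apply/eqP/eqP => [h|->]; last exact: conjc0.
by rewrite -(conjcK x) h conjc0.
Qed.

Lemma coef_conj_eval a z : is_trig_poly a ->
  is_trig_poly (coef_conj a) /\ trig_eval (coef_conj a) z = conjc (trig_eval a z).
Proof.
move=> ta; have [us sup] := support_seqP ta; split.
  apply: (@sub_finite_set _ _ (-%R @` [set k | a k != 0])); last exact: finite_image.
  move=> k; rewrite /= /coef_conj conjc_eq0b => ak.
  by exists (- k); rewrite ?opprK.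
rewrite [trig_eval a z]trig_eval_support// (big_morph _ (@conjcD R) (conjc0 R)).
rewrite (@trig_evalE _ _ _ (map -%R (support_seq a))).
- rewrite big_map; apply: eq_bigr => k _.
  by rewrite conjcM /coef_conj opprK monoN.
- by rewrite map_inj_uniq//; exact: oppr_inj.
- move=> k; rewrite /coef_conj conjc_eq0b -sup => h.
  by apply/mapP; exists (- k); rewrite ?opprK.
Qed.

(** Hermitian symmetry of the coefficients: the polynomial and its conjugate agree almost everywhere
    on the torus. *)
Lemma coef_conj_real a : is_trig_poly a -> real_on_torus a -> coef_conj a = a.
Proof.
move=> ta ra; have tb : is_trig_poly (coef_conj a) := (coef_conj_eval [tuple 0 | _ < N] ta).1.
have mid : measurable_fun setT (@idfun (N.-tuple R[i])) by exact: measurable_id.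
have mX : cmeasurable (fun z => trig_eval (coef_conj a) z - trig_eval a z).
  by apply: cmeasurableD; [|apply: cmeasurableN]; exact: cmeasurable_trig_eval mid.
have X0 z : on_torus z -> trig_eval (coef_conj a) z - trig_eval a z = 0.
  move=> oz; have a0 := ra _ oz; rewrite (coef_conj_eval _ ta).2.
  by apply: complexP; rewrite ?ReD ?ImD ?ReN ?ImN ?ReJ ?ImJ ?a0 /= ?subrr ?oppr0 ?addr0.
apply/funext => k; apply/eqP; rewrite -subr_eq0; apply/eqP.
have mk := cmeasurable_mono (R := R) (- k) mid.
have [i1 e1] := trig_coef k tb; have [i2 e2] := trig_coef k ta.
rewrite -mulN1r -e1 -e2 -cexpZ// -cexpD//; last exact: complex_integrableZ.
rewrite (_ : (fun _ => _) = fun z =>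
    (trig_eval (coef_conj a) z - trig_eval a z) * mono (- k) z); last first.
  by apply/funext => z; ring.
apply: cexp_ae_eq0 => //.
- by apply: filterS ae_on_torus => z oz _ /=; rewrite X0.
- by apply: filterS ae_on_torus => z oz _ /=; rewrite X0.
Qed.

(* Only the d_j with j the last index such that k_j <> 0 sees the frequency k. *)
Definition last_sign k : int :=
  \sum_(j < N) (supported j.+1 k && ~~ supported j k)%:R * sgz (k j).

(** The difference of two consecutive truncations keeps the frequencies whose last nonzero index is
    j. There the conjugate function multiplies by -i sgn(k_j), and the factor i in front makes this
    sgn(k_j). *)
Lemma analytic_completionE a k : is_trig_poly a ->
  analytic_completion a k = a k * (1 + (last_sign k)%:~R).
Proof.
move=> ta; rewrite /analytic_completion /conj_op fct_sumE mulr_sumr mulrDr mulr1.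
congr (_ + _); rewrite /last_sign rmorph_sum mulr_sumr; apply: eq_bigr => j _.
rewrite /conj_fun /trig_diff !trig_cond_expE// rmorphM/=.
have -> : ((trunc j.+1 a - trunc j a) : coefs R N) k = trunc j.+1 a k - trunc j a k by [].
have ii : 'i%C * 'i%C = -1 :> R[i] by apply: complexP; rewrite ?ReM ?ImM ?ReN ?ImN /=; ring.
have h : supported j k -> supported j.+1 k.
  move=> /forallP sj; apply/forallP => i; apply/implyP => ji.
  exact: (implyP (sj i)) (ltnW ji).
rewrite /trunc !mulrA mulrN ii opprK mul1r.
rewrite rmorph_nat.
case: (boolP (supported j k)) => [sj|_]; first by rewrite h//=; ring.
by rewrite /= andbT subr0; case: ifP => _ /=; rewrite ?(mulr0, mul0r, mulr1)// mulrC.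
Qed.

Lemma supportedN n k : supported n (- k) = supported n k.
Proof. by apply: eq_forallb => i; rewrite ffunE oppr_eq0. Qed.

Lemma last_signN k : last_sign (- k) = - last_sign k.
Proof.
rewrite /last_sign -sumrN; apply: eq_bigr => j _.
by rewrite !supportedN ffunE sgzN mulrN.
Qed.

Lemma last_sign_last k (n : 'I_N) : k n != 0 ->
  (forall i : 'I_N, (n < i)%N -> k i = 0) -> last_sign k = sgz (k n).
Proof.
move=> kn kS; rewrite /last_sign (bigD1 n)//=.
have sn : supported n.+1 k.
  by apply/forallP => i; apply/implyP => ni; rewrite kS.
have nsn j : (j <= n)%N -> supported j k = false.
  by move=> jn; apply/negP => /forallP/(_ n); rewrite jn (negbTE kn).
rewrite sn nsn//= mul1r big1 ?addr0// => j /eqP jn.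
have [nj|nj|/val_inj] := ltngtP j n; last by [].
- by rewrite nsn// mul0r.
- by rewrite kS// sgz0 mulr0.
Qed.

Lemma is_trig_poly_completion a : is_trig_poly a -> is_trig_poly (analytic_completion a).
Proof.
move=> ta; apply: trig_poly_sub (ta) => k; rewrite analytic_completionE//.
by apply: contraNneq => ->; rewrite mul0r.
Qed.

Lemma analytic_completion_ge0 a k (n : 'I_N) : is_trig_poly a ->
  analytic_completion a k != 0 -> (forall i : 'I_N, (n < i)%N -> k i = 0) ->
  0 <= k n.
Proof.
move=> ta gk kS; rewrite leNgt; apply/negP => kn0.
move: gk; rewrite analytic_completionE// (last_sign_last _ kS); last by rewrite lt_eqF.
by rewrite ltr0_sgz// mulrN1z subrr mulr0 eqxx.
Qed.

(** Since [last_sign] is odd and the coefficients a_k are Hermitian, the conjugate of g has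
    coefficients a_k (1 - [last_sign] k), and the average of the two is a_k. The identity holds at
    every point of C^N, hence along the walk inside the disc and beyond it. *)
Lemma Re_analytic_completion a z : is_trig_poly a -> real_on_torus a ->
  trig_eval a z = (complex.Re (trig_eval (analytic_completion a) z))%:C.
Proof.
move=> ta ra; have [us sup] := support_seqP ta.
have tg := is_trig_poly_completion ta.
have [tg' e] := coef_conj_eval z tg.
have supg k : analytic_completion a k != 0 -> k \in support_seq a.
  by rewrite sup analytic_completionE//; apply: contraNneq => ->; rewrite mul0r.
have gE k : coef_conj (analytic_completion a) k = a k * (1 - (last_sign k)%:~R).
  rewrite /coef_conj analytic_completionE// conjcM last_signN -[in RHS](coef_conj_real ta ra).
  have conjI (m : int) : conjc (m%:~R : R[i]) = m%:~R.
    by rewrite -(rmorph_int (real_complex R)); exact: conjc_real.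
  by congr (_ * _); rewrite conjcD conjc1 conjI mulrNz.
have -> : (complex.Re (trig_eval (analytic_completion a) z))%:C =
    2^-1 * (trig_eval (analytic_completion a) z + conjc (trig_eval (analytic_completion a) z)).
  by rewrite ReJ_add mulrC.
rewrite -e (@trig_evalE _ _ _ (support_seq a))//; last by move=> k; rewrite sup.
rewrite (@trig_evalE _ _ (analytic_completion a) (support_seq a))//.
rewrite (@trig_evalE _ _ (coef_conj _) (support_seq a))//; last first.
  by move=> k; rewrite sup gE; apply: contraNneq => ->; rewrite mul0r.
rewrite -big_split mulr_sumr; apply: eq_bigr => k _ /=.
by rewrite gE analytic_completionE//; field.
Qed.

End analytic_completion.

(** * Growth of trigonometric polynomials *)

Section polynomial_growth.
Context (R : realType) (N : nat).
Local Notation tup := (N.-tuple R[i]).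
Implicit Types (F G : tup -> R[i]).

(** Growth and Lipschitz bound together, because the Lipschitz bound of a product uses the growth of
    its factors. The radius r is free: the discrete walk leaves the unit disc, by a random
    amount. *)
Definition poly_growth F := exists C : R, exists D : nat, 0 <= C /\
  forall (r rho : R) (z w : tup), 1 <= r -> 0 <= rho ->
    (forall n, normc (tnth z n) <= r) -> (forall n, normc (tnth w n) <= r) ->
    (forall n, normc (tnth z n - tnth w n) <= rho) ->
    normc (F z) <= C * r ^+ D /\ normc (F z - F w) <= C * r ^+ D * rho.

Lemma poly_growth_cst c : poly_growth (fun=> c).
Proof.
exists (normc c), 0%N; split; first exact: normc_ge0.
move=> r rho z w r1 rho0 _ _ _; rewrite expr0 mulr1 subrr normc0; split=> //.
by rewrite mulr_ge0// normc_ge0.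
Qed.

Lemma poly_growth_tnth n : poly_growth (fun z => tnth z n).
Proof.
exists 1, 1%N; split=> // r rho z w r1 rho0 zr wr zw; rewrite expr1 mul1r; split=> //.
by rewrite (le_trans (zw n))// ler_peMl.
Qed.

Lemma poly_growthJ F : poly_growth F -> poly_growth (fun z => conjc (F z)).
Proof.
move=> [C [D [C0 h]]]; exists C, D; split=> // r rho z w r1 rho0 zr wr zw.
have [h1 h2] := h _ _ _ _ r1 rho0 zr wr zw.
have -> : conjc (F z) - conjc (F w) = conjc (F z - F w).
  by rewrite conjcD; congr (_ + _); apply: complexP; rewrite ?(ReN, ImN, ReJ, ImJ).
by rewrite !ncJ.
Qed.

Lemma poly_growthD F G : poly_growth F -> poly_growth G ->
  poly_growth (fun z => F z + G z).
Proof.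
move=> [C [D [C0 h]]] [C' [D' [C0' h']]]; exists (C + C'), (D + D')%N.
split=> [|r rho z w r1 rho0 zr wr zw]; first exact: addr_ge0.
have [h1 h2] := h _ _ _ _ r1 rho0 zr wr zw.
have [h1' h2'] := h' _ _ _ _ r1 rho0 zr wr zw.
have rD : r ^+ D <= r ^+ (D + D') by apply: ler_weXn2l => //; exact: leq_addr.
have rD' : r ^+ D' <= r ^+ (D + D') by apply: ler_weXn2l => //; exact: leq_addl.
split.
  rewrite (le_trans (ler_normcD _ _))// mulrDl lerD//.
    by rewrite (le_trans h1)// ler_wpM2l.
  by rewrite (le_trans h1')// ler_wpM2l.
rewrite (_ : F z + G z - (F w + G w) = (F z - F w) + (G z - G w)); last by ring.
rewrite (le_trans (ler_normcD _ _))// !mulrDl lerD//.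
  by rewrite (le_trans h2)// ler_wpM2r// ler_wpM2l.
by rewrite (le_trans h2')// ler_wpM2r// ler_wpM2l.
Qed.

Lemma poly_growthM F G : poly_growth F -> poly_growth G ->
  poly_growth (fun z => F z * G z).
Proof.
move=> [C [D [C0 h]]] [C' [D' [C0' h']]]; exists (2 * (C * C')), (D + D')%N.
split=> [|r rho z w r1 rho0 zr wr zw]; first by rewrite !mulr_ge0.
have [h1 h2] := h _ _ _ _ r1 rho0 zr wr zw.
have [h1' h2'] := h' _ _ _ _ r1 rho0 zr wr zw.
have wz n : normc (tnth w n - tnth z n) <= rho by rewrite ncB.
have [h3 _] := h _ _ _ _ r1 rho0 wr zr wz.
have r0 : 0 <= r by exact: le_trans r1.
have E : 2 * (C * C') * r ^+ (D + D') = C * r ^+ D * (C' * r ^+ D') *+ 2.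
  by rewrite exprD; ring.
have P0 : 0 <= C * r ^+ D * (C' * r ^+ D') by rewrite !mulr_ge0 ?exprn_ge0.
split.
  rewrite ncM E mulr2n (@le_trans _ _ (C * r ^+ D * (C' * r ^+ D')))//.
    by apply: ler_pM; rewrite ?normc_ge0.
  by rewrite lerDl.
rewrite (_ : F z * G z - F w * G w = (F z - F w) * G z + F w * (G z - G w)); last by ring.
rewrite (le_trans (ler_normcD _ _))// !ncM E mulr2n mulrDl lerD//.
  rewrite [leRHS]mulrAC; apply: ler_pM; rewrite ?normc_ge0//.
rewrite -[leRHS]mulrA; apply: ler_pM; rewrite ?normc_ge0//.
Qed.

Lemma poly_growth_sum I (s : seq I) (F : I -> tup -> R[i]) :
  (forall i, poly_growth (F i)) -> poly_growth (fun z => \sum_(i <- s) F i z).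
Proof.
move=> gF; elim: s => [|i s ih].
  by under eq_fun do rewrite big_nil; exact: poly_growth_cst.
by under eq_fun do rewrite big_cons; exact: poly_growthD.
Qed.

Lemma poly_growth_prod I (s : seq I) (F : I -> tup -> R[i]) :
  (forall i, poly_growth (F i)) -> poly_growth (fun z => \prod_(i <- s) F i z).
Proof.
move=> gF; elim: s => [|i s ih].
  by under eq_fun do rewrite big_nil; exact: poly_growth_cst.
by under eq_fun do rewrite big_cons; exact: poly_growthM.
Qed.

Lemma poly_growthX F p : poly_growth F -> poly_growth (fun z => F z ^+ p).
Proof.
move=> gF; elim: p => [|p ih].
  by under eq_fun do rewrite expr0; exact: poly_growth_cst.
by under eq_fun do rewrite exprS; exact: poly_growthM.
Qed.

Lemma poly_growth_trig_eval (a : coefs R N) : is_trig_poly a ->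
  poly_growth (trig_eval a).
Proof.
move=> ta; rewrite (_ : trig_eval a = fun z => \sum_(k <- support_seq a) a k * mono k z).
  apply: poly_growth_sum => k; apply: poly_growthM; first exact: poly_growth_cst.
  apply: poly_growth_prod => n; case: (k n) => p; rewrite /zpow.
    by apply: poly_growthX; exact: poly_growth_tnth.
  by apply: poly_growthX; apply: poly_growthJ; exact: poly_growth_tnth.
by apply/funext => z; exact: trig_eval_support.
Qed.

Lemma trig_eval0 (a : coefs R N) (z : tup) : is_trig_poly a -> (forall n, tnth z n = 0) ->
  trig_eval a z = a 0.
Proof.
move=> ta z0; have [us sup] := support_seqP ta.
have m0 k : mono k z = (k == 0)%:R.
  have [->|k0] := eqVneq k 0; first exact: mono0.
  have [j kj] : exists j, k j != 0.
    apply/existsP; apply: contra_neqT k0; rewrite negb_exists => /forallP h.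
    by apply/ffunP => j; rewrite ffunE; have := h j; rewrite negbK => /eqP.
  by rewrite /mono (bigD1 j)//= z0 zpow_at0 (negbTE kj) mul0r.
rewrite trig_eval_support//; have [ks|ks] := boolP (0 \in support_seq a).
  rewrite (bigD1_seq 0)//= m0 eqxx mulr1 big1 ?addr0// => l /negbTE l0.
  by rewrite m0 l0 mulr0.
rewrite big_seq big1 => [|l ls].
  by apply/eqP; rewrite eq_sym; apply: contraNT ks; rewrite sup.
by rewrite m0; case: eqP => [l0|_]; [rewrite -l0 ls in ks|rewrite mulr0].
Qed.

End polynomial_growth.

(** * Exit times *)

Lemma grid_index (R : realType) (h t : R) : 0 < h -> 0 <= t ->
  exists k : nat, t <= k%:R * h < t + h.
Proof.
move=> h0 t0; have f0 : 0 <= t / h by rewrite divr_ge0// ltW.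
have c0 : 0 <= Num.ceil (t / h) by rewrite ceil_ge0 (lt_le_trans _ f0)// ltrN10.
exists `|Num.ceil (t / h)|%N; have := ceil_itv (t / h).
rewrite -[Num.ceil _]gez0_abs// absz_nat intrB -!pmulrn ltrBlDr => /andP[h1 h2].
apply/andP; split; first by rewrite -ler_pdivrMr.
by rewrite -ltr_pdivlMr// mulrDl mulfV ?gt_eqF//; lra.
Qed.

Section exit_time_path.
Context d (Omega : measurableType d) (R : realType) (c : R -> Omega -> R[i]) (w : Omega).
Hypothesis c0 : c 0 w = 0.
Hypothesis cc : forall t e : R, 0 <= t -> 0 < e -> exists2 del : R, 0 < del &
  forall s : R, 0 <= s -> `|s - t| < del -> normc (c s w - c t w) < e.

Let T := exit_time c w.

Lemma exit_time_ge0 : (0 <= T)%E.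
Proof. by apply: le_ereal_inf_tmp => _ [t [t0 _] <-]; rewrite lee_fin. Qed.

Lemma exit_time_lb t : 0 <= t -> 1 <= normc (c t w) -> (T <= t%:E)%E.
Proof. by move=> t0 ct; apply: ereal_inf_lbound; exists t. Qed.

Lemma before_exit t : 0 <= t -> (t%:E < T)%E -> normc (c t w) < 1.
Proof. by move=> t0 tT; rewrite ltNge; apply/negP => /(exit_time_lb t0); rewrite leNgt tT. Qed.

(** If |c| were above 1 at the exit time, it would be above 1 slightly earlier; if it were below 1,
    it would stay below 1 for a while and the infimum would be larger. The start at 0 guarantees
    that there is an earlier time. *)
Lemma normc_exit t0 : T = t0%:E -> 0 <= t0 /\ normc (c t0 w) = 1.
Proof.
move=> Te; have t00 : 0 <= t0 by rewrite -lee_fin -Te exit_time_ge0.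
split=> //; apply/eqP; rewrite eq_le; apply/andP; split; rewrite leNgt; apply/negP => ct.
- have tp : 0 < t0.
    rewrite lt_def t00 andbT; apply/eqP => t0e.
    by move: ct; rewrite t0e c0 normc0 ltr10.
  have e0 : 0 < normc (c t0 w) - 1 by rewrite subr_gt0.
  have [del del0 h] := cc t00 e0.
  pose s := Num.max 0 (t0 - del / 2).
  have s0 : 0 <= s by rewrite le_max lexx.
  have st : s < t0 by rewrite gt_max tp /= ltrBlDr ltrDl divr_gt0.
  have : normc (c s w - c t0 w) < normc (c t0 w) - 1.
    apply: h => //; rewrite ltr0_norm ?subr_lt0// opprB.
    have : t0 - del / 2 <= s by rewrite le_max lexx orbT.
    by lra.
  have := lerB_normc (c t0 w) (c s w); rewrite ncB.
  have := before_exit s0; rewrite Te lte_fin st => /(_ isT).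
  by lra.
- have e0 : 0 < 1 - normc (c t0 w) by rewrite subr_gt0.
  have [del del0 h] := cc t00 e0.
  suff : ((t0 + del)%:E <= T)%E by rewrite Te lee_fin gerDl leNgt del0.
  apply: le_ereal_inf_tmp => _ [t [tge ct1] <-]; rewrite lee_fin leNgt; apply/negP => tlt.
  have t0t : t0 <= t by rewrite -lee_fin -Te; exact: exit_time_lb.
  have : normc (c t w - c t0 w) < 1 - normc (c t0 w).
    by apply: h => //; rewrite ger0_norm ?subr_ge0//; lra.
  have := lerB_normc (c t w) (c t0 w); lra.
Qed.

Lemma exit_timeP t : 0 <= t ->
  (t%:E < T)%E <-> forall s, 0 <= s <= t -> normc (c s w) < 1.
Proof.
move=> t0; split=> [tT s /andP[s0 st]|h].
  by apply: before_exit => //; apply: le_lt_trans tT; rewrite lee_fin.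
rewrite ltNge; apply/negP => Tt.
have Tf : T = (fine T)%:E.
  by rewrite fineK// ge0_fin_numE ?exit_time_ge0// (le_lt_trans Tt)// ltry.
have [f0 /eqP] := normc_exit Tf; rewrite lt_eqF//; apply: h.
by rewrite f0 -lee_fin -Tf.
Qed.

Let stop t := stopped c t w.

Lemma stopped_lt t : (t%:E <= T)%E -> stop t = c t w.
Proof. by move=> tT; rewrite /stop /stopped minEle leNgt; case: ltP => //= Tt; rewrite (_ : exit_time c w = t%:E)//; apply/le_anti; rewrite Tt. Qed.

Lemma stopped_ge t : (T <= t%:E)%E -> stop t = exit_point c w.
Proof. by move=> tT; rewrite /stop /stopped /exit_point min_l. Qed.

Lemma fin_exit t : (T <= t%:E)%E -> T = (fine T)%:E.
Proof. by move=> Tt; rewrite fineK// ge0_fin_numE ?exit_time_ge0// (le_lt_trans Tt)// ltry. Qed.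

Lemma normc_exit_point_le1 : normc (exit_point c w) <= 1.
Proof.
have := normc_exit; rewrite /exit_point -/T; case eT: T => [t| |]/=.
- by move=> /(_ _ erefl)[_ ->].
- by rewrite c0 normc0 ler01.
- by rewrite c0 normc0 ler01.
Qed.

Lemma normc_stopped_le1 t : 0 <= t -> normc (stop t) <= 1.
Proof.
move=> t0; have [tT|Tt] := ltP t%:E T.
  by rewrite stopped_lt ?ltW// before_exit.
by rewrite stopped_ge//; exact: normc_exit_point_le1.
Qed.

(** Continuity from the right suffices: a time t is approximated by the first grid time at or after
    t. *)
Lemma stopped_right_continuous t e : 0 <= t -> 0 < e -> exists2 del : R, 0 < del &
  forall s, t <= s -> s < t + del -> normc (stop s - stop t) < e.
Proof.
move=> t0 e0; have [tT|Tt] := ltP t%:E T; last first.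
  exists 1 => // s ts _; rewrite !stopped_ge ?subrr ?normc0//.
  by apply: le_trans Tt _; rewrite lee_fin.
have [del del0 h] := cc t0 e0; exists del => // s ts sd.
rewrite (stopped_lt (ltW tT)); have [sT|Ts] := ltP s%:E T.
  rewrite (stopped_lt (ltW sT)); apply: h; first exact: le_trans ts.
  by rewrite ger0_norm ?subr_ge0//; lra.
rewrite stopped_ge// /exit_point -/T; have Te := fin_exit Ts.
have ft : t < fine T by rewrite -lte_fin -Te.
have fs : fine T <= s by rewrite -lee_fin -Te.
by apply: h; [exact: le_trans (ltW ft)|rewrite gtr0_norm ?subr_gt0//; lra].
Qed.

(** The path on the grid, where step i is made as long as the exit has not occurred at the start of
    the step. The decision depends on the past only, at the price of stopping at the first grid time
    at or after the exit. *)
Definition stopped_sum (h : R) (k : nat) : R[i] :=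
  \sum_(i < k) if ((i%:R * h)%:E < T)%E
               then c (i.+1%:R * h) w - c (i%:R * h) w else 0.

Variable h : R.
Hypothesis h0 : 0 < h.

Lemma stopped_sum_before k : (forall i, (i < k)%N -> (i%:R * h)%:E < T)%E ->
  stopped_sum h k = c (k%:R * h) w.
Proof.
elim: k => [|k ih] hk; first by rewrite /stopped_sum big_ord0 mul0r c0.
have := ih (fun i ik => hk i (ltnW ik)); rewrite /stopped_sum big_ord_recr/= => ->.
by rewrite hk// addrC subrK.
Qed.

Lemma stopped_sum_le x k : 0 <= x ->
  (forall i, (i < k)%N -> normc (c (i.+1%:R * h) w - c (i%:R * h) w) <= x) ->
  normc (stopped_sum h k) <= 1 + x.
Proof.
move=> x0; elim: k => [|k ih] hx.
  by rewrite /stopped_sum big_ord0 normc0 addr_ge0// ler01.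
have := ih (fun i ik => hx i (ltnW ik)); rewrite /stopped_sum big_ord_recr/=.
case: ifPn => [kT|]; last by rewrite addr0.
rewrite -/(stopped_sum h k) stopped_sum_before => [_|i ik]; last first.
  apply: le_lt_trans kT; rewrite lee_fin (ler_wpM2r (ltW h0)) ?ler_nat ?(ltnW ik)//.
have k0 : 0 <= k%:R * h by rewrite mulr_ge0// ltW.
have := before_exit k0 kT; have := hx k (ltnSn k).
have := ler_normcD (c (k%:R * h) w) (c (k.+1%:R * h) w - c (k%:R * h) w); lra.
Qed.

Lemma stopped_sum_after k kap : T = (fine T)%:E ->
  fine T <= kap%:R * h < fine T + h ->
  stopped_sum h k = c ((minn k kap)%:R * h) w.
Proof.
move=> Te /andP[k1 k2]; have kP i : (i < kap)%N = ((i%:R * h)%:E < T)%E.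
  rewrite Te lte_fin; apply/idP/idP => [ik|].
    have : i.+1%:R * h <= kap%:R * h by rewrite (ler_wpM2r (ltW h0)) ?ler_nat.
    by rewrite -addn1 natrD mulrDl mul1r; lra.
  apply: contraTT; rewrite -leqNgt -leNgt => ki.
  by apply: (le_trans k1); rewrite (ler_wpM2r (ltW h0)) ?ler_nat.
elim: k => [|k ih]; first by rewrite /stopped_sum big_ord0 min0n mul0r c0.
move: ih; rewrite /stopped_sum big_ord_recr/= => ->; rewrite -kP.
have [kk|kk] := ltnP k kap; first by rewrite (minn_idPl kk) addrC subrK.
by rewrite (minn_idPr (leqW kk)) addr0.
Qed.

End exit_time_path.

Section stopped_sum_limit.
Context d (Omega : measurableType d) (R : realType) (c : R -> Omega -> R[i]) (w : Omega).
Hypothesis c0 : c 0 w = 0.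
Hypothesis cc : forall t e : R, 0 <= t -> 0 < e -> exists2 del : R, 0 < del &
  forall s : R, 0 <= s -> `|s - t| < del -> normc (c s w - c t w) < e.

(** Up to the exit both sides are the same value of the path; from then on the left one is frozen at
    a grid time less than h after the exit. So continuity at the exit time alone yields a bound
    uniform in k. *)
Lemma stopped_sum_close (e : R) : 0 < e -> exists2 del : R, 0 < del &
  forall (h : R) (k : nat), 0 < h -> h < del ->
    normc (stopped_sum c w h k - stopped c (k%:R * h) w) < e.
Proof.
move=> e0; have T0 := exit_time_ge0 c w.
have [Tf|Tf] := ltP (exit_time c w) +oo%E; last first.
  have Te : exit_time c w = +oo%E by apply/le_anti; rewrite Tf leey.
  exists 1 => // h k h0 _; rewrite (stopped_lt (_ : _ <= exit_time c w)%E); last by rewrite Te leey.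
  by rewrite (stopped_sum_before c0) ?subrr ?normc0// => i _; rewrite Te ltry.
have Te : exit_time c w = (fine (exit_time c w))%:E by rewrite fineK// ge0_fin_numE.
have f0 : 0 <= fine (exit_time c w) by rewrite -lee_fin -Te.
have [del del0 hd] := cc f0 e0; exists del => // h k h0 hdel.
have [kap kb] := grid_index h0 f0.
rewrite (stopped_sum_after c0 h0 k Te kb).
case/andP: kb => k1 k2; have [kk|kk] := ltnP k kap.
  rewrite (stopped_lt (_ : _ <= exit_time c w)%E); first by rewrite subrr normc0.
  have : k.+1%:R * h <= kap%:R * h by rewrite (ler_wpM2r (ltW h0)) ?ler_nat.
  by rewrite Te lee_fin -addn1 natrD mulrDl mul1r; lra.
rewrite stopped_ge; last first.
  by rewrite Te lee_fin; apply: (le_trans k1); rewrite (ler_wpM2r (ltW h0)) ?ler_nat.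
apply: hd; first exact: le_trans k1.
by rewrite ger0_norm ?subr_ge0//; lra.
Qed.

End stopped_sum_limit.

Lemma within_continuous_ray (R : realType) (X : R -> R) :
  {within `[0, +oo[, continuous X} ->
  forall t e : R, 0 <= t -> 0 < e -> exists2 del : R, 0 < del &
    forall s : R, 0 <= s -> `|s - t| < del -> `|X s - X t| < e.
Proof.
move=> cX t e t0 e0; have /subspace_continuousP/(_ t) := cX.
rewrite /= in_itv/= t0 => /(_ isT)/cvgrPdist_lt/(_ e e0).
rewrite near_withinE => -[del /= del0 h]; exists del => // s s0 sd.
rewrite distrC; apply: h; last by rewrite /= in_itv/= s0.
by rewrite /= distrC.
Qed.

Section measurable_exit.
Context d (Omega : measurableType d) (R : realType) (c : R -> Omega -> R[i]).
Hypothesis c0 : forall w, c 0 w = 0.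
Hypothesis cc : forall w (t e : R), 0 <= t -> 0 < e -> exists2 del : R, 0 < del &
  forall s : R, 0 <= s -> `|s - t| < del -> normc (c s w - c t w) < e.

(* By compactness and density, |c| < 1 on [0, t] iff |c| is bounded away from 1
   on a dense sequence of times. *)
Lemma before_exitE t : 0 <= t -> [set w | (t%:E < exit_time c w)%E] =
  \bigcup_p \bigcap_m \bigcap_i
    [set w | normc (c (t * ((minn i m.+1)%:R / m.+1%:R)) w) <= 1 - p.+1%:R^-1].
Proof.
move=> t0; apply/seteqP; split=> w /=.
  move=> /(exit_timeP (c0 w) (cc w) t0) h.
  have cn : {within `[0, t], continuous (fun s => normc (c s w))}.
    apply/subspace_continuousP => s; rewrite /= in_itv/= => /andP[s0 st].
    apply/cvgrPdist_lt => e e0; have [del del0 hd] := cc w s0 e0.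
    rewrite near_withinE; exists del => //= u us; rewrite in_itv/= => /andP[u0 _].
    have := hd u u0; rewrite distrC => /(_ us) hu.
    rewrite ltr_norml; change (- e < normc (c s w) - normc (c u w) < e).
    have := lerB_normc (c s w) (c u w).
    by have := lerB_normc (c u w) (c s w); rewrite (ncB (c s w)); lra.
  (* The maximum of |c| on [0, t] is attained and below 1; this gap determines p. *)
  have [s] := EVT_max t0 cn; rewrite in_itv/= => /h hs smax.
  have [p pe] := ltr_add_invr hs; exists p => // m _ i _ /=.
  rewrite lerBrDr; apply: le_trans (ltW pe); rewrite lerD2r; apply: smax.
  rewrite in_itv/= mulr_ge0 ?divr_ge0//= ler_piMr// ler_pdivrMr// mul1r ler_nat.
  exact: geq_minr.
move=> [p _ hp]; apply/(exit_timeP (c0 w) (cc w) t0) => s /andP[s0 st].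
have [t00|tn0] := eqVneq t 0.
  have -> : s = 0 by apply/le_anti; rewrite s0 -t00 st.
  by rewrite c0 normc0 ltr01.
have tp : 0 < t by rewrite lt_def tn0.
have p0 : 0 < p.+1%:R^-1 :> R by rewrite invr_gt0.
rewrite ltNge; apply/negP => cs.
have [del del0 hd] := cc w s0 p0.
have [m] := ltr_add_invr (divr_gt0 del0 tp); rewrite add0r => mdel.
have hm : 0 < t / m.+1%:R by rewrite divr_gt0.
have [k /andP[k1 k2]] := grid_index hm s0.
(* The grid point is so close to s, where |c| >= 1, that it violates the gap 1/(p+1). *)
have := hp m I k I; rewrite /= leNgt => /negP; apply.
set u := t * _; have us : s <= u /\ u < s + t / m.+1%:R.
  rewrite /u; have [km|km] := leqP k m.+1.
    by rewrite mulrA mulrAC mulrC; split.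
  rewrite mulfV ?pnatr_eq0// mulr1; split=> //; apply: le_lt_trans k2.
  by rewrite mulrA ler_pdivlMr// mulrC ler_pM2r// ler_nat ltnW.
have : normc (c u w - c s w) < p.+1%:R^-1.
  apply: hd; first by apply: le_trans us.1.
  rewrite ger0_norm ?subr_ge0 ?us.1// ltrBlDl (lt_trans us.2)// ltrD2l.
  by rewrite mulrC -ltr_pdivlMr.
clearbody u; have := lerB_normc (c s w) (c u w); rewrite (ncB (c s w)).
by move: (p.+1%:R^-1) cs => q; lra.
Qed.

Lemma measurable_before_exit t : 0 <= t ->
  (forall s, 0 <= s <= t -> cmeasurable (c s)) ->
  measurable [set w | (t%:E < exit_time c w)%E].
Proof.
move=> t0 mc; rewrite before_exitE//.
apply: bigcupT_measurable => p; apply: bigcap_measurableType => m _.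
apply: bigcap_measurableType => i _; set s := t * _.
have sI : 0 <= s <= t.
  rewrite mulr_ge0 ?divr_ge0//= ler_piMr// ler_pdivrMr// mul1r ler_nat.
  exact: geq_minr.
have := measurable_normc (mc _ sI) measurableT (@measurable_itv R `]-oo, 1 - p.+1%:R^-1]).
by rewrite setTI; congr (_ _); apply/funext => w; rewrite /= in_itv.
Qed.

End measurable_exit.

Section brownian_exit.
Context d (Omega : measurableType d) (R : realType) (P : probability Omega R).
Variables (N : nat) (B : 'I_N -> R -> Omega -> R[i]).
Hypothesis bmB : independent_complex_bm P B.

Lemma bm_at0 n w : B n 0 w = 0.
Proof.
have [/(_ n)[[_ re0 _ _ _] [_ im0 _ _ _] _] _] := bmB.
by apply: complexP; [exact: re0|exact: im0].
Qed.

Lemma bm_continuous n w (t e : R) : 0 <= t -> 0 < e -> exists2 del : R, 0 < del &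
  forall s : R, 0 <= s -> `|s - t| < del -> normc (B n s w - B n t w) < e.
Proof.
have [/(_ n)[[_ _ /(_ w) cre _ _] [_ _ /(_ w) cim _ _] _] _] := bmB => t0 e0.
have e2 : 0 < e / 2 by rewrite divr_gt0.
have [d1 d10 h1] := within_continuous_ray cre t0 e2.
have [d2 d20 h2] := within_continuous_ray cim t0 e2.
exists (Num.min d1 d2); first by rewrite lt_min d10.
move=> s s0; rewrite lt_min => /andP[sd1 sd2].
apply: le_lt_trans (normc_le _) _; rewrite ReD ImD ReN ImN.
by have := h1 s s0 sd1; have := h2 s s0 sd2; lra.
Qed.

(** Measurability for an arbitrary sigma-algebra that sees the path up to t; applied to [bm_past],
    it makes the decisions of [stopped_sum] depend on the past. *)
Lemma bm_before_exit n (X : set (set Omega)) t : 0 <= t ->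
  (forall s, 0 <= s <= t -> @cmeasurable _ (g_sigma_algebraType X) R (B n s)) ->
  <<s X>> [set w | (t%:E < exit_time (B n) w)%E].
Proof.
exact: (@measurable_before_exit _ (g_sigma_algebraType X) R (B n)
  (bm_at0 n) (@bm_continuous n) t).
Qed.

Lemma measurable_bm_before_exit n (t : R) : 0 <= t ->
  measurable [set w | (t%:E < exit_time (B n) w)%E].
Proof.
move=> t0; apply: measurable_before_exit => //; [exact: bm_at0|exact: bm_continuous|].
by move=> s /andP[s0 _]; exact: (cmeasurable_bm bmB).
Qed.

Definition no_exit n := [set w | exit_time (B n) w = +oo%E].

Lemma no_exitE n :
  no_exit n = \bigcap_(k : nat) [set w | ((k%:R : R)%:E < exit_time (B n) w)%E].
Proof.
apply/seteqP; split=> w /=; first by move=> e k _ /=; rewrite e ltry.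
move=> h; have T0 := exit_time_ge0 (B n) w.
case eT : (exit_time (B n) w) T0 => [r| |]// r0.
have := h (Num.truncn r).+1 I; rewrite /= eT lte_fin => hr.
by have := real_truncnS_gt (num_real r); rewrite ltNge ltW.
Qed.

Lemma measurable_no_exit n : measurable (no_exit n).
Proof.
by rewrite no_exitE; apply: bigcap_measurableType => k _; exact: measurable_bm_before_exit.
Qed.

(* P(|Re B_t| <= 1) is at most 2 times the maximum of the density of N(0, t),
   which tends to 0. *)
Lemma no_exit0 n : P (no_exit n) = 0.
Proof.
have le_k (k : nat) : (P (no_exit n) <= (2 / k.+1%:R)%:E)%E.
  (* The standard deviation at this time is k + 1, so the density is at most 1/(k + 1); the interval
     [-1, 1] has length 2. *)
  pose t : R := k.+1%:R ^+ 2.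
  have st : Num.sqrt (t - 0) = k.+1%:R by rewrite subr0 sqrtr_sqr ger0_norm.
  have t0 : 0 < t by rewrite exprn_gt0.
  pose I : set R := `[-1, 1]%classic; have mI : measurable I by exact: measurable_itv.
  have [] := bm_increment_law bmB n (lexx 0) t0 mI.
  rewrite st => eP _; apply: (@le_trans _ _ (P [set w |
      I (complex.Re (B n t w) - complex.Re (B n 0 w))%R])).
    apply: le_measure; rewrite ?inE; first exact: measurable_no_exit.
      have [mt _] := cmeasurable_bm bmB n (ltW t0).
      have [m0 _] := cmeasurable_bm bmB n (lexx 0).
      have := measurable_funB mt m0 measurableT mI; by rewrite setTI.
    move=> w /= nw; rewrite /I /= bm_at0 subr0 in_itv/= -ler_norml.
    apply: le_trans (normc_Re _) (ltW _).
    by apply: before_exit; rewrite ?ltW// nw ltry.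
  rewrite eP; apply: (@le_trans _ _ (\int[lebesgue_measure]_(x in I)
      (normal_peak (k.+1%:R : R))%:E)%E).
    apply: ge0_le_integral => //.
    - by move=> x _; rewrite lee_fin normal_pdf_ge0.
    - apply/measurable_EFinP; apply: measurable_funTS; exact: measurable_normal_pdf.
    - by move=> x _; rewrite lee_fin normal_pdf_ub// pnatr_eq0.
  have eI : lebesgue_measure I = 2%:E.
    by rewrite /I lebesgue_measure_itv/= lte_fin ifT -?EFinD ?opprK//; lra.
  rewrite integral_cst// [X in (_ * X)%E](_ : _ = 2%:E)//.
  rewrite -EFinM lee_fin mulrC ler_pM2l//.
  rewrite /normal_peak lef_pV2 ?posrE ?sqrtr_gt0//; last first.
    by rewrite pmulrn_lgt0// mulr_gt0 ?exprn_gt0 ?pi_gt0.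
  rewrite -[leLHS]ger0_norm// -sqrtr_sqr ler_wsqrtr//.
  by have := pi_ge2 R; have := sqr_ge0 (k.+1%:R : R); move: (_ ^+ 2) => y; nra.
have p0 : (0 <= P (no_exit n))%E by [].
have pf : P (no_exit n) \is a fin_num by apply: fin_num_measure; exact: measurable_no_exit.
rewrite -(fineK pf) in le_k p0 *; move: (fine _) le_k p0 => p le_k.
rewrite lee_fin => p0; congr EFin; apply/le_anti; rewrite p0 andbT leNgt; apply/negP => pp.
have [k] := ltr_add_invr (divr_gt0 pp (ltr0n R 2)); rewrite add0r => hk.
by have := le_k k; rewrite lee_fin; move: (_^-1) hk => q; lra.
Qed.

End brownian_exit.

(** * Stopped martingales *)

Section past.
Context d (Omega : measurableType d) (R : realType) (P : probability Omega R).
Variable G : set (set Omega).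
Hypothesis mG : <<s G >> `<=` measurable.
Implicit Types (X Y Z b : Omega -> R[i]).

Definition past_fun Y := @cmeasurable _ (g_sigma_algebraType G) R Y /\ moments P Y.

Lemma past_fun_cst z : past_fun (fun=> z).
Proof. by split; [exact: cmeasurable_cst|exact: moments_cst]. Qed.

Lemma past_funD X Y : past_fun X -> past_fun Y -> past_fun (fun w => X w + Y w).
Proof. by move=> [? ?] [? ?]; split; [exact: cmeasurableD|exact: momentsD]. Qed.

Lemma past_funM X Y : past_fun X -> past_fun Y -> past_fun (fun w => X w * Y w).
Proof. by move=> [? ?] [? ?]; split; [exact: cmeasurableM|exact: momentsM]. Qed.

Lemma past_funN X : past_fun X -> past_fun (fun w => - X w).
Proof. by move=> [? ?]; split; [exact: cmeasurableN|exact: momentsN]. Qed.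

Lemma past_funX X p : past_fun X -> past_fun (fun w => X w ^+ p).
Proof. by move=> [? ?]; split; [exact: cmeasurableX|exact: momentsX]. Qed.

Lemma past_funJ X : past_fun X -> past_fun (fun w => conjc (X w)).
Proof. by move=> [? ?]; split; [exact: cmeasurableJ|exact: momentsJ]. Qed.

Lemma past_fun_sum I (r : seq I) (F : I -> Omega -> R[i]) :
  (forall i, past_fun (F i)) -> past_fun (fun w => \sum_(i <- r) F i w).
Proof.
move=> pF; split; first by apply: cmeasurable_sum => i; have [] := pF i.
by apply: moments_sum => i; have [] := pF i.
Qed.

Lemma past_fun_prod I (r : seq I) (F : I -> Omega -> R[i]) :
  (forall i, past_fun (F i)) -> past_fun (fun w => \prod_(i <- r) F i w).
Proof.
move=> pF; split; first by apply: cmeasurable_prod => i; have [] := pF i.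
by apply: moments_prod => i; have [] := pF i.
Qed.

Lemma past_fun_if (b : Omega -> bool) X : <<s G >> [set w | b w] -> past_fun X ->
  past_fun (fun w => if b w then X w else 0).
Proof.
move=> mb [mX iX]; split.
  apply: (@cmeasurable_if _ (g_sigma_algebraType G) R b X (fun=> 0) _ mX).
    by apply: (measurable_fun_bool true); rewrite setTI.
  exact: cmeasurable_cst.
by apply: moments_if iX; apply: (measurable_fun_bool true); rewrite setTI; exact: mG.
Qed.

Variable xi : Omega -> R[i].
Hypothesis mxi : moments P xi.
Hypothesis xi_indep : indep_sigma P G xi.
Hypothesis xi_null : forall l, cexp P (fun w => xi w ^+ l.+1) = 0.

(* Polynomials without constant term in the increment xi, with coefficients in
   the past: they are closed under products, and have mean 0 because xi is
   independent of the past and E(xi^l) = 0 for l > 0. *)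
Inductive null_poly : (Omega -> R[i]) -> Prop :=
| null_poly0 : null_poly (fun=> 0)
| null_poly_add b l Y : past_fun b -> null_poly Y ->
    null_poly (fun w => b w * xi w ^+ l.+1 + Y w).

Lemma null_polyD X Y : null_poly X -> null_poly Y -> null_poly (fun w => X w + Y w).
Proof.
move=> nX nY; elim: nX => [|b l X' pb _ ih].
  by rewrite (_ : (fun _ => _) = Y)//; apply/funext => w; rewrite add0r.
rewrite (_ : (fun _ => _) = (fun w => b w * xi w ^+ l.+1 + (X' w + Y w))).
  exact: null_poly_add.
by apply/funext => w; rewrite addrA.
Qed.

Lemma null_poly_sum I (r : seq I) (F : I -> Omega -> R[i]) :
  (forall i, null_poly (F i)) -> null_poly (fun w => \sum_(i <- r) F i w).
Proof.
move=> nF; elim: r => [|i r ih].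
  by under eq_fun do rewrite big_nil; exact: null_poly0.
by under eq_fun do rewrite big_cons; exact: null_polyD.
Qed.

Lemma null_polyMl b Y : past_fun b -> null_poly Y -> null_poly (fun w => b w * Y w).
Proof.
move=> pb nY; elim: nY => [|b' l Y' pb' _ ih].
  by under eq_fun do rewrite mulr0; exact: null_poly0.
rewrite (_ : (fun _ => _) = (fun w => (b w * b' w) * xi w ^+ l.+1 + b w * Y' w)).
  by apply: null_poly_add => //; exact: past_funM.
by apply/funext => w; rewrite mulrDr mulrA.
Qed.

Lemma null_polyMxi Y l : null_poly Y -> null_poly (fun w => xi w ^+ l * Y w).
Proof.
move=> nY; elim: nY => [|b' l' Y' pb' _ ih].
  by under eq_fun do rewrite mulr0; exact: null_poly0.
rewrite (_ : (fun _ => _) =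
    (fun w => b' w * xi w ^+ (l + l').+1 + xi w ^+ l * Y' w)).
  exact: null_poly_add.
by apply/funext => w; rewrite -addnS exprD; ring.
Qed.

Lemma null_polyM X Y : null_poly X -> null_poly Y -> null_poly (fun w => X w * Y w).
Proof.
move=> nX nY; elim: nX => [|b l X' pb _ ih].
  by under eq_fun do rewrite mul0r; exact: null_poly0.
rewrite (_ : (fun _ => _) =
    (fun w => b w * (xi w ^+ l.+1 * Y w) + X' w * Y w)); last first.
  by apply/funext => w; ring.
by apply: null_polyD => //; apply: null_polyMl => //; exact: null_polyMxi.
Qed.

Lemma null_poly_moments Y : null_poly Y -> moments P Y.
Proof.
elim=> [|b l Y' [_ pb] _ ih]; first exact: moments_cst.
by apply: momentsD => //; apply: momentsM => //; exact: momentsX.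
Qed.

Lemma null_poly_cexp Y : null_poly Y -> cexp P Y = 0.
Proof.
elim=> [|b l Y' [mb pb] nY' ih]; first exact: cexp_cst.
have mpow : moments P (fun w => xi w ^+ l.+1) by exact: momentsX.
rewrite cexpD ?ih ?addr0; last 2 first.
- by apply: moments_complex_integrable; exact: momentsM.
- by apply: moments_complex_integrable; exact: null_poly_moments.
rewrite (@indep_cexp _ _ _ P _ R[i] G xi b (fun z => z ^+ l.+1))//.
- by rewrite [X in _ * X]xi_null mulr0.
- by apply/cmeasurableP; have [] := mxi.
- by apply: cmeasurableX; apply/cmeasurableP; exact: measurable_id.
- exact: moments_complex_integrable.
- exact: moments_complex_integrable.
Qed.

(** The constant term of the binomial expansion cancels. Only powers of xi occur, none of its
    conjugate: a product of xi and its conjugate would have a positive mean. *)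
Lemma null_poly_pow x b p : past_fun x -> past_fun b ->
  null_poly (fun w => (x w + b w * xi w) ^+ p - x w ^+ p).
Proof.
move=> px pb; elim: p => [|p ih].
  by under eq_fun do rewrite !expr0 subrr; exact: null_poly0.
pose Y w := (x w + b w * xi w) ^+ p - x w ^+ p.
rewrite (_ : (fun _ => _) = (fun w => (b w * x w ^+ p) * xi w ^+ 1 +
    (x w * Y w + b w * (xi w ^+ 1 * Y w)))).
  apply: null_poly_add; first by apply: past_funM => //; exact: past_funX.
  apply: null_polyD; apply: null_polyMl => //; exact: null_polyMxi.
by apply/funext => w; rewrite /Y !exprS !expr0 mulr1; ring.
Qed.

End past.

Section martingale.
Context d (Omega : measurableType d) (R : realType) (P : probability Omega R).
Variables (M : nat) (G : nat -> set (set Omega)) (xi D : nat -> Omega -> R[i]).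
Variable A : nat -> Omega -> bool.
Hypothesis mG : forall j, (j < M)%N -> <<s G j >> `<=` measurable.
Hypothesis mxi : forall j, (j < M)%N -> moments P (xi j).
Hypothesis xi_indep : forall j, (j < M)%N -> indep_sigma P (G j) (xi j).
Hypothesis xi_null : forall j, (j < M)%N ->
  forall l, cexp P (fun w => xi j w ^+ l.+1) = 0.
Hypothesis D_null : forall j, (j < M)%N -> null_poly P (G j) (xi j) (D j).
Hypothesis A_past : forall j, (j < M)%N -> <<s G j >> [set w | A j w].
Hypothesis AD_past : forall i j, (i < j)%N -> (j < M)%N ->
  past_fun P (G j) (fun w => if A i w then D i w else 0).

Definition stopped_mart (j : nat) (w : Omega) : R[i] :=
  \sum_(i < j) if A i w then D i w else 0.

Let S := stopped_mart.

Let S_past j k : (k <= j)%N -> (j < M)%N -> past_fun P (G j) (S k).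
Proof.
elim: k => [_ jM|k ih kj jM].
  by rewrite /S /stopped_mart; under eq_fun do rewrite big_ord0; exact: past_fun_cst.
rewrite /S /stopped_mart; under eq_fun do rewrite big_ord_recr/=.
by apply: past_funD; [exact: ih (ltnW kj) jM|exact: AD_past].
Qed.

(* S_(j+1)^2 = S_j^2 + (2 S_j D_j + D_j^2) 1_(A_j), where the last term is a
   polynomial without constant term in the increment. *)
Lemma stopped_mart_sq j : (j <= M)%N -> moments P (S j) /\ cexp P (fun w => S j w ^+ 2) = 0.
Proof.
elim: j => [_|j ih jM].
  rewrite /S /stopped_mart; under eq_fun do rewrite big_ord0.
  by split; [exact: moments_cst|under eq_fun do rewrite big_ord0 expr0n; exact: cexp_cst].
have [mS eS] := ih (ltnW jM).
pose one w : R[i] := if A j w then 1 else 0.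
have pone : past_fun P (G j) one.
  by apply: past_fun_if; [exact: mG|exact: A_past|exact: past_fun_cst].
have SE w : S j.+1 w = S j w + one w * D j w.
  by rewrite /S /stopped_mart big_ord_recr/= /one; case: ifP; rewrite ?mul1r ?mul0r.
have nY : null_poly P (G j) (xi j)
    (fun w => (2 * (S j w * one w)) * D j w + (one w * one w) * (D j w * D j w)).
  apply: null_polyD.
    apply: null_polyMl; last exact: D_null.
    apply: past_funM; first exact: past_fun_cst.
    by apply: past_funM => //; exact: S_past.
  by apply: null_polyMl; [exact: past_funM|apply: null_polyM; exact: D_null].
split.
  rewrite (_ : S j.+1 = fun w => S j w + one w * D j w); last exact/funext.
  apply: momentsD => //; apply: momentsM; first by have [] := pone.
  by apply: (null_poly_moments (mxi jM)); exact: D_null.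
rewrite (_ : (fun w => S j.+1 w ^+ 2) = (fun w => S j w ^+ 2 +
    ((2 * (S j w * one w)) * D j w + (one w * one w) * (D j w * D j w)))).
  rewrite cexpD ?eS ?add0r.
  - exact: (null_poly_cexp (mG jM) (mxi jM) (xi_indep jM) (xi_null jM)).
  - by apply: moments_complex_integrable; exact: momentsX.
  - by apply: moments_complex_integrable; exact: (null_poly_moments (mxi jM) nY).
by apply/funext => w; rewrite SE; ring.
Qed.

(** The real part of E(S^2) = 0 says that Re S and Im S have the same second moment. *)
Lemma stopped_mart_norm :
  [/\ P.-integrable setT (fun w => (normc (S M w) ^+ 2)%:E),
      P.-integrable setT (fun w => (complex.Re (S M w) ^+ 2)%:E) &
      \int[P]_w (normc (S M w) ^+ 2) = 2 * \int[P]_w (complex.Re (S M w) ^+ 2)].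
Proof.
have [mS eS] := stopped_mart_sq (leqnn M); have [cS iS] := mS.
have iRe : P.-integrable setT (fun w => (complex.Re (S M w) ^+ 2)%:E).
  apply: (le_integrable measurableT _ _ (iS 2%N)).
    by apply/measurable_EFinP; apply: measurable_funX; case: cS.
  move=> w _; rewrite lee_fin !ger0_norm ?sqr_ge0//.
  by rewrite normc_sq lerDl sqr_ge0.
split; [exact: iS|exact: iRe|].
have [iq _] := moments_complex_integrable (momentsX 2 mS).
have := congr1 (@complex.Re R) eS; rewrite /cexp /complex_integral /= => e0.
rewrite -RintegralZl// -[RHS]subr0 -e0 -RintegralB//; last first.
  have := integrableZl measurableT 2 iRe; apply: eq_integrable => // w _.

by apply: eq_Rintegral => w _; rewrite normc_sq expr2 ReM; ring.
Qed.

End martingale.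

(** * Pathwise stopping between two levels *)

Section hit.
Context (R : realType) (g : nat -> R[i]).

Definition hit (l : R) (j : nat) := [exists i : 'I_j.+1, l < normc (g i)].

Lemma hit0 l : hit l 0 = (l < normc (g 0)).
Proof.
apply/idP/idP; last by move=> h; apply/existsP; exists ord0.
by apply: contraTT => h; apply/existsPn => i; rewrite ord1.
Qed.

Lemma hitS l j : hit l j.+1 = hit l j || (l < normc (g j.+1)).
Proof.
apply/existsP/orP => [[i hi]|[/existsP[i hi]|hj]].
- have [ij|ij] := ltnP i j.+1; first by left; apply/existsP; exists (Ordinal ij).
  by right; rewrite (_ : j.+1 = i)//; apply/eqP; rewrite eqn_leq ij -ltnS ltn_ord.
- by exists (widen_ord (leqnSn _) i).
- by exists ord_max.
Qed.

Lemma hitN l j i : (i <= j)%N -> ~~ hit l j -> normc (g i) <= l.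
Proof.
move=> ij /existsPn h; have := h (Ordinal (ij : (i < j.+1)%N)).
by rewrite -leNgt.
Qed.

End hit.

Section stopping.
Context (R : realType) (g : nat -> R[i]).
Variables (M : nat) (l L O : R).
Hypotheses (l0 : 0 <= l) (lL : l < L) (g0 : g 0 = 0).
Hypothesis gO : forall j, (j < M)%N -> normc (g j.+1 - g j) <= O.

(** Both tests involve the path up to index j only, so whether step j is counted is decided before
    the step is made. *)
Definition between j := hit g l j && ~~ hit g L j.

Definition stopped_path j : R[i] := \sum_(i < j) if between i then g i.+1 - g i else 0.

Let S := stopped_path.

Let hit_le j : hit g L j -> hit g l j.
Proof. by move=> /existsP[i hi]; apply/existsP; exists i; exact: lt_trans hi. Qed.

Let grow j : (j < M)%N -> normc (g j.+1) <= normc (g j) + O.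
Proof. by move=> /gO; have := lerB_normc (g j.+1) (g j); lra. Qed.

(* The path of S: 0 until |g| exceeds l, then an increment of g, frozen as soon
   as |g| exceeds L. *)
Let invariant j : (j <= M)%N ->
  (~~ hit g l j -> S j = 0) /\
  (hit g l j -> exists s t, [/\ (s <= j)%N, (t <= j)%N, S j = g t - g s,
    normc (g s) <= l + O & if hit g L j then L < normc (g t) <= L + O else t == j]).
Proof.
elim: j => [_|j ih jM].
  split=> [_|h0]; first by rewrite /S /stopped_path big_ord0.
  by move: h0; rewrite hit0 g0 normc0 ltNge l0.
have [ih1 ih2] := ih (ltnW jM); have gj := grow jM.
have SE : S j.+1 = S j + if between j then g j.+1 - g j else 0.
  by rewrite /S /stopped_path big_ord_recr.
rewrite hitS; case: (boolP (hit g l j)) => hl /=; last first.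
  have /negbTE Lj : ~~ hit g L j by apply: contra hl; exact: hit_le.
  have S0 : S j.+1 = 0 by rewrite SE ih1// /between (negbTE hl) addr0.
  split=> // hj; exists j.+1, j.+1; rewrite S0 subrr; split=> //.
    by have := hitN (leqnn j) hl; lra.
  rewrite hitS Lj /=; case: ifP => // ->; have := hitN (leqnn j) hl.
  by move: lL; lra.
split=> // _; have [s [t [sj tj St gs gt]]] := ih2 hl.
move: gt; case: (boolP (hit g L j)) => hL gt.
  exists s, t; split; [exact: leqW|exact: leqW| |exact: gs|by rewrite hitS hL].
  by rewrite SE /between hL andbF addr0.
exists s, j.+1; split; [exact: leqW|exact: leqnn| |exact: gs|].
  by rewrite SE /between hl hL St (eqP gt) addrC addrA subrK.
rewrite hitS (negbTE hL) /=; case: ifP => // ->.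
by have := hitN (leqnn j) hL; lra.
Qed.

Let O0 : (0 < M)%N -> 0 <= O.
Proof. by move=> /gO; apply: le_trans; exact: normc_ge0. Qed.

Lemma stopped_path_lower : hit g L M -> L - l <= normc (S M) + O.
Proof.
move=> hL; have [_ /(_ (hit_le hL))[s [t [_ _ -> gs]]]] := invariant (leqnn M).
by rewrite hL => /andP[gt _]; have := lerB_normc (g t) (g s); lra.
Qed.

Lemma stopped_path_sq_lower :
  (L - l) ^+ 2 * (hit g L M)%:R <= 2 * normc (S M) ^+ 2 + 2 * O ^+ 2.
Proof.
have [/stopped_path_lower hL|_] := boolP (hit g L M); last first.
  by rewrite mulr0 addr_ge0// mulr_ge0// sqr_ge0.
have : 0 < L - l by rewrite subr_gt0.
by rewrite mulr1; have := sqr_ge0 (normc (S M) - O); move: hL; nra.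
Qed.

(** If l is not exceeded, S = 0. If the real part of g exceeds x/2 in modulus, then |S| <= 2 (L + O)
    and 4 (L + O)^2 <= 8 L^2 + 8 O^2. Otherwise Re S is a difference of two numbers of modulus at
    most x/2. *)
Lemma stopped_path_sq_Re x : 0 <= x ->
  complex.Re (S M) ^+ 2 <= x ^+ 2 * (hit g l M)%:R +
    8 * L ^+ 2 * (hit (fun i => (complex.Re (g i))%:C) (x / 2) M)%:R + 8 * O ^+ 2.
Proof.
move=> x0; have [S0 S1] := invariant (leqnn M).
have [hl|/S0 ->] := boolP (hit g l M); last first.
  by rewrite expr0n /= mulr0 add0r addr_ge0// mulr_ge0 ?ler0n ?sqr_ge0// mulr_ge0 ?sqr_ge0.
have [s [t [sM tM SE gs gt]]] := S1 hl.
have [_|hx] := boolP (hit (fun i => (complex.Re (g i))%:C) (x / 2) M).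
  have : complex.Re (S M) ^+ 2 <= normc (S M) ^+ 2 by rewrite normc_sq lerDl sqr_ge0.
  have : normc (S M) <= 2 * (L + O).
    have : normc (g t) <= L + O.
      move: gt; case: (boolP (hit g L M)) => [_ /andP[]//|hL /eqP ->].
      apply: (le_trans (hitN (leqnn M) hL)); rewrite lerDl; apply: O0.
      by case: M hl => //; rewrite hit0 g0 normc0 ltNge l0.
    by have := ler_normcD (g t) (- g s); rewrite SE ncN; move: lL; lra.
  have := normc_ge0 (S M); have := sqr_ge0 (L - O); have := sqr_ge0 x.
  by rewrite !mulr1; nra.
have h i : (i <= M)%N -> `|complex.Re (g i)| <= x / 2.
  by move=> iM; have := hitN iM hx; rewrite normc_real.
have : `|complex.Re (S M)| <= x.
  rewrite SE ReD ReN; have := h _ sM; have := h _ tM.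
  by have := ler_normB (complex.Re (g t)) (complex.Re (g s)); lra.
rewrite -real_normK ?num_real//; have := normr_ge0 (complex.Re (S M)).
by have := sqr_ge0 O; rewrite mulr0 mulr1; nra.
Qed.

End stopping.

(** * The discretized walk *)

Section brownian_increment.
Context d (Omega : measurableType d) (R : realType) (P : probability Omega R).
Variables (N : nat) (B : 'I_N -> R -> Omega -> R[i]).
Hypothesis bmB : independent_complex_bm P B.

Section increment.
Variables (n : 'I_N) (t t' : R).
Hypotheses (t0 : 0 <= t) (tt' : t < t').

Let X w : R := complex.Re (B n t' w) - complex.Re (B n t w).
Let Y w : R := complex.Im (B n t' w) - complex.Im (B n t w).

Let XY : (fun w => B n t' w - B n t w) = (fun w => X w +i* Y w).
Proof. by apply/funext => w; apply: complexP; rewrite ?(ReD, ImD, ReN, ImN). Qed.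

Let s0 : 0 < Num.sqrt (t' - t).
Proof. by rewrite sqrtr_gt0 subr_gt0. Qed.

Let cmB s : 0 <= s -> cmeasurable (B n s). Proof. exact: (cmeasurable_bm bmB). Qed.

Let mX : measurable_fun setT X.
Proof.
have [m _] := cmB t0; have [m' _] := cmB (le_trans t0 (ltW tt')).
exact: measurable_funB.
Qed.

Let mY : measurable_fun setT Y.
Proof.
have [_ m] := cmB t0; have [_ m'] := cmB (le_trans t0 (ltW tt')).
exact: measurable_funB.
Qed.

Let law A : measurable A ->
  P (X @^-1` A) = normal_prob 0 (Num.sqrt (t' - t)) A /\
  P (Y @^-1` A) = normal_prob 0 (Num.sqrt (t' - t)) A.
Proof. exact: (bm_increment_law bmB). Qed.

Let lawX A (mA : measurable A) := (law mA).1.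
Let lawY A (mA : measurable A) := (law mA).2.

Let indXY A C : measurable A -> measurable C ->
  P (X @^-1` A `&` Y @^-1` C) = (P (X @^-1` A) * P (Y @^-1` C))%E.
Proof. exact: (bm_increment_indep bmB). Qed.

Lemma bm_increment_moments : moments P (fun w => B n t' w - B n t w).
Proof. by rewrite XY; exact: (moments_complex_gaussian s0 mX mY lawX lawY). Qed.

Lemma bm_increment_cexp l : cexp P (fun w => (B n t' w - B n t w) ^+ l.+1) = 0.
Proof.
rewrite (_ : (fun _ => _) = (fun w => (X w +i* Y w) ^+ l.+1)).
  exact: (cexp_complex_gaussian s0 mX mY lawX lawY indXY).
by apply/funext => w; rewrite -[_ +i* _]/((fun w => X w +i* Y w) w) -XY.
Qed.

Lemma bm_increment_norm q :
  (\int[P]_w (normc (B n t' w - B n t w) ^+ (2 * q))%:E <=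
     (2 ^+ q.+1 * (odd_fact q)%:R * (t' - t) ^+ q)%:E)%E.
Proof.
have ts : 0 <= t' - t by rewrite subr_ge0 ltW.
rewrite -(sqr_sqrtr ts).
rewrite (_ : (fun w => _) = (fun w => (normc (X w +i* Y w) ^+ (2 * q))%:E)).
  exact: (normc_complex_gaussian s0 mX mY lawX lawY).
by apply/funext => w; rewrite -[_ +i* _]/((fun w => X w +i* Y w) w) -XY.
Qed.

End increment.

Lemma bm_moments n t : 0 <= t -> moments P (B n t).
Proof.
rewrite le_eqVlt => /predU1P[<-|t0].
  by rewrite (_ : B n 0 = fun=> 0); [exact: moments_cst|apply/funext => w; exact: (bm_at0 bmB)].
rewrite (_ : B n t = fun w => B n t w - B n 0 w); first exact: bm_increment_moments.
by apply/funext => w; rewrite (bm_at0 bmB) subr0.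
Qed.

Lemma bm_past_cmeasurable (n i : 'I_N) (t s : R) : 0 <= s ->
  (i < n)%N \/ i = n /\ s <= t ->
  @cmeasurable _ (g_sigma_algebraType (bm_past B n t)) R (B i s).
Proof.
move=> s0 [iq|[-> st]].
  apply/cmeasurableP => _ C mC; rewrite setTI; apply: sub_gen_smallest; left.
  by exists i => //; apply: sub_gen_smallest; exists s => //; exists C.
split=> _ C mC; rewrite setTI; apply: sub_gen_smallest; right; [left|right];
  by exists s; rewrite ?s0//; exists C.
Qed.

Variables (h : R) (K : nat).
Hypothesis h0 : 0 < h.

Let mG (n : 'I_N) (t : R) : <<s bm_past B n t >> `<=` measurable.
Proof. by move=> A; exact: (bm_past_measurable bmB). Qed.

Lemma past_alive (n i : 'I_N) (t s : R) : 0 <= t -> 0 <= s ->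
  (i < n)%N \/ i = n /\ s <= t ->
  <<s bm_past B n t >> [set w | (s%:E < exit_time (B i) w)%E].
Proof.
move=> t0 s0 its; apply: (bm_before_exit bmB s0) => u /andP[u0 us].
apply: bm_past_cmeasurable => //; case: its => [|[-> st]]; [by left|right].
by split=> //; exact: le_trans st.
Qed.

Lemma past_stopped_sum (n i : 'I_N) (t : R) k : 0 <= t ->
  (i < n)%N \/ i = n /\ k%:R * h <= t ->
  past_fun P (bm_past B n t) (fun w => stopped_sum (B i) w h k).
Proof.
move=> t0 ink; apply: past_fun_sum => -[j jk] /=.
have jh : (i < n)%N \/ i = n /\ j.+1%:R * h <= t.
  case: ink => [|[-> kt]]; [by left|right; split=> //; apply: le_trans kt].
  by rewrite ler_wpM2r ?ler_nat// ltW.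
have jh' : (i < n)%N \/ i = n /\ j%:R * h <= t.
  case: jh => [|[-> kt]]; [by left|right; split=> //; apply: le_trans kt].
  by rewrite ler_wpM2r ?ler_nat// ltW.
have p0 m : 0 <= m%:R * h by rewrite mulr_ge0// ltW.
apply: past_fun_if; [exact: mG|exact: past_alive|].
apply: past_funD; last apply: past_funN.
  by split; [exact: bm_past_cmeasurable|exact: bm_moments].
by split; [exact: bm_past_cmeasurable|exact: bm_moments].
Qed.

Lemma cmeasurable_stopped_sum l k : cmeasurable (fun w => stopped_sum (B l) w h k).
Proof.
have t0 i : 0 <= i%:R * h by rewrite mulr_ge0// ltW.
apply: cmeasurable_sum => i; apply: cmeasurable_if; last exact: cmeasurable_cst.
  apply: (measurable_fun_bool true); rewrite setTI.
  exact: (measurable_bm_before_exit bmB).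
by apply: cmeasurableD; last apply: cmeasurableN; exact: (cmeasurable_bm bmB).
Qed.

(* Step j = n K + k of the walk (k <= K): the coordinates before n have run
   through K steps, stopped at the exit from the disc, the coordinate n through
   k steps, and the following ones are still 0. *)
Definition dwalk (j : nat) (w : Omega) : N.-tuple R[i] :=
  [tuple stopped_sum (B i) w h (minn K (j - i * K)) | i < N].

(** The truncated subtraction gives 0 for the coordinates after n, and the minimum with K freezes
    those before n; at k = K the position is also step 0 of the next coordinate. *)
Lemma dwalk_index (n l : 'I_N) k : (k <= K)%N ->
  minn K (n * K + k - l * K) = if (l < n)%N then K else if l == n then k else 0%N.
Proof.
move=> kK; case: ltnP => ln; first by have := leq_mul ln (leqnn K); rewrite mulSn; lia.
have [->|nl] := eqVneq l n; first by lia.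
have nl' : (n < l)%N by rewrite ltn_neqAle ln andbT eq_sym.
by have := leq_mul nl' (leqnn K); rewrite mulSn; lia.
Qed.

Lemma tnth_dwalk (n l : 'I_N) k w : (k <= K)%N -> tnth (dwalk (n * K + k) w) l =
  stopped_sum (B l) w h (if (l < n)%N then K else if l == n then k else 0%N).
Proof. by move=> kK; rewrite tnth_mktuple dwalk_index. Qed.

Lemma past_dwalk (n l : 'I_N) k i : (k <= K)%N -> (i <= n * K + k)%N ->
  past_fun P (bm_past B n (k%:R * h)) (fun w => tnth (dwalk i w) l).
Proof.
move=> kK ij; have kh : 0 <= k%:R * h by rewrite mulr_ge0// ltW.
under eq_fun do rewrite tnth_mktuple.
have : (minn K (i - l * K) <= if (l < n)%N then K else if l == n then k else 0)%N.
  by rewrite -dwalk_index// leq_min geq_minl /= geq_min leq_sub2r ?orbT.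
case: ltnP => ln mK; first by apply: past_stopped_sum => //; left.
move: mK; have [->|nl] := eqVneq l n => mK.
  by apply: past_stopped_sum => //; right; rewrite ler_wpM2r ?ler_nat// ltW.
move: mK; rewrite leqn0 => /eqP ->; rewrite /stopped_sum.
by under eq_fun do rewrite big_ord0; exact: past_fun_cst.
Qed.

Lemma past_zpow (G : set (set Omega)) p X : past_fun P G X ->
  past_fun P G (fun w => zpow p (X w)).
Proof.
by move=> pX; case: p => p; rewrite /zpow; apply: past_funX => //; exact: past_funJ.
Qed.

Lemma past_trig_eval (G : set (set Omega)) (a : coefs R N) (Z : Omega -> N.-tuple R[i]) :
  is_trig_poly a -> (forall l, past_fun P G (fun w => tnth (Z w) l)) ->
  past_fun P G (fun w => trig_eval a (Z w)).
Proof.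
move=> ta pZ; under eq_fun do rewrite trig_eval_support//.
apply: past_fun_sum => k; apply: past_funM; first exact: past_fun_cst.
by apply: past_fun_prod => l; exact: past_zpow.
Qed.

(* One step moves only the coordinate n, in which the polynomial, restricted to
   the points whose later coordinates vanish, is holomorphic. *)
Lemma null_dwalk (a : coefs R N) (n : 'I_N) k : is_trig_poly a ->
  (forall k (n : 'I_N), a k != 0 -> (forall i : 'I_N, (n < i)%N -> k i = 0) -> 0 <= k n) ->
  (k < K)%N ->
  null_poly P (bm_past B n (k%:R * h))
    (fun w => B n (k.+1%:R * h) w - B n (k%:R * h) w)
    (fun w => trig_eval a (dwalk (n * K + k).+1 w) - trig_eval a (dwalk (n * K + k) w)).
Proof.
move=> ta a0 kK; have kh : 0 <= k%:R * h by rewrite mulr_ge0// ltW.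
set xi := (fun w => B n _ w - _).
under eq_fun do rewrite !trig_eval_support// -sumrB.
apply: null_poly_sum => p; under eq_fun do rewrite -mulrBr.
have [->|ap] := eqVneq (a p) 0; first by under eq_fun do rewrite mul0r; exact: null_poly0.
apply: null_polyMl; first exact: past_fun_cst.
(* A frequency with a nonzero entry after n contributes nothing before or after the step, as that
   coordinate is still 0. *)
have [/existsP[l /andP[nl pl]]|/existsPn pn] :=
    boolP [exists l : 'I_N, (n < l)%N && (p l != 0)].
  have m0 k' w : (k' <= K)%N -> mono p (dwalk (n * K + k') w) = 0.
    move=> kK'; rewrite /mono (bigD1 l)//= tnth_dwalk// ltnNge ltnW//=.
    rewrite gt_eqF// /stopped_sum big_ord0 zpow_at0 (negbTE pl) mul0r//.
  under eq_fun do rewrite -addnS !m0 ?(ltnW kK)// subrr.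
  exact: null_poly0.
(* All entries after n are now zero, so the entry at n is nonnegative and its factor is a plain
   power of the coordinate. *)
have := a0 _ n ap; case pE : (p n) => [q|q] h'; last first.
  suff : 0 <= Negz q by [].
  apply: h' => i ni; have := pn i; rewrite ni /= => /negPn/eqP //.
pose x w := stopped_sum (B n) w h k.
(* Coordinate n moves from x to x + b xi, where b records that the path has not exited at the start
   of the step. *)
pose b w : R[i] := if ((k%:R * h)%:E < exit_time (B n) w)%E then 1 else 0.
rewrite (_ : (fun _ => _) = (fun w =>
    (\prod_(l < N | l != n) zpow (p l) (tnth (dwalk (n * K + k) w) l)) *
    ((x w + b w * xi w) ^+ q - x w ^+ q))); last first.
  apply/funext => w; rewrite /mono (bigD1 n)//= [X in _ - X](bigD1 n)//= -addnS.
  rewrite [X in _ * X - _](eq_bigr (fun l =>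
      zpow (p l) (tnth (dwalk (n * K + k) w) l))); last first.
    by move=> l /negbTE nl; rewrite !tnth_dwalk ?(ltnW kK)// nl.
  rewrite -mulrBl mulrC !tnth_dwalk ?(ltnW kK)// ltnn eqxx pE; congr (_ * (_ ^+ _ - _)).
  rewrite /stopped_sum big_ord_recr/=; congr (_ + _).
  by rewrite /b; case: ifP; rewrite ?mul1r ?mul0r.
apply: null_polyMl.
  rewrite (_ : (fun _ => _) = (fun w => \prod_(l < N)
      if l != n then zpow (p l) (tnth (dwalk (n * K + k) w) l) else 1)); last first.
    by apply/funext => w; rewrite big_mkcond.
  apply: past_fun_prod => l; case: (l != n); last exact: past_fun_cst.
  by apply: past_zpow; apply: past_dwalk => //; exact: ltnW.
apply: null_poly_pow; first by apply: past_stopped_sum => //; right.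
apply: past_fun_if; [exact: mG| |exact: past_fun_cst].
by apply: past_alive => //; right.
Qed.

End brownian_increment.

Lemma measurable_normc_gt d (T : measurableType d) (R : realType) (X : T -> R[i]) l :
  cmeasurable X -> measurable [set w | l < normc (X w)].
Proof.
move=> /measurable_normc mX; have := mX measurableT _ (@measurable_itv R `]l, +oo[).
by rewrite setTI; congr (_ _); apply/funext => w; rewrite /= in_itv/= andbT.
Qed.

Lemma measurable_hit d (T : measurableType d) (R : realType) (g : nat -> T -> R[i]) l j :
  (forall i, (i <= j)%N -> cmeasurable (g i)) ->
  measurable [set w | hit (fun i => g i w) l j].
Proof.
elim: j => [|j ih] mg.
  rewrite (_ : [set _ | _] = [set w | l < normc (g 0%N w)]); first exact: measurable_normc_gt (mg _ _).
  by apply/funext => w; rewrite /= hit0.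
rewrite (_ : [set _ | _] = [set w | hit (fun i => g i w) l j] `|`
    [set w | l < normc (g j.+1 w)]).
  apply: measurableU; last exact: measurable_normc_gt (mg _ _).
  by apply: ih => i ij; apply: mg; exact: leqW.
by apply/seteqP; split=> w /=; rewrite hitS => /orP.
Qed.

Lemma Rintegral_bool d (T : measurableType d) (R : realType) (P : probability T R)
    (b : T -> bool) : measurable [set w | b w] ->
  P.-integrable setT (fun w => (b w)%:R%:E) /\
  \int[P]_w (b w)%:R = fine (P [set w | b w]).
Proof.
move=> mb; have bE : (fun w => (b w)%:R) = \1_[set w | b w] :> (T -> R).
  apply/funext => w; rewrite indicE; congr (_%:R); congr nat_of_bool.
  by apply/idP/idP; rewrite inE.
rewrite (_ : (fun w => (b w)%:R%:E) = EFin \o \1_[set w | b w]); last by rewrite -bE.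
split; first exact: integrable_indic.
by rewrite bE /Rintegral integral_indic// setIT.
Qed.

(** * The good-lambda inequality for the discrete walk *)

Section discrete_estimate.
Context d (Omega : measurableType d) (R : realType) (P : probability Omega R).
Variables (N : nat) (B : 'I_N -> R -> Omega -> R[i]).
Hypothesis bmB : independent_complex_bm P B.
Variables (h : R) (K : nat).
Hypothesis h0 : 0 < h.
Variable a : coefs R N.
Hypothesis ta : is_trig_poly a.
Hypothesis a_analytic : forall k (n : 'I_N), a k != 0 ->
  (forall i : 'I_N, (n < i)%N -> k i = 0) -> 0 <= k n.
Hypothesis a0 : a 0 = 0.

Let M := (N * K)%N.
Let g j w := trig_eval a (dwalk B h K j w).

Lemma dwalk_step j : (j < M)%N ->
  exists n : 'I_N, exists2 k, (k < K)%N & j = (n * K + k)%N.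
Proof.
move=> jM; have K0 : (0 < K)%N by move: jM; rewrite /M; case: K; rewrite ?muln0.
have nN : (j %/ K < N)%N by rewrite ltn_divLR.
by exists (Ordinal nN), (j %% K)%N; [rewrite ltn_mod|exact: divn_eq].
Qed.

(** The martingale section is indexed by a single counter j = n K + k. Quotient and remainder
    recover n and k, and [insub] makes the quotient an index below N, which succeeds for j < M when
    K > 0. *)
Let past j := if insub (j %/ K)%N is Some n
  then bm_past B (n : 'I_N) ((j %% K)%:R * h) else set0.

Let xi j w := if insub (j %/ K)%N is Some n
  then B (n : 'I_N) ((j %% K).+1%:R * h) w - B n ((j %% K)%:R * h) w else 0.

Let insub_step (n : 'I_N) k : (k < K)%N ->
  insub ((n * K + k) %/ K)%N = Some n /\ ((n * K + k) %% K = k)%N.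
Proof.
move=> kK; rewrite modnMDl modn_small// divnMDl ?(leq_ltn_trans _ kK)//.
by rewrite divn_small// addn0 valK.
Qed.

Let pastE (n : 'I_N) k : (k < K)%N -> past (n * K + k) = bm_past B n (k%:R * h).
Proof. by move=> kK; have [e1 e2] := insub_step n kK; rewrite /past e1 e2. Qed.

Let xiE (n : 'I_N) k : (k < K)%N ->
  xi (n * K + k) = fun w => B n (k.+1%:R * h) w - B n (k%:R * h) w.
Proof. by move=> kK; have [e1 e2] := insub_step n kK; rewrite /xi e1 e2. Qed.

Let time (k : nat) : 0 <= k%:R * h /\ k%:R * h < k.+1%:R * h.
Proof. by rewrite mulr_ge0 ?ltr_pM2r ?ltr_nat// ltW. Qed.

Let past_g i j : (i <= j)%N -> (j < M)%N -> past_fun P (past j) (g i).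
Proof.
move=> ij /dwalk_step[n [k kK jE]]; rewrite jE pastE//.
apply: past_trig_eval => // l; apply: (past_dwalk bmB h0) => //; first exact: ltnW.
by rewrite -jE.
Qed.

Variables (l L x : R) (Rm : Omega -> R).
Hypotheses (l0 : 0 <= l) (lL : l < L) (x0 : 0 <= x).
Hypothesis iR : P.-integrable setT (EFin \o Rm).
Hypothesis gR : forall j w, (j < M)%N -> normc (g j.+1 w - g j w) ^+ 2 <= Rm w.

Let A j w := between (fun i => g i w) l L j.
Let D j w := g j.+1 w - g j w.
Let S w := stopped_mart D A M w.

Let A_past i j : (i <= j)%N -> (j < M)%N -> <<s past j >> [set w | A i w].
Proof.
move=> ij jM; have mh l' : <<s past j >> [set w | hit (fun i => g i w) l' i].
  apply: (@measurable_hit _ (g_sigma_algebraType (past j))) => i' i'i.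
  by have [] := past_g (leq_trans i'i ij) jM.
rewrite (_ : [set w | A i w] = [set w | hit (fun i => g i w) l i] `&`
    ~` [set w | hit (fun i => g i w) L i]).
  apply: (@measurableI _ (g_sigma_algebraType (past j))); first exact: mh.
  by apply: (@measurableC _ (g_sigma_algebraType (past j))); exact: mh.
by apply/seteqP; split=> w /=; [move=> /andP[? /negP ?]|move=> [? /negP ?]; apply/andP].
Qed.

Let mpast j : (j < M)%N -> <<s past j >> `<=` measurable.
Proof.
move=> /dwalk_step[n [k kK ->]]; rewrite pastE// => X.
exact: (bm_past_measurable bmB).
Qed.

Let mart := @stopped_mart_norm _ _ _ P M past xi D A.

Let S_norm :
  [/\ P.-integrable setT (fun w => (normc (S w) ^+ 2)%:E),
      P.-integrable setT (fun w => (complex.Re (S w) ^+ 2)%:E) &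
      \int[P]_w (normc (S w) ^+ 2) = 2 * \int[P]_w (complex.Re (S w) ^+ 2)].
Proof.
apply: mart => [j jM|j jM|j jM|j jM|j jM|j jM|i j ij jM].
- exact: mpast.
- have [n [k kK ->]] := dwalk_step jM; rewrite xiE//.
  by have [t1 t2] := time k; exact: (bm_increment_moments bmB).
- have [n [k kK ->]] := dwalk_step jM; rewrite xiE// pastE//.
  have [t1 t2] := time k; move=> *; exact: (bm_past_indep bmB).
- have [n [k kK ->]] := dwalk_step jM; rewrite xiE//.
  by have [t1 t2] := time k; exact: (bm_increment_cexp bmB).
- have [n [k kK ->]] := dwalk_step jM; rewrite xiE// pastE//.
  exact: (null_dwalk bmB h0).
- exact: A_past.
- apply: past_fun_if; [exact: mpast|exact: A_past (ltnW ij) jM|].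
  by apply: past_funD; [|apply: past_funN]; apply: past_g => //; exact: ltnW.
Qed.

Let g_at0 w : g 0%N w = 0.
Proof.
rewrite /g trig_eval0// => n.
by rewrite tnth_mktuple sub0n minn0 /stopped_sum big_ord0.
Qed.

Let prob l' := fine (P [set w | hit (fun i => g i w) l' M]).

Lemma measurable_dwalk j : measurable_fun setT (dwalk B h K j).
Proof.
apply/measurable_fun_tnthP => n; apply/cmeasurableP; rewrite /comp.
under eq_fun do rewrite tnth_mktuple; exact: (cmeasurable_stopped_sum bmB).
Qed.

Let mg j : cmeasurable (g j).
Proof. exact/cmeasurable_trig_eval/measurable_dwalk. Qed.

Let R0 w : 0 <= (if (0 < M)%N then Rm w else 0).
Proof. by case: ifP => // /(gR w); apply: le_trans; exact: sqr_ge0. Qed.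

(** The two pathwise inequalities are integrated and linked by E|S|^2 = 2 E(Re S)^2: doubling twice
    turns the coefficients 1 and 8 into 4 and 32, and the overshoot collects 4 * 8 + 2 = 34. *)
Lemma discrete_good_lambda : (0 < M)%N ->
  (L - l) ^+ 2 * prob L <= 4 * x ^+ 2 * prob l +
    32 * L ^+ 2 * fine (P [set w | hit (fun i => (complex.Re (g i w))%:C) (x / 2) M]) +
    34 * \int[P]_w Rm w.
Proof.
move=> M0; have [iS iRe ES] := S_norm.
(* The square root of [Rm] plays the part of the pathwise step bound O. *)
have RE w : Num.sqrt (Rm w) ^+ 2 = Rm w by rewrite sqr_sqrtr//; have := R0 w; rewrite M0.
have gO w j : (j < M)%N -> normc (g j.+1 w - g j w) <= Num.sqrt (Rm w).
  by move=> jM; rewrite -[leLHS]ger0_norm ?normc_ge0// -sqrtr_sqr ler_wsqrtr// gR.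
have mh l' : measurable [set w | hit (fun i => g i w) l' M] by exact: measurable_hit.
have mhF : measurable [set w | hit (fun i => (complex.Re (g i w))%:C) (x / 2) M].
  apply: measurable_hit => i iM; split=> /=; last exact: measurable_cst.
  by have [] := mg i.
have [iL EL] := Rintegral_bool P (mh L).
have [il El] := Rintegral_bool P (mh l).
have [iF EF] := Rintegral_bool P mhF.
have iZ r (u : Omega -> R) : P.-integrable setT (EFin \o u) ->
    P.-integrable setT (EFin \o (fun w => r * u w)).
  by move=> iu; have := integrableZl measurableT r iu; apply: eq_integrable.
have iD (u v : Omega -> R) : P.-integrable setT (EFin \o u) ->
    P.-integrable setT (EFin \o v) -> P.-integrable setT (EFin \o (fun w => u w + v w)).
  by move=> iu iv; have := integrableD measurableT iu iv; apply: eq_integrable.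
have h1 : (L - l) ^+ 2 * prob L <=
    2 * \int[P]_w (normc (S w) ^+ 2) + 2 * \int[P]_w Rm w.
  rewrite /prob -EL -RintegralZl// -!RintegralZl// -RintegralD//; last 2 first.
  - exact: iZ.
  - exact: iZ.
  apply: le_Rintegral => //; [exact: iZ|by apply: iD; exact: iZ|move=> w _].
  rewrite -[in leRHS]RE.
  exact: (stopped_path_sq_lower l0 lL (g_at0 w) (gO w)).
have h2 : \int[P]_w (complex.Re (S w) ^+ 2) <= x ^+ 2 * prob l +
    8 * L ^+ 2 * fine (P [set w | hit (fun i => (complex.Re (g i w))%:C) (x / 2) M]) +
    8 * \int[P]_w Rm w.
  have i1 := iZ (x ^+ 2) _ il; have i2 := iZ (8 * L ^+ 2) _ iF; have i3 := iZ 8 _ iR.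
  have i4 := iD _ _ i1 i2; have i5 := iD _ _ i4 i3.
  rewrite /prob -El -EF -!RintegralZl// -!RintegralD//.
  apply: le_Rintegral => //.
  move=> w _; rewrite -[in leRHS]RE.
  exact: (stopped_path_sq_Re l0 lL (g_at0 w) (gO w)).
by move: h1 h2; rewrite ES; lra.
Qed.

End discrete_estimate.

(** * The largest step tends to 0 in mean square *)

Section growth_bound.
Context (R : realType).

(** With y the largest increment, the left side bounds the square of a step of g. A sum of squares
    over all increments would not be small, so y^2 is traded for a fixed small e plus powers of
    order at least six (when D >= 2), whose sums over the increments do tend to 0. *)
Lemma sqr_growth_le (C y e : R) D : 0 <= C -> 0 <= y -> 0 < e ->
  (C * (1 + y) ^+ D * y) ^+ 2 <=
  C ^+ 2 * 4 ^+ D * (e + (y ^+ 6 / e ^+ 2 + y ^+ (2 * D.+1))).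
Proof.
move=> C0 y0 e0; have A0 : 0 <= C ^+ 2 * 4 ^+ D by rewrite mulr_ge0 ?sqr_ge0 ?exprn_ge0.
have e20 : 0 < e ^+ 2 by rewrite exprn_gt0.
have y6 : 0 <= y ^+ 6 / e ^+ 2 by rewrite divr_ge0 ?sqr_ge0// exprn_ge0.
have yD : 0 <= y ^+ (2 * D.+1) by rewrite exprn_ge0.
have [y1|y1] := leP y 1.
  apply: (@le_trans _ _ (C ^+ 2 * 4 ^+ D * y ^+ 2)).
    rewrite !exprMn -!exprM mulnC exprM ler_wpM2r ?sqr_ge0// ler_wpM2l ?sqr_ge0//.
    by rewrite lerXn2r ?nnegrE ?sqr_ge0//; nra.
  (* y^2 <= e + y^6 / e^2 *)
  rewrite ler_wpM2l//; have [ye|ye] := leP (y ^+ 2) e; first lra.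
  suff : y ^+ 2 <= y ^+ 6 / e ^+ 2 by lra.
  rewrite ler_pdivlMr// (_ : 6%N = 2 + 2 * 2)%N// exprD exprM ler_wpM2l ?sqr_ge0//.
  by rewrite lerXn2r ?nnegrE ?sqr_ge0 ?(ltW e0) ?(ltW ye).
apply: (@le_trans _ _ (C ^+ 2 * 4 ^+ D * y ^+ (2 * D.+1))); last first.
  by rewrite ler_wpM2l//; lra.
rewrite !exprMn -!exprM -mulrA -[leRHS]mulrA ler_wpM2l ?sqr_ge0//.
rewrite (_ : y ^+ (2 * D.+1) = y ^+ (2 * D) * y ^+ 2); last first.
  by rewrite -exprD mulnS addnC.
rewrite mulrA; apply: ler_wpM2r; first exact: sqr_ge0.
rewrite mulnC exprM [y ^+ (2 * _)]exprM -exprMn lerXn2r ?nnegrE ?sqr_ge0 ?mulr_ge0 ?sqr_ge0//.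
nra.
Qed.

Lemma bigmax_pow_le (I : finType) (u : I -> R) p : (forall i, 0 <= u i) ->
  (\big[Num.max/0]_i u i) ^+ p.+1 <= \sum_i u i ^+ p.+1.
Proof.
move=> u0; suff [] : 0 <= \big[Num.max/0]_i u i /\
  (\big[Num.max/0]_i u i) ^+ p.+1 <= \sum_i u i ^+ p.+1 by [].
elim/big_ind2 : _ => [|b1 a1 b2 a2 [a10 h1] [a20 h2]|i _]; first by rewrite expr0n.
- split; first by rewrite le_max a10.
  have b10 : 0 <= b1 by apply: le_trans h1; exact: exprn_ge0.
  have b20 : 0 <= b2 by apply: le_trans h2; exact: exprn_ge0.
  by rewrite /Num.max; case: ifP => _; lra.
- by split.
Qed.

End growth_bound.

Section expect_bound.
Context d (T : measurableType d) (R : realType) (P : probability T R).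

Definition expect_le (u : T -> R) (v : R) :=
  P.-integrable setT (EFin \o u) /\ \int[P]_w u w <= v.

Lemma expect_le_cst c : expect_le (fun=> c) c.
Proof.
split; first exact: finite_measure_integrable_cst.
by rewrite Rintegral_cst//= [X in fine X]probability_setT mulr1.
Qed.

Lemma expect_leD u1 v1 u2 v2 : expect_le u1 v1 -> expect_le u2 v2 ->
  expect_le (fun w => u1 w + u2 w) (v1 + v2).
Proof.
move=> [i1 e1] [i2 e2]; split; last by rewrite RintegralD// lerD.
by have := integrableD measurableT i1 i2; apply: eq_integrable.
Qed.

Lemma expect_leZ c u v : 0 <= c -> expect_le u v -> expect_le (fun w => c * u w) (c * v).
Proof.
move=> c0 [i e]; split; last by rewrite RintegralZl// ler_wpM2l.
by have := integrableZl measurableT c i; apply: eq_integrable.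
Qed.

Lemma expect_le_sum (I : finType) (u : I -> T -> R) v : (forall i, expect_le (u i) v) ->
  expect_le (fun w => \sum_i u i w) (#|I|%:R * v).
Proof.
move=> uv; have <- : \sum_(i : I) v = #|I|%:R * v by rewrite sumr_const mulr_natl.
elim: (index_enum I) => [|i r ih].
  by rewrite big_nil; under eq_fun do rewrite big_nil; exact: expect_le_cst.
by rewrite big_cons; under eq_fun do rewrite big_cons; exact: expect_leD.
Qed.

End expect_bound.

Section walk_increments.
Context d (Omega : measurableType d) (R : realType) (P : probability Omega R).
Variables (N : nat) (B : 'I_N -> R -> Omega -> R[i]).
Hypothesis bmB : independent_complex_bm P B.

Definition bm_incr (h : R) K (q : 'I_N * 'I_K) (w : Omega) : R[i] :=
  B q.1 (q.2.+1%:R * h) w - B q.1 (q.2%:R * h) w.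

Definition max_incr (h : R) K (w : Omega) : R :=
  \big[Num.max/0]_(q : 'I_N * 'I_K) normc (bm_incr h q w).

Lemma max_incr_ge0 h K w : 0 <= max_incr h K w.
Proof. exact: bigmax_ge_id. Qed.

Lemma le_max_incr h K w (n : 'I_N) k : (k < K)%N ->
  normc (B n (k.+1%:R * h) w - B n (k%:R * h) w) <= max_incr h K w.
Proof.
move=> kK; exact: (le_bigmax _ (fun q => normc (bm_incr h q w)) (n, Ordinal kK)).
Qed.

(** A step starts inside the unit disc or is not made, so each coordinate overshoots by at most one
    increment. *)
Lemma dwalk_norm h K j l w : 0 < h ->
  normc (tnth (dwalk B h K j w) l) <= 1 + max_incr h K w.
Proof.
move=> h0; rewrite tnth_mktuple.
apply: stopped_sum_le => //; [exact: (bm_at0 bmB)|exact: max_incr_ge0|].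
by move=> i; rewrite leq_min => /andP[iK _]; exact: le_max_incr.
Qed.

Lemma dwalk_diff h K j l w : 0 < h -> (j < N * K)%N ->
  normc (tnth (dwalk B h K j.+1 w) l - tnth (dwalk B h K j w) l) <= max_incr h K w.
Proof.
move=> h0 /dwalk_step[]// n [k kK ->]; rewrite -addnS !tnth_dwalk ?(ltnW kK)//.
case: ifP => _; first by rewrite subrr normc0 max_incr_ge0.
have [->|_] := eqVneq l n; last by rewrite subrr normc0 max_incr_ge0.
rewrite /stopped_sum big_ord_recr/= addrAC subrr add0r.
by case: ifP => _; [exact: le_max_incr|rewrite normc0 max_incr_ge0].
Qed.

Definition gauss_cst q : R := 2 ^+ q.+1 * (odd_fact q)%:R.

Lemma expect_bm_incr h K (q : 'I_N * 'I_K) p : 0 < h ->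
  expect_le P (fun w => normc (bm_incr h q w) ^+ (2 * p)) (gauss_cst p * h ^+ p).
Proof.
move=> h0; have t0 : 0 <= q.2%:R * h by rewrite mulr_ge0// ltW.
have tt' : q.2%:R * h < q.2.+1%:R * h by rewrite ltr_pM2r// ltr_nat.
have [_ /(_ (2 * p)%N) im] := bm_increment_moments bmB q.1 t0 tt'.
have := bm_increment_norm bmB q.1 t0 tt' p.
rewrite -mulrBl -natrB// subSnn mul1r => le; split=> //.
rewrite -lee_fin /Rintegral fineK; first exact: le.
by apply: integrable_fin_num.
Qed.

(* (m+1)^2 steps of length 1/(m+1) cover [0, m+1], and the sum of the sixth
   moments of the increments still tends to 0. *)
Definition mesh (m : nat) : R := m.+1%:R^-1.
Definition steps (m : nat) : nat := (m.+1 ^ 2)%N.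

Lemma mesh_gt0 m : 0 < mesh m. Proof. by rewrite invr_gt0. Qed.

(** The moment of order 2p of an increment over time h is of order h^p, so p > 2 means sixth moments
    and higher. *)
Lemma steps_mesh m p : (2 < p)%N -> (steps m)%:R * mesh m ^+ p <= mesh m.
Proof.
case: p => [|[|[|p]]]// _; rewrite /steps /mesh natrX -addn3 addnC exprD.
rewrite (_ : 3 = 2 + 1)%N// [_ ^+ (2 + 1)]exprD mulrA mulrA -exprMn mulfV ?pnatr_eq0//.
rewrite expr1n mul1r expr1 ler_piMr ?invr_ge0// exprn_ile1 ?invr_ge0//.
by rewrite invf_le1 ?ltr0n// ler1n.
Qed.

Variable a : coefs R N.
Hypothesis ta : is_trig_poly a.

Let g m j w := trig_eval a (dwalk B (mesh m) (steps m) j w).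

(** The maximum of the increments is raised to a power and replaced by the sum of these powers,
    whose expectation is computable; independence of the increments is not involved at this
    point. *)
Lemma small_increments (eps : R) : 0 < eps -> exists m0, forall m, (m0 <= m)%N ->
  exists2 Rm : Omega -> R, expect_le P Rm eps &
    forall j w, (j < N * steps m)%N -> normc (g m j.+1 w - g m j w) ^+ 2 <= Rm w.
Proof.
move=> eps0; have [C [D' [C0 hg]]] := poly_growth_trig_eval ta.
(* The shift by 2 makes D + 1 at least 3, as [steps_mesh] demands. The larger exponent is harmless
   because the radius is at least 1. *)
pose D := D'.+2; pose A := C ^+ 2 * 4 ^+ D.
have A0 : 0 <= A by rewrite mulr_ge0 ?sqr_ge0 ?exprn_ge0.
have A1 : 0 < A + 1 by rewrite ltr_wpDl.
(* Half of eps is spent on A e, the other half on A Q h, where Q h bounds the expectation of the sum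
   over all increments. *)
pose e := eps / (2 * (A + 1)); have e0 : 0 < e by rewrite divr_gt0// mulr_gt0.
pose Q := N%:R * (gauss_cst 3 / e ^+ 2 + gauss_cst D.+1).
have c0 p : 0 <= gauss_cst p by rewrite mulr_ge0 ?exprn_ge0.
have Q0 : 0 <= Q by rewrite mulr_ge0// addr_ge0// divr_ge0// sqr_ge0.
have Q1 : 0 < 2 * (A + 1) * (Q + 1) by rewrite !mulr_gt0// ltr_wpDl.
have [m0] := ltr_add_invr (divr_gt0 eps0 Q1); rewrite add0r => hm0.
exists m0 => m m0m; set h := mesh m; set K := steps m.
have h0 : 0 < h by exact: mesh_gt0.
pose u w (q : 'I_N * 'I_K) := normc (bm_incr h q w).
exists (fun w => A * (e + \sum_q (u w q ^+ 6 / e ^+ 2 + u w q ^+ (2 * D.+1)))).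
  have : expect_le P (fun w => A * (e + \sum_q (u w q ^+ 6 / e ^+ 2 + u w q ^+ (2 * D.+1))))
      (A * (e + #|{: 'I_N * 'I_K}|%:R *
        (e ^- 2 * (gauss_cst 3 * h ^+ 3) + gauss_cst D.+1 * h ^+ D.+1))).
    apply: expect_leZ => //; apply: expect_leD; first exact: expect_le_cst.
    apply: (@expect_le_sum _ _ _ _ _ (fun q w => u w q ^+ 6 / e ^+ 2 + u w q ^+ (2 * D.+1))) => q.
    apply: expect_leD; last exact: expect_bm_incr.
    under eq_fun do rewrite mulrC.
    by apply: expect_leZ; [rewrite invr_ge0 sqr_ge0|exact: (expect_bm_incr q 3)].
  move=> [iu eu]; split=> //; apply: (le_trans eu).
  rewrite card_prod !card_ord natrM -mulrA.
  have K3 := @steps_mesh m 3 isT; have KD := @steps_mesh m D.+1 isT.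
  apply: (@le_trans _ _ (A * (e + Q * h))).
    rewrite ler_wpM2l// lerD2l /Q -mulrA ler_wpM2l// mulrDl mulrDr lerD//.
      by rewrite [leLHS](_ : _ = gauss_cst 3 / e ^+ 2 * (K%:R * h ^+ 3));
        [rewrite ler_wpM2l// divr_ge0// sqr_ge0|ring].
    by rewrite mulrCA ler_wpM2l.
  have hle : h < eps / (2 * (A + 1) * (Q + 1)).
    by apply: le_lt_trans hm0; rewrite lef_pV2 ?posrE// ler_nat ltnS.
  move: hle; rewrite ltr_pdivlMr ?mulr_gt0// ?ltr_wpDl// => hle.
  have eE : 2 * (A + 1) * e = eps by rewrite /e mulrC divfK// gt_eqF// mulr_gt0.
  have p1 : 0 <= Q * h by rewrite mulr_ge0// ltW.
  have p2 : 0 <= A * h by rewrite mulr_ge0// ltW.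
  have p3 : 0 <= A * (Q * h) by rewrite mulr_ge0.
  nra.
move=> j w jM.
have [r1 X0] : 1 <= 1 + max_incr h K w /\ 0 <= max_incr h K w.
  by have := max_incr_ge0 h K w; split=> //; lra.
have [_ gd] := hg _ _ (dwalk B h K j.+1 w) (dwalk B h K j w) r1 X0
  (fun n => dwalk_norm _ _ _ _ h0) (fun n => dwalk_norm _ _ _ _ h0)
  (fun n => dwalk_diff _ _ h0 jM).
apply: (@le_trans _ _ ((C * (1 + max_incr h K w) ^+ D * max_incr h K w) ^+ 2)).
  have r0 : 0 <= 1 + max_incr h K w by apply: le_trans r1; exact: ler01.
  have b0 E : 0 <= C * (1 + max_incr h K w) ^+ E * max_incr h K w.
    by rewrite mulr_ge0// mulr_ge0// exprn_ge0.
  apply: lerXn2r; rewrite ?nnegrE ?normc_ge0 ?b0//.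
  apply: (le_trans gd); apply: ler_wpM2r => //; apply: ler_wpM2l => //.
  by apply: ler_weXn2l => //; rewrite /D -addn2 leq_addr.
apply: (le_trans (sqr_growth_le D C0 X0 e0)); rewrite ler_wpM2l// lerD2l big_split/=.
rewrite lerD// ?bigmax_pow_le// -?mulr_suml ?ler_wpM2r ?invr_ge0 ?sqr_ge0//.
  by apply: bigmax_pow_le => q; exact: normc_ge0.
by move=> q; exact: normc_ge0.
Qed.

End walk_increments.

(** * Passage to the limit *)

Definition eventually (Q : nat -> Prop) := exists m0, forall m, (m0 <= m)%N -> Q m.

Lemma eventually_and (Q1 Q2 : nat -> Prop) :
  eventually Q1 -> eventually Q2 -> eventually (fun m => Q1 m /\ Q2 m).
Proof.
move=> [m1 h1] [m2 h2]; exists (maxn m1 m2) => m; rewrite geq_max => /andP[? ?].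
by split; [exact: h1|exact: h2].
Qed.

Lemma eventually_forall (I : finType) (Q : I -> nat -> Prop) :
  (forall i, eventually (Q i)) -> eventually (fun m => forall i, Q i m).
Proof.
move=> /choice[f hf]; exists (\max_i f i) => m fm i; apply: hf.
by apply: leq_trans fm; exact: leq_bigmax.
Qed.

Section eventually_prob.
Context d (T : measurableType d) (R : realType) (P : probability T R).

(** Up to a null set, A lies in the increasing union of the sets of points that belong to F m for
    all m >= n; continuity from below does the rest. *)
Lemma eventually_prob_le (A N0 : set T) (F : nat -> set T) :
  measurable A -> measurable N0 -> (forall m, measurable (F m)) -> P N0 = 0 ->
  (forall w, ~ N0 w -> A w -> eventually (fun m => F m w)) ->
  forall e : R, 0 < e -> eventually (fun m => fine (P A) <= fine (P (F m)) + e).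
Proof.
move=> mA mN mF N00 AF e e0.
pose E n := \bigcap_(m in [set m | (n <= m)%N]) F m.
have mE n : measurable (E n) by apply: bigcap_measurableType.
have mU : measurable (\bigcup_n E n) by exact: bigcupT_measurable.
have homoE : {homo E : n m / (n <= m)%N >-> (n <= m)%O}.
  move=> n m nm; apply/subsetPset => w En k /= mk; apply: En.
  exact: leq_trans mk.
have fin X : measurable X -> P X \is a fin_num by move=> mX; exact: fin_num_measure.
have cE : (P \o E) n @[n --> \oo] --> (fine (P (\bigcup_n E n)))%:E.
  by rewrite fineK ?fin//; exact: (nondecreasing_cvg_mu (mu := P) mE mU homoE).
have cF : (fine \o (P \o E)) n @[n --> \oo] --> fine (P (\bigcup_n E n)).
  exact: fine_cvg cE.
have /cvgrPdist_lt/(_ e e0)[n _ /(_ n (leqnn n)) /=] := cF.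
rewrite ltr_norml => /andP[_ hn].
have leU : (P A <= P (\bigcup_n E n))%E.
  rewrite -(measureU0 (mu := P) mU mN N00); apply: le_measure; rewrite ?inE//.
    exact: measurableU.
  move=> w Aw; have [Nw|/AF/(_ Aw)[m0 hm]] := pselect (N0 w); first by right.
  by left; exists m0 => // m /= m0m; exact: hm.
exists n => m nm.
have leF : (P (E n) <= P (F m))%E by apply: le_measure; rewrite ?inE// => w; exact.
rewrite -(fineK (fin _ mU)) -(fineK (fin _ mA)) lee_fin in leU.
rewrite -(fineK (fin _ (mE n))) -(fineK (fin _ (mF m))) lee_fin in leF.
by move: hn; rewrite /comp; lra.
Qed.

Lemma eventually_prob_ge (A N0 : set T) (F : nat -> set T) :
  measurable A -> measurable N0 -> (forall m, measurable (F m)) -> P N0 = 0 ->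
  (forall w, ~ N0 w -> ~ A w -> eventually (fun m => ~ F m w)) ->
  forall e : R, 0 < e -> eventually (fun m => fine (P (F m)) <= fine (P A) + e).
Proof.
move=> mA mN mF N00 AF e e0.
have fin X : measurable X -> P X \is a fin_num by move=> mX; exact: fin_num_measure.
have fC X : measurable X -> fine (P (~` X)) = 1 - fine (P X).
  by move=> mX; rewrite probability_setC// -(fineK (fin _ mX)).
have [m0 hm] := @eventually_prob_le (~` A) N0 (fun m => ~` F m) (measurableC mA) mN
  (fun m => measurableC (mF m)) N00 AF e e0.
by exists m0 => m /hm; rewrite !fC//; lra.
Qed.

End eventually_prob.

Section convergence.
Context d (Omega : measurableType d) (R : realType) (P : probability Omega R).
Variables (N : nat) (B : 'I_N -> R -> Omega -> R[i]).
Hypothesis bmB : independent_complex_bm P B.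

Local Notation mesh := (@mesh R).

(* Agrees with c_0 = 0 when the path does not exit. *)
Definition exit_approx m (l : 'I_N) (w : Omega) : R[i] :=
  if (exit_time (B l) w < +oo)%E then stopped_sum (B l) w (mesh m) (steps m) else 0.

Definition walk_approx m (n : 'I_N) (k : nat) (w : Omega) : N.-tuple R[i] :=
  [tuple if (l < n)%N then exit_approx m l w
         else if l == n then stopped_sum (B l) w (mesh m) k else 0 | l < N].

Definition walk_end_approx m (w : Omega) : N.-tuple R[i] :=
  [tuple exit_approx m l w | l < N].

Let c0 l w : B l 0 w = 0. Proof. exact: (bm_at0 bmB). Qed.

Let cc l w (t e : R) : 0 <= t -> 0 < e -> exists2 del : R, 0 < del &
  forall s : R, 0 <= s -> `|s - t| < del -> normc (B l s w - B l t w) < e.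
Proof. exact: (bm_continuous bmB). Qed.

Lemma eventually_mesh (e : R) : 0 < e -> eventually (fun m => mesh m < e).
Proof.
move=> e0; have [m0] := ltr_add_invr e0; rewrite add0r => h; exists m0 => m m0m.
by apply: le_lt_trans h; rewrite lef_pV2 ?posrE// ler_nat ltnS.
Qed.

Lemma eventually_ge (r : R) : eventually (fun m => r <= m.+1%:R).
Proof.
exists (Num.truncn r).+1 => m; rewrite -(ler_nat R) => h.
apply/ltW/(lt_le_trans (real_truncnS_gt (num_real r))).
by apply: (le_trans h); rewrite ler_nat.
Qed.

Lemma steps_meshE m : (steps m)%:R * mesh m = m.+1%:R.
Proof. by rewrite /steps /mesh natrX expr2 -mulrA mulfV ?mulr1// pnatr_eq0. Qed.

Lemma eventually_coord w (e : R) : 0 < e -> eventually (fun m => forall l : 'I_N,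
  normc (exit_approx m l w - exit_point (B l) w) < e /\
  forall k, normc (stopped_sum (B l) w (mesh m) k - stopped (B l) (k%:R * mesh m) w) < e).
Proof.
move=> e0; apply: eventually_forall => l.
have [del del0 hd] := stopped_sum_close (c0 l w) (@cc l w) e0.
have [m1 h1] := eventually_mesh del0.
(* The [steps m] steps cover the time m + 1, by which the exit has then occurred. *)
have [m2 h2] := eventually_ge (fine (exit_time (B l) w)).
exists (maxn m1 m2) => m; rewrite geq_max => /andP[/h1 m1m /h2 m2m].
have hk k := hd _ k (mesh_gt0 R m) m1m; split=> //; rewrite /exit_approx.
case: ifP => [Tf|/negbT]; last first.
  rewrite -leNgt leye_eq => /eqP T; rewrite /exit_point T /= c0 subrr normc0 //.
have := hk (steps m); rewrite stopped_ge// steps_meshE.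
have Tfin : exit_time (B l) w \is a fin_num by rewrite ge0_fin_numE// exit_time_ge0.
by rewrite -(fineK Tfin) lee_fin.
Qed.

Lemma normc_walk_le1 n t w l : 0 <= t -> normc (tnth (walk B n t w) l) <= 1.
Proof.
move=> t0; rewrite tnth_mktuple; case: ifP => _.
  exact: normc_exit_point_le1 (c0 l w) (@cc l w).
case: eqP => [_|_]; last by rewrite normc0.
exact: (normc_stopped_le1 (c0 n w) (@cc n w)).
Qed.

Lemma normc_walk_end_le1 w l : normc (tnth (walk_end B w) l) <= 1.
Proof. by rewrite tnth_mktuple; exact: normc_exit_point_le1 (c0 l w) (@cc l w). Qed.

Variable a : coefs R N.
Hypothesis ta : is_trig_poly a.

Lemma trig_eval_close (e : R) : 0 < e -> exists2 del : R, 0 < del &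
  forall z z' : N.-tuple R[i], (forall l, normc (tnth z l) <= 1) ->
  (forall l, normc (tnth z' l - tnth z l) < del) ->
  normc (trig_eval a z' - trig_eval a z) < e.
Proof.
move=> e0; have [C [D [C0 hg]]] := poly_growth_trig_eval ta.
have A0 : 0 <= C * 2 ^+ D by rewrite mulr_ge0// exprn_ge0.
have A1 : 0 < C * 2 ^+ D + 1 by rewrite ltr_wpDl.
pose del := Num.min 1 (e / (C * 2 ^+ D + 1)).
have del0 : 0 < del by rewrite lt_min ltr01 divr_gt0.
exists del => // z z' z1 zz'.
have d1 : del <= 1 by rewrite ge_min lexx.
have d2 : del <= e / (C * 2 ^+ D + 1) by rewrite ge_min lexx orbT.
have z2 l : normc (tnth z l) <= 2 by have := z1 l; lra.
have z'2 l : normc (tnth z' l) <= 2.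
  by have := zz' l; have := lerB_normc (tnth z' l) (tnth z l); have := z1 l; lra.
have [_ h] := hg 2 del z' z (ler1n R 2) (ltW del0) z'2 z2 (fun l => ltW (zz' l)).
apply: (le_lt_trans h); move: d2; rewrite ler_pdivlMr//; nra.
Qed.

Lemma eventually_trig_eval w (e : R) : 0 < e -> eventually (fun m =>
  (forall n k, normc (trig_eval a (walk_approx m n k w) -
                      trig_eval a (walk B n (k%:R * mesh m) w)) < e) /\
  normc (trig_eval a (walk_end_approx m w) - trig_eval a (walk_end B w)) < e).
Proof.
move=> e0; have [del del0 hd] := trig_eval_close e0.
have [m0 hm] := eventually_coord w del0; exists m0 => m /hm{hm} hm; split=> [n k|].
  apply: hd => l; first by apply: normc_walk_le1; rewrite mulr_ge0// ltW// mesh_gt0.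
  have [h1 h2] := hm l; rewrite !tnth_mktuple; case: ifP => _ //.
  by case: eqP => [<-//|_]; rewrite subrr normc0.
apply: hd => l; first exact: normc_walk_end_le1.
by have [h1 h2] := hm l; rewrite !tnth_mktuple.
Qed.

(** A grid version of the event that the Brownian maximum exceeds L, built from approximations that
    converge at every point of Omega, including those whose path never exits; [hit] along [dwalk] is
    the same event off a null set only. *)
Definition hit_approx m (L : R) : set Omega :=
  [set w | (exists n : 'I_N, exists2 k, (k <= steps m)%N &
              L < normc (trig_eval a (walk_approx m n k w))) \/
           L < normc (trig_eval a (walk_end_approx m w))].

Lemma normc_gt_near (u v z : R[i]) (L : R) : normc (v - u) < (normc u - L) / 2 ->
  normc (z - v) < (normc u - L) / 2 -> L < normc z.
Proof.
have := lerB_normc u v; have := lerB_normc v z; rewrite (ncB u) (ncB v z).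
by move: (normc (v - u)) (normc (z - v)) => p q; lra.
Qed.

(** Some value of the walk exceeds L with room to spare. Half of the room pays for moving its time
    to the next grid time, the other half for replacing the path by its grid approximation. *)
Lemma eventually_hit w (L : R) : (L%:E < brownian_max B a w)%E ->
  eventually (fun m => hit_approx m L w).
Proof.
move=> /ereal_sup_gt[_ [[n [t t0 ->]]|->]]; rewrite lte_fin => hL; last first.
  have e0 : 0 < (normc (trig_eval a (walk_end B w)) - L) / 2.
    by rewrite divr_gt0// subr_gt0.
  have [m0 hm] := eventually_trig_eval w e0; exists m0 => m /hm[_ h]; right.
  by apply: (normc_gt_near h); rewrite subrr normc0.
pose e := (normc (trig_eval a (walk B n t w)) - L) / 2.
have e0 : 0 < e by rewrite divr_gt0// subr_gt0.
have [del del0 hd] := trig_eval_close e0.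
have [del' del'0 hs] := stopped_right_continuous (@cc n w) t0 del0.
have [m1 h1] := eventually_mesh del'0.
(* The grid time chosen is below t + h <= t + 1 <= m + 1, so its index is at most [steps m]. *)
have [m2 h2] := eventually_ge (t + 1).
have [m3 h3] := eventually_trig_eval w e0.
exists (maxn m1 (maxn m2 m3)) => m; rewrite !geq_max => /and3P[/h1 md /h2 tm /h3[hV _]].
left; exists n; have [k /andP[k1 k2]] := grid_index (mesh_gt0 R m) t0.
exists k.
  rewrite -(ler_nat R) -(ler_pM2r (mesh_gt0 R m)) steps_meshE.
  apply: (le_trans (ltW k2)); apply: le_trans tm; rewrite lerD2l.
  by rewrite /mesh invf_le1 ?ltr0n// ler1n.
have h : normc (trig_eval a (walk B n (k%:R * mesh m) w) - trig_eval a (walk B n t w)) < e.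
  apply: hd => l; first exact: normc_walk_le1.
  rewrite !tnth_mktuple; case: ifP => _; first by rewrite subrr normc0.
  case: eqP => [_|_]; last by rewrite subrr normc0.
  by apply: hs => //; apply: (lt_trans k2); rewrite ltrD2l.
exact: (normc_gt_near h (hV n k)).
Qed.

Lemma normc_le_near (u z : R[i]) (L L' : R) : normc u <= L ->
  normc (z - u) < L' - L -> ~ L' < normc z.
Proof.
move=> uL zu; have := lerB_normc z u; move: (normc (z - u)) zu => p.
by move: (normc z) (normc u) uL => q r; lra.
Qed.

(** The approximation at grid times is uniform in the index, so all approximate values stay within
    L' - L of true ones at once. No mesh achieves this for L' = L in general. *)
Lemma eventually_nohit w (L L' : R) : (brownian_max B a w <= L%:E)%E -> L < L' ->
  eventually (fun m => ~ hit_approx m L' w).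
Proof.
move=> /ereal_supP hG LL'; have e0 : 0 < L' - L by rewrite subr_gt0.
have [m0 hm] := eventually_trig_eval w e0; exists m0 => m /hm[h1 h2].
case=> [[n [k _]]|].
  apply: (normc_le_near _ (h1 n k)); rewrite -lee_fin; apply: hG; left.
  by exists n, (k%:R * mesh m) => //; rewrite mulr_ge0// ltW// mesh_gt0.
by apply: (normc_le_near _ h2); rewrite -lee_fin; apply: hG; right.
Qed.

Lemma cmeasurable_exit_approx m l : cmeasurable (exit_approx m l).
Proof.
apply: cmeasurable_if; [|exact: (cmeasurable_stopped_sum bmB (mesh_gt0 R m))|exact: cmeasurable_cst].
apply: (measurable_fun_bool true); rewrite setTI.
rewrite (_ : _ @^-1` _ = ~` no_exit B l); last first.
  by apply/seteqP; split=> w /=; rewrite /no_exit /= ltey; [move/eqP|move=> /eqP].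
by apply: measurableC; exact: (measurable_no_exit bmB).
Qed.

Lemma measurable_hit_approx m L : measurable (hit_approx m L).
Proof.
have mn (Z : Omega -> N.-tuple R[i]) : (forall l, cmeasurable (fun w => tnth (Z w) l)) ->
    measurable [set w | L < normc (trig_eval a (Z w))].
  move=> mZ; apply: measurable_normc_gt; apply: cmeasurable_trig_eval => //.
  by apply/measurable_fun_tnthP => l; apply/cmeasurableP; exact: mZ.
rewrite (_ : hit_approx m L = (\bigcup_(n in [set: 'I_N])
    \bigcup_(k in [set k | (k <= steps m)%N])
      [set w | L < normc (trig_eval a (walk_approx m n k w))]) `|`
    [set w | L < normc (trig_eval a (walk_end_approx m w))]).
  apply: measurableU.
    apply: fin_bigcup_measurable => // n _; apply: bigcup_measurable => k _.
    apply: mn => l; under eq_fun do rewrite tnth_mktuple.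
    case: (l < n)%N; first exact: cmeasurable_exit_approx.
    by case: (l == n); [exact: (cmeasurable_stopped_sum bmB (mesh_gt0 R m))|exact: cmeasurable_cst].
  by apply: mn => l; under eq_fun do rewrite tnth_mktuple; exact: cmeasurable_exit_approx.
apply/seteqP; split=> w [].
- by move=> [n [k kK hk]]; left; exists n => //; exists k.
- by right.
- by move=> [n _ [k kK hk]]; left; exists n, k.
- by right.
Qed.

(** The event is the union over p of the lower limits of [hit_approx] at the levels L + 1/(p+1).
    Omega is an arbitrary measurable space, so this has to hold at every point and not just almost
    surely. *)
Lemma measurable_brownian_max (L : R) : measurable [set w | (L%:E < brownian_max B a w)%E].
Proof.
rewrite (_ : [set _ | _] = \bigcup_p \bigcup_m0 \bigcap_(m in [set m | (m0 <= m)%N])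
    hit_approx m (L + p.+1%:R^-1)).
  apply: bigcupT_measurable => p; apply: bigcupT_measurable => m0.
  by apply: bigcap_measurableType => m _; exact: measurable_hit_approx.
apply/seteqP; split=> w /=.
  move=> hL; suff [p hp] : exists p : nat, ((L + p.+1%:R^-1)%:E < brownian_max B a w)%E.
    by have [m0 hm] := eventually_hit hp; exists p => //; exists m0.
  case: (brownian_max B a w) hL => [r| |]//; last by exists 0%N; rewrite ltry.
  by rewrite lte_fin => /ltr_add_invr[p hp]; exists p; rewrite lte_fin.
move=> [p _ [m0 _ hm]]; rewrite ltNge; apply/negP => /eventually_nohit.
move=> /(_ (L + p.+1%:R^-1)); rewrite ltrDl invr_gt0 => /(_ (ltr0Sn _ _))[m1 h1].
exact: (h1 _ (leq_maxr m0 m1)) (hm _ (leq_maxl m0 m1)).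
Qed.

Definition some_no_exit : set Omega := \bigcup_(l in [set: 'I_N]) no_exit B l.

Lemma measurable_some_no_exit : measurable some_no_exit.
Proof. by apply: fin_bigcup_measurable => // l _; exact: (measurable_no_exit bmB). Qed.

Lemma some_no_exit0 : P some_no_exit = 0.
Proof.
apply: measure_negligible; first exact: measurable_some_no_exit.
rewrite /some_no_exit bigcup_fset_set//; last exact: finite_finset.
apply: big_ind => [|X Y|l _]; [exact: negligible_set0|exact: negligibleU|].
by apply/negligibleP; [exact: (measurable_no_exit bmB)|exact: (no_exit0 bmB)].
Qed.

(** When every motion exits, step n K + k of [dwalk] is the approximate walk at (n, k), and the very
    last step is the approximation of [walk_end]. *)
Lemma hit_approxE m (L : R) w : ~ some_no_exit w ->
  hit_approx m L w <->
  hit (fun j => trig_eval a (dwalk B (mesh m) (steps m) j w)) L (N * steps m).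
Proof.
move=> Nw; have fin l : (exit_time (B l) w < +oo)%E.
  by rewrite ltey; apply/eqP => e; apply: Nw; exists l.
have VE n k : (k <= steps m)%N ->
    walk_approx m n k w = dwalk B (mesh m) (steps m) (n * steps m + k) w.
  move=> kK; apply: eq_from_tnth => l; rewrite [RHS](tnth_dwalk _ (mesh_gt0 R m))// [LHS]tnth_mktuple.
  rewrite /exit_approx fin; case: ifP => // _; case: ifP => // _.
  by rewrite /stopped_sum big_ord0.
have EE : walk_end_approx m w = dwalk B (mesh m) (steps m) (N * steps m) w.
  apply: eq_from_tnth => l; rewrite !tnth_mktuple /exit_approx fin.
  rewrite (minn_idPl _)// -mulnBl leq_pmull// subn_gt0//.
split=> [[[n [k kK hL]]|hL]|/existsP[[j jM] /= hj]].
- apply/existsP; have jM : (n * steps m + k < (N * steps m).+1)%N.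
    rewrite ltnS; apply: (@leq_trans (n.+1 * steps m)); last by rewrite leq_mul2r ltn_ord orbT.
    by rewrite mulSn addnC leq_add2r.
  by exists (Ordinal jM); rewrite /= -VE.
- by apply/existsP; exists ord_max; rewrite /= -EE.
- move: jM; rewrite ltnS leq_eqVlt => /predU1P[jE|jM].
    by right; rewrite EE -jE.
  have [n [k kK jE]] := dwalk_step jM; left; exists n, k; first exact: ltnW.
  by rewrite (VE n k (ltnW kK)) -jE; exact: hj.
Qed.

End convergence.

(** * The good-lambda inequality for the Brownian maxima *)

Section limit.
Context d (Omega : measurableType d) (R : realType) (P : probability Omega R).
Variables (N : nat) (B : 'I_N -> R -> Omega -> R[i]).
Hypothesis bmB : independent_complex_bm P B.

Definition dhit (a : coefs R N) (m : nat) (L : R) : set Omega := [set w |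
  hit (fun j => trig_eval a (dwalk B (mesh R m) (steps m) j w)) L (N * steps m)].

Section one_polynomial.
Variable a : coefs R N.
Hypothesis ta : is_trig_poly a.

Lemma measurable_dhit m L : measurable (dhit a m L).
Proof.
apply: measurable_hit => j _; apply: cmeasurable_trig_eval => //.
by apply: (measurable_dwalk bmB); exact: mesh_gt0.
Qed.

Lemma eventually_dhit_le (L e : R) : 0 < e -> eventually (fun m =>
  fine (P [set w | (L%:E < brownian_max B a w)%E]) <= fine (P (dhit a m L)) + e).
Proof.
apply: (eventually_prob_le (measurable_brownian_max bmB ta L)
  (measurable_some_no_exit bmB) _ (some_no_exit0 bmB)) => [m|w Nw /= hL].
  exact: measurable_dhit.
have [m0 hm] := eventually_hit bmB ta hL; exists m0 => m /hm.
by move/(hit_approxE a m L Nw).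
Qed.

Lemma eventually_dhit_ge (L L' e : R) : L < L' -> 0 < e -> eventually (fun m =>
  fine (P (dhit a m L')) <= fine (P [set w | (L%:E < brownian_max B a w)%E]) + e).
Proof.
move=> LL'; apply: (eventually_prob_ge (measurable_brownian_max bmB ta L)
  (measurable_some_no_exit bmB) _ (some_no_exit0 bmB)) => [m|w Nw /= /negP].
  exact: measurable_dhit.
rewrite -leNgt => hL; have [m0 hm] := eventually_nohit bmB ta hL LL'.
by exists m0 => m /hm h hd; apply: h; apply/(hit_approxE a m L' Nw).
Qed.

End one_polynomial.

Variable f : coefs R N.
Hypotheses (N0 : (0 < N)%N) (tf : is_trig_poly f) (rf : real_on_torus f).
Hypothesis f0 : torus_mean f = 0.

(** The discrete inequality at levels l, L and x/2 is compared with the Brownian events at l0 < l, L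
    and x/4 < x/2. A failure would leave a positive gap, which the errors of a fine enough mesh
    cannot fill. *)
Lemma brownian_good_lambda (l0 l L x : R) : 0 <= l0 -> l0 < l -> l < L -> 0 < x ->
  (L - l) ^+ 2 * fine (P [set w | (L%:E < brownian_max B (analytic_completion f) w)%E]) <=
  4 * x ^+ 2 * fine (P [set w | (l0%:E < brownian_max B (analytic_completion f) w)%E]) +
  32 * L ^+ 2 * fine (P [set w | ((x / 4)%:E < brownian_max B f w)%E]).
Proof.
move=> l00 l0l lL x0; have tg := is_trig_poly_completion tf.
set g := analytic_completion f in tg *.
set pL := fine _; set pl := fine _; set pF := fine _.
have g0 : g 0 = 0 by rewrite /g analytic_completionE// -trig_coef0// f0 mul0r.
rewrite leNgt; apply/negP => hlt.
(* C is the sum of the factors that multiply the four errors e, so that the total error C e is half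
   of the assumed gap. *)
pose C := (L - l) ^+ 2 + 4 * x ^+ 2 + 32 * L ^+ 2 + 34.
have q1 := sqr_ge0 (L - l); have q2 := sqr_ge0 x; have q3 := sqr_ge0 L.
have C0 : 0 < C.
  by rewrite /C; move: ((L - l) ^+ 2) (x ^+ 2) (L ^+ 2) q1 q2 q3 => q r s; lra.
pose e := ((L - l) ^+ 2 * pL - (4 * x ^+ 2 * pl + 32 * L ^+ 2 * pF)) / (2 * C).
have e0 : 0 < e by rewrite divr_gt0 ?subr_gt0// mulr_gt0.
have xx : x / 4 < x / 2 by lra.
have [m [[hL hl] [hF [Rm [iR eR] gR]]]] : exists m,
    (pL <= fine (P (dhit g m L)) + e /\ fine (P (dhit g m l)) <= pl + e) /\
    (fine (P (dhit f m (x / 2))) <= pF + e /\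
     exists2 Rm : Omega -> R, expect_le P Rm e & forall j w, (j < N * steps m)%N ->
       normc (trig_eval g (dwalk B (mesh R m) (steps m) j.+1 w) -
              trig_eval g (dwalk B (mesh R m) (steps m) j w)) ^+ 2 <= Rm w).
  have [m0 hm] := eventually_and
    (eventually_and (eventually_dhit_le tg L e0) (eventually_dhit_ge tg l0l e0))
    (eventually_and (eventually_dhit_ge tf xx e0) (small_increments bmB tg e0)).
  by exists m0; exact: hm.
have g_an k (n : 'I_N) : g k != 0 ->
    (forall i : 'I_N, (n < i)%N -> k i = 0) -> 0 <= k n.
  exact: analytic_completion_ge0.
have M0 : (0 < N * steps m)%N by rewrite muln_gt0 N0.
have := discrete_good_lambda bmB (mesh_gt0 R m) tg g_an g0
  (le_trans l00 (ltW l0l)) lL (ltW x0) iR gR M0.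
rewrite -/(dhit g m L) -/(dhit g m l).
(* The real part of g is f along the discrete walk too, so this event concerns the discrete path of
   f. *)
rewrite (_ : [set w | hit _ (x / 2) _] = dhit f m (x / 2)); last first.
  have fg z : (complex.Re (trig_eval g z))%:C = trig_eval f z.
    by rewrite /g -Re_analytic_completion.
  apply/funext => w; congr (is_true (hit _ _ _)); apply/funext => i; exact: fg.
have : e * (2 * C) = (L - l) ^+ 2 * pL - (4 * x ^+ 2 * pl + 32 * L ^+ 2 * pF).
  by rewrite /e divfK// gt_eqF// mulr_gt0.
have := ler_wpM2l q1 hL; have := ler_wpM2l q2 hl; have := ler_wpM2l q3 hF.
have : 0 < e * C by rewrite mulr_gt0.
rewrite /C; move: e0 eR; move: (fine _) (fine _) (fine _) => a1 a2 a3.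
by move: ((L - l) ^+ 2) (x ^+ 2) (L ^+ 2) => q r s; lra.
Qed.

End limit.

(** The inequality between the levels lambda and L = beta lambda is used with l halfway between
    them, so that L - l = (beta - 1) lambda / 2, and with x = e lambda; by homogeneity lambda^2 then
    cancels. *)
Theorem lemma2p4 (R : realType) (alpha beta : R) :
  1 <= alpha -> 1 < beta ->
  exists c : R, 0 < c /\
  forall (N : nat) (f : coefs R N),
    (0 < N)%N ->
    is_trig_poly f ->
    real_on_torus f ->
    torus_mean f = 0 ->
  forall (d : measure_display) (Omega : measurableType d)
    (P : probability Omega R) (B : 'I_N -> R -> Omega -> R[i]),
    independent_complex_bm P B ->
  forall lambda : R, 0 < lambda ->
  let Fmax := brownian_max B f in
  let Gmax := brownian_max B (analytic_completion f) in
  (P [set w | lambda%:E < Gmax w] <=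
     alpha%:E * P [set w | (beta * lambda)%:E < Gmax w])%E ->
  (P [set w | lambda%:E < Gmax w] <=
     c%:E * P [set w | lambda%:E < c%:E * Fmax w])%E.
Proof.
move=> a1 b1; have a0 : 0 < alpha by lra.
have b0 : 0 < beta - 1 by lra.
(* e makes 16 alpha e^2 <= (beta - 1)^2 / 4. *)
pose e := (beta - 1) / (8 * alpha).
have e0 : 0 < e by rewrite divr_gt0// mulr_gt0.
(* The first summand is the constant that absorption produces; the second gives e c >= 4, so that
   the level lambda / c is at most e lambda / 4. *)
pose c := 256 * alpha * beta ^+ 2 / (beta - 1) ^+ 2 + 32 * alpha / (beta - 1).
have c1 : 0 < 256 * alpha * beta ^+ 2 / (beta - 1) ^+ 2.
  by rewrite divr_gt0 ?exprn_gt0// mulr_gt0 ?exprn_gt0 ?mulr_gt0//; lra.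
have c2 : 0 < 32 * alpha / (beta - 1) by rewrite divr_gt0// mulr_gt0.
have c0 : 0 < c by rewrite addr_gt0.
exists c; split=> // N f N0 tf rf f0 d Omega P B bmB lambda l0 Fmax Gmax hG.
have tg := is_trig_poly_completion tf.
have fin X : measurable X -> P X \is a fin_num by move=> mX; exact: fin_num_measure.
have mG r : measurable [set w | (r%:E < Gmax w)%E] by exact: (measurable_brownian_max bmB).
have mF r : measurable [set w | (r%:E < Fmax w)%E] by exact: (measurable_brownian_max bmB).
have Lc : [set w | (lambda%:E < c%:E * Fmax w)%E] = [set w | ((lambda / c)%:E < Fmax w)%E].
  by apply/funext => w; rewrite /= -lte_pdivrMl// -EFinM [c^-1 * _]mulrC.
rewrite Lc; apply: (@le_trans _ _ (c%:E * P [set w | ((e * lambda / 4)%:E < Fmax w)%E])%E);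
  last first.
  rewrite lee_pmul2l//; apply: le_measure; rewrite ?inE// => w /=; apply: le_lt_trans.
  rewrite lee_fin ler_pdivrMr//.
  have ce : e * c = e * (256 * alpha * beta ^+ 2 / (beta - 1) ^+ 2) + 4.
    rewrite /c mulrDr; congr (_ + _); rewrite /e; field.
    by rewrite !gt_eqF.
  have : 4 <= e * c by rewrite ce lerDr mulr_ge0// ltW.
  have -> : e * lambda / 4 * c = lambda * (e * c) / 4 by ring.
  by move: (e * c) => ec; nra.
move: hG; rewrite -(fineK (fin _ (mG lambda))).
rewrite -(fineK (fin _ (mG (beta * lambda)))) -(fineK (fin _ (mF (e * lambda / 4)))).
rewrite -!EFinM !lee_fin => hG.
have := @brownian_good_lambda _ _ _ P N B bmB f N0 tf rf f0 lambda
  (lambda * (1 + beta) / 2) (beta * lambda) (e * lambda) (ltW l0).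
rewrite -/Fmax -/Gmax.
have -> : lambda < lambda * (1 + beta) / 2 by nra.
have -> : lambda * (1 + beta) / 2 < beta * lambda by nra.
rewrite mulr_gt0// => /(_ isT isT isT).
have pF0 : 0 <= fine (P [set w | ((e * lambda / 4)%:E < Fmax w)%E]) by rewrite fine_ge0.
have pG0 : 0 <= fine (P [set w | (lambda%:E < Gmax w)%E]) by rewrite fine_ge0.
move: hG pF0 pG0; set pB := fine (P [set w | ((beta * lambda)%:E < _)%E]).
set pF := fine (P [set w | ((e * lambda / 4)%:E < _)%E]); set p := fine (P _).
move: pB pF p => pB pF p hG pF0 pG0.
have -> : (beta * lambda - lambda * (1 + beta) / 2) ^+ 2 * pB =
    lambda ^+ 2 * ((beta - 1) ^+ 2 / 4 * pB) by field.
have -> : 4 * (e * lambda) ^+ 2 * p + 32 * (beta * lambda) ^+ 2 * pF =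
    lambda ^+ 2 * (4 * e ^+ 2 * p + 32 * beta ^+ 2 * pF) by ring.
rewrite ler_pM2l ?exprn_gt0// => h.
have d0 : 0 < (beta - 1) ^+ 2 by rewrite exprn_gt0.
have ea : 64 * alpha ^+ 2 * e ^+ 2 = (beta - 1) ^+ 2 by rewrite /e; field; rewrite gt_eqF.
have e2 : 0 <= e ^+ 2 by exact: sqr_ge0.
(* The hypothesis on lambda bounds p by alpha times the probability at the higher level, to which
   the good-lambda inequality, multiplied by 4 alpha, applies. *)
have h1 : (beta - 1) ^+ 2 * p <= 16 * alpha * e ^+ 2 * p + 128 * alpha * beta ^+ 2 * pF.
  apply: (@le_trans _ _ (4 * alpha * ((beta - 1) ^+ 2 / 4 * pB))).
    by have := ler_wpM2l (ltW d0) hG; move: ((beta - 1) ^+ 2) => q; nra.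
  by have := ler_wpM2l (ltW (mulr_gt0 (ltr0n R 4) a0)) h; lra.
(* At most a quarter of the left side returns on the right, because alpha >= 1; this is the term
   that is absorbed. *)
have h2 : 16 * alpha * e ^+ 2 * p <= (beta - 1) ^+ 2 / 4 * p.
  have a10 : 0 <= alpha - 1 by rewrite subr_ge0.
  rewrite ler_wpM2r// -ea; have := mulr_ge0 (mulr_ge0 (ltW a0) a10) e2.
  by move: (e ^+ 2) => q; lra.
apply: (@le_trans _ _ (256 * alpha * beta ^+ 2 / (beta - 1) ^+ 2 * pF)); last first.
  by rewrite ler_wpM2r// lerDl ltW.
rewrite mulrAC ler_pdivlMr//.
have : 0 <= alpha * beta ^+ 2 * pF by rewrite mulr_ge0// mulr_ge0 ?sqr_ge0// ltW.
by move: h1 h2; move: ((beta - 1) ^+ 2) => q; lra.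
Qed.
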